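(* Let $n\ge 8$, $p\in[1,2]$, let $N\ge 1$ and $m\ge 1$ be integers and $t>0$. Let ARDFDS (defined in the context) be applied with these parameters to the problem $\min_{x\in\mathbb{R}^n} f(x)$, where $f(x)=\mathbb{E}_\xi[F(x,\xi)]$, let $x^*$ be an arbitrary minimizer of $f$ on $\mathbb{R}^n$, and let $\Theta_p$ be such that $V[z_0](x^* )\le\Theta_p$. Then $$\mathbb{E}[f(y_N)]-f(x^* )\le \frac{384\,n^2\rho_nL_2\Theta_p}{N^2}+\frac{384N}{nL_2}\frac{\sigma^2}{m}+\frac{12\sqrt{2n\Theta_p}}{N^2}\Big(\frac{L_2t}{2}+\frac{2\Delta}{t}\Big)+\frac{6N}{L_2}\Big(L_2^2t^2+\frac{16\Delta^2}{t^2}\Big)+\frac{N^2}{24n\rho_nL_2}\Big(L_2^2t^2+\frac{16\Delta^2}{t^2}\Big),$$ where $\mathbb{E}$ is the expectation over all random directions and all samples of $\xi$ used by the algorithm.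
   Context: Problem. $\xi$ is a random vector with distribution $P$ on $\mathcal{X}$; $f(x)=\mathbb{E}_\xi[F(x,\xi)]$ is a closed convex function on $\mathbb{R}^n$ having a minimizer ($F(\cdot,\xi)$ itself need not be convex). Almost surely in $\xi$, $F(\cdot,\xi)$ has a gradient $g(x,\xi)$ with $\|g(x,\xi)-g(y,\xi)\|_2\le L(\xi)\|x-y\|_2$ for all $x,y$. The constant $L_2>0$ satisfies $\sqrt{\mathbb{E}_\xi L(\xi)^2}\le L_2$; consequently $\mathbb{E}_\xi g(x,\xi)=\nabla f(x)$ and $\nabla f$ is $L_2$-Lipschitz in $\|\cdot\|_2$. For all $x$, $\mathbb{E}_\xi\|g(x,\xi)-\nabla f(x)\|_2^2\le\sigma^2$. Oracle. Given a pair of points $(x,y)$, an oracle call returns $(\widetilde f(x,\xi),\widetilde f(y,\xi))$ for one sample $\xi\sim P$ (the same for both points), where $\widetilde f(x,\xi)=F(x,\xi)+\eta(x,\xi)$ and $|\eta(x,\xi)|\le\Delta$ for all $x\in\mathbb{R}^n$, a.s. in $\xi$. All functions are measurable, so that expectations make sense. Proximal setup. $\|x\|_p$ is the $\ell_p$ norm, $q\in[2,\infty]$ with $\frac1p+\frac1q=1$. The prox-function $d:\mathbb{R}^n\to\mathbb{R}$ is continuous, differentiable and $1$-strongly convex w.r.t. $\|\cdot\|_p$, i.e. $d(y)-d(x)-\langle\nabla d(x),y-x\rangle\ge\frac12\|y-x\|_p^2$ for all $x,y$, with $\min d=0$. $V[z](x)=d(x)-d(z)-\langle\nabla d(z),x-z\rangle$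 is the Bregman divergence. $\rho_n=\min\{q-1,\,16\ln n-8\}\,n^{2/q-1}$ (for $q=\infty$, $2/q=0$ and $q-1=\infty$). Gradient approximation. For $e$ in the unit Euclidean sphere and samples $\xi_1,\dots,\xi_m$, $\widetilde\nabla^m f^t(x)=\frac1m\sum_{i=1}^m\frac{\widetilde f(x+te,\xi_i)-\widetilde f(x,\xi_i)}{t}\,e$. ARDFDS. Input $x_0\in\mathbb{R}^n$, $N,m\ge1$, $t>0$. Set $y_0=z_0=x_0$ and $\alpha_k=\frac{k+1}{96n^2\rho_nL_2}$. For $k=0,\dots,N-1$: draw $e_{k+1}$ uniformly from the unit Euclidean sphere of $\mathbb{R}^n$ and $m$ independent copies $\xi_1^{k+1},\dots,\xi_m^{k+1}$ of $\xi$, all independent of each other and of previous iterations; set $\tau_k=\frac{2}{k+2}$ and $x_{k+1}=\tau_kz_k+(1-\tau_k)y_k$; compute $\widetilde\nabla^m f^t(x_{k+1})$ with $e=e_{k+1}$ and $\xi_i=\xi_i^{k+1}$; set $y_{k+1}=x_{k+1}-\frac1{2L_2}\widetilde\nabla^m f^t(x_{k+1})$ and $z_{k+1}=\arg\min_{z\in\mathbb{R}^n}\{\alpha_{k+1}n\langle\widetilde\nabla^m f^t(x_{k+1}),z-z_k\rangle+V[z_k](z)\}$. Output $y_N$. *)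

(* Defs.v *)
From HB Require Import structures.
From mathcomp Require Import all_boot all_order all_algebra.
From mathcomp Require Import all_classical all_reals all_analysis.

Set Implicit Arguments.
Unset Strict Implicit.
Unset Printing Implicit Defensive.

Import Order.TTheory GRing.Theory Num.Theory.
Import numFieldNormedType.Exports.

Local Open Scope classical_set_scope.
Local Open Scope ring_scope.

(* MathComp-Analysis puts no sigma-algebra on row vectors: this abbreviation for
   'rV[R]_n carries the Borel one. *)
Notation borel_rV R n := (g_sigma_algebraType (@open 'rV[R]_n)).

Section Euclidean.
Context {R : realType} {n : nat}.
Implicit Types (x y : 'rV[R]_n) (f : 'rV[R]_n -> R).

Definition dot x y : R := \sum_i x 0 i * y 0 i.

Definition norm2 x : R := Num.sqrt (\sum_i x 0 i ^+ 2).

Definition normp (p : R) x : R := (\sum_i `|x 0 i| `^ p) `^ p^-1.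

(* The gradient collects the values of the Frechet differential on the
   canonical basis; it is meaningful only where f is differentiable. *)
Definition grad f x : 'rV[R]_n := \row_i 'd f x (delta_mx 0 i).

Definition has_gradient f x (v : 'rV[R]_n) : Prop :=
  differentiable f x /\ grad f x = v.

Definition minimizer f x : Prop := forall y, f x <= f y.

Definition closed_convex f : Prop :=
  closed [set u : 'rV[R]_n * R | f u.1 <= u.2] /\
  convex_function [set: convex_lmodType 'rV[R]_n] f.

(* The uniform distribution on the unit Euclidean sphere is the unique Borel
   probability measure on R^n carried by the sphere and invariant under all
   orthogonal transformations. *)
Definition uniform_sphere (mu : probability (borel_rV R n) R) : Prop :=
  mu [set x : borel_rV R n | norm2 x = 1] = 1%E /\
  forall U : 'M[R]_n, U *m U^T = 1%:M ->
  forall A : set (borel_rV R n), measurable A ->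
    mu [set x : borel_rV R n | A ((x : 'rV[R]_n) *m U)] = mu A.

End Euclidean.

(* The random variables of a family need not share a codomain, so independence
   is stated for the sigma-algebras they generate. *)
Definition independent d (T : measurableType d) (R : realType)
    (Q : probability T R) (I : finType) (G : I -> set (set T)) : Prop :=
  forall (J : {set I}) (A : I -> set T), (forall i, i \in J -> G i (A i)) ->
    Q (\bigcap_(i in [set` J]) A i) = (\prod_(i in J) Q (A i))%E.

Section Problem.
Context {R : realType} {n : nat} {d : measure_display} {X : measurableType d}.
Implicit Types (P : probability X R) (F eta : 'rV[R]_n -> X -> R).

Record stochastic_problem P F (f : 'rV[R]_n -> R)
    (g : 'rV[R]_n -> X -> 'rV[R]_n) (L : X -> R) (L2 sigma : R) : Prop := {
  measurable_F : measurable_fun [set: borel_rV R n * X] (fun u => F u.1 u.2) ;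
  measurable_g : measurable_fun [set: borel_rV R n * X]
    (fun u => g u.1 u.2 : borel_rV R n) ;
  measurable_L : measurable_fun [set: X] L ;
  integrable_F : forall x, P.-integrable [set: X] (EFin \o F x) ;
  objectiveE : forall x, ('E_P[F x] = (f x)%:E)%E ;
  closed_convex_f : closed_convex f ;
  gradient_F : {ae P, forall xi, forall x, has_gradient (F^~ xi) x (g x xi)} ;
  Lipschitz_g : {ae P, forall xi, forall x y,
    norm2 (g x xi - g y xi) <= L xi * norm2 (x - y)} ;
  L2_gt0 : 0 < L2 ;
  L2_bound : (sqrte 'E_P[fun xi => (L xi ^+ 2)%R] <= L2%:E)%E ;
  variance_g : forall x,
    ('E_P[fun xi => (norm2 (g x xi - grad f x) ^+ 2)%R] <= (sigma ^+ 2)%:E)%E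
}.

Definition oracle_noise P eta (Delta : R) : Prop :=
  measurable_fun [set: borel_rV R n * X] (fun u => eta u.1 u.2) /\
  {ae P, forall xi, forall x, `|eta x xi| <= Delta}.

Definition oracle F eta (x : 'rV[R]_n) (xi : X) : R := F x xi + eta x xi.

Definition grad_estimate (ft : 'rV[R]_n -> X -> R) (t : R) (m : nat)
    (e : 'rV[R]_n) (xi : 'I_m -> X) (x : 'rV[R]_n) : 'rV[R]_n :=
  m%:R^-1 *: \sum_(i < m) (((ft (x + t *: e) (xi i) - ft x (xi i)) / t) *: e).

End Problem.

Section Proximal.
Context {R : realType} {n : nat}.

Record prox_function (p : R) (d : 'rV[R]_n -> R) : Prop := {
  prox_continuous : continuous d ;
  prox_differentiable : forall x, differentiable d x ;
  prox_strongly_convex : forall x y,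
    2^-1 * normp p (y - x) ^+ 2 <= d y - d x - dot (grad d x) (y - x) ;
  prox_min0 : exists2 x, d x = 0 & minimizer d x
}.

Definition bregman (d : 'rV[R]_n -> R) (z x : 'rV[R]_n) : R :=
  d x - d z - dot (grad d z) (x - z).

End Proximal.

(* Meaningful for 2 <= q; the last case is q = +oo, where 2 / q = 0 and
   q - 1 = +oo drops out of the minimum. *)
Definition rho (R : realType) (n : nat) (q : \bar R) : R :=
  match q with
  | q%:E => Num.min (q - 1) (16 * ln n%:R - 8) * n%:R `^ (2 / q - 1)
  | _ => (16 * ln n%:R - 8) * n%:R `^ (- 1)
  end.

Section Algorithm.
Context {R : realType} {n : nat} {d d' : measure_display}.
Context {X : measurableType d} {Omega : measurableType d'}.
Context {N m : nat}.
Implicit Types (e : 'I_N -> {mfun Omega >-> borel_rV R n})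
  (xi : 'I_N -> 'I_m -> {mfun Omega >-> X}).

(* e k and xi k i are the direction and the samples drawn at iteration k, that
   is e_{k+1} and xi_i^{k+1} in the usual indexing. *)
Record ardfds_sampling (Q : probability Omega R) (P : probability X R) e xi
    : Prop := {
  direction_uniform : forall k, uniform_sphere (distribution Q (e k)) ;
  sample_distribution : forall k i (A : set X), measurable A ->
    distribution Q (xi k i) A = P A ;
  sampling_independent :
    independent Q (fun j : 'I_N + 'I_N * 'I_m => match j with
      | inl k => g_sigma_algebra_preimage (e k)
      | inr (k, i) => g_sigma_algebra_preimage (xi k i)
      end)
}.

Definition ardfds_alpha (q : \bar R) (L2 : R) (k : nat) : R :=
  k.+1%:R / (96 * n%:R ^+ 2 * rho n q * L2).

Definition ardfds_tau (k : nat) : R := 2 / k.+2%:R.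

Record ardfds (ft : 'rV[R]_n -> X -> R) (prox : 'rV[R]_n -> R) (q : \bar R)
    (L2 t : R) (x0 : 'rV[R]_n) e xi (x y z : nat -> Omega -> 'rV[R]_n)
    (G := fun (k : 'I_N) w =>
       grad_estimate ft t (e k w) (fun i => xi k i w) (x k.+1 w))
    : Prop := {
  ardfds_y0 : forall w, y 0%N w = x0 ;
  ardfds_z0 : forall w, z 0%N w = x0 ;
  ardfds_x : forall (k : 'I_N) w,
    x k.+1 w = ardfds_tau k *: z k w + (1 - ardfds_tau k) *: y k w ;
  ardfds_y : forall (k : 'I_N) w,
    y k.+1 w = x k.+1 w - (2 * L2)^-1 *: G k w ;
  ardfds_z : forall (k : 'I_N) w,
    minimizer (fun u => ardfds_alpha q L2 k.+1 * n%:R * dot (G k w) (u - z k w)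
                        + bregman prox (z k w) u)
      (z k.+1 w)
}.

End Algorithm.

(* Main.v *)
(* At a fixed state (y, grad d (z)) the iteration is analysed by linear coupling,
   and the estimate is averaged over the past by Tonelli's theorem, the state
   being a function of the past samples only.

   A direction [e] uniform on the sphere is known only through its rotation
   invariance; reflections suffice. They give
   E [<s, e> <r, e> D e] = <s, r> E [D e] / n for every weight [D] invariant under
   sign changes and transpositions of the coordinates, and, by comparing the
   coefficients of b^2 in E (e_i + b e_j)^(2k), E [e_i ^ (2k)] <= (2k / n)^k.
   The square of the dual norm of [e] is dominated by a weight
   D e = a + b * sum_i e_i ^ (2k) (with 2k close to q or to log n), whose mean is
   then at most 8 rho_n; this is what the mirror step needs.

   The dual variable grad d (z) moves by an explicit increment, and
   (grad d)^-1 is 1-Lipschitz by strong convexity, so the iterates are measurable.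

   The bias of the finite difference, at most Z = L t / 2 + 2 Delta / t up to
   averaging, enters as Z |<e, z - x*>| <= l Z^2 / 2 + <e, z - x*>^2 / (2 l). With
   l of order N^2 the second term multiplies the potential V[z] at x* by 1 + a_k
   where the a_k sum to 1 / 2, hence by a factor at most 2 over the whole run. *)

Require Import Defs.
From HB Require Import structures.
From mathcomp Require Import all_boot all_order all_algebra.
From mathcomp Require Import all_classical all_reals all_analysis.
From mathcomp Require Import perm measurable_realfun.
From mathcomp Require Import ring lra zify.

Set Implicit Arguments.
Unset Strict Implicit.
Unset Printing Implicit Defensive.

Import Order.TTheory GRing.Theory Num.Theory.
Import numFieldNormedType.Exports.

Local Open Scope classical_set_scope.
Local Open Scope ring_scope.

(** * Vectors *)

(** The weight keeps the dual norm of [e] apart from the gradient: the mean of [<gm, e>^2 D e]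
    factors exactly into the mean of [|gm|^2] times [E [D e] / n], so no concentration of [e] is
    needed and the dual norm costs only the mean of [D]. The step sizes make this cost [K / (6 L2)],
    half of the decrease [K / (3 L2)] that the gradient step yields, where [K] weighs the gap of [f]
    in the potential; the gradient terms then disappear and only variance and bias are left to sum.
    No conditional expectation appears. A block of samples is represented by the identity of the
    sample space, seen with the sigma-algebra generated by that block; independence of two blocks
    makes their joint law a product, and Tonelli's theorem averages over one with the other frozen.
    No derivative is moved through an expectation either. The coordinatewise mean [mean_grad] of [g]
    inherits the quadratic Taylor bound of the realizations of [F], and convexity of [f] then makes
    it a subgradient, which is all that linear coupling asks of it. *)

Section Vectors.
Context {R : realType} {n : nat}.
Implicit Types (u v w x y : 'rV[R]_n) (a p : R).

Lemma dotC x y : dot x y = dot y x.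
Proof. by apply: eq_bigr => i _; rewrite mulrC. Qed.

Lemma dotDl x y w : dot (x + y) w = dot x w + dot y w.
Proof. by rewrite /dot -big_split; apply: eq_bigr => i _; rewrite mxE mulrDl. Qed.

Lemma dotZl a x y : dot (a *: x) y = a * dot x y.
Proof. by rewrite /dot mulr_sumr; apply: eq_bigr => i _; rewrite mxE mulrA. Qed.

Lemma dotNl x y : dot (- x) y = - dot x y.
Proof. by rewrite -scaleN1r dotZl mulN1r. Qed.

Lemma dotBl x y w : dot (x - y) w = dot x w - dot y w.
Proof. by rewrite dotDl dotNl. Qed.

Lemma dotDr x y w : dot w (x + y) = dot w x + dot w y.
Proof. by rewrite !(dotC w) dotDl. Qed.

Lemma dotZr a x y : dot x (a *: y) = a * dot x y.
Proof. by rewrite !(dotC x) dotZl. Qed.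

Lemma dotNr x y : dot x (- y) = - dot x y.
Proof. by rewrite !(dotC x) dotNl. Qed.

Lemma dotBr x y w : dot w (x - y) = dot w x - dot w y.
Proof. by rewrite !(dotC w) dotBl. Qed.

Lemma dot0l x : dot 0 x = 0.
Proof. by rewrite /dot big1// => i _; rewrite mxE mul0r. Qed.

Lemma dot_suml (I : finType) (G : I -> 'rV[R]_n) x :
  dot (\sum_i G i) x = \sum_i dot (G i) x.
Proof.
by apply: (big_morph (fun v => dot v x)) => [u v|]; [rewrite dotDl|rewrite dot0l].
Qed.

Lemma dotxx x : dot x x = \sum_i x 0 i ^+ 2.
Proof. by apply: eq_bigr => i _; rewrite expr2. Qed.

Lemma dotxx_ge0 x : 0 <= dot x x.
Proof. by rewrite dotxx sumr_ge0// => i _; rewrite sqr_ge0. Qed.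

Lemma norm2_ge0 x : 0 <= norm2 x.
Proof. exact: sqrtr_ge0. Qed.

Lemma norm2_sq x : norm2 x ^+ 2 = dot x x.
Proof. by rewrite /norm2 -dotxx sqr_sqrtr// dotxx_ge0. Qed.

Lemma norm2E x : norm2 x = Num.sqrt (dot x x).
Proof. by rewrite /norm2 dotxx. Qed.

Lemma norm2Z a x : norm2 (a *: x) = `|a| * norm2 x.
Proof.
by rewrite !norm2E dotZl dotZr mulrA -expr2 sqrtrM ?sqr_ge0// sqrtr_sqr.
Qed.

Lemma norm2_delta i : norm2 (delta_mx 0 i : 'rV[R]_n) = 1.
Proof.
rewrite /norm2 (bigD1 i)//= mxE !eqxx expr1n big1 ?addr0 ?sqrtr1// => j ji.
by rewrite mxE (negbTE ji) andbF expr0n.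
Qed.

Lemma dot_delta x i : dot x (delta_mx 0 i) = x 0 i.
Proof.
rewrite /dot (bigD1 i)//= mxE !eqxx mulr1 big1 ?addr0// => j ji.
by rewrite mxE (negbTE ji) andbF mulr0.
Qed.

Lemma row_sum x : x = \sum_i x 0 i *: delta_mx 0 i.
Proof. exact: row_sum_delta. Qed.

Lemma cauchy_schwarz x y : dot x y ^+ 2 <= dot x x * dot y y.
Proof.
have [y0|y0] := eqVneq (dot y y) 0.
  have yi i : y 0 i = 0.
    move: y0; rewrite dotxx => /eqP; rewrite psumr_eq0 => [/allP/(_ i)|j _].
      by rewrite mem_index_enum sqrf_eq0 => /(_ isT)/eqP.
    by rewrite sqr_ge0.
  by rewrite y0 mulr0 /dot big1 ?expr0n// => i _; rewrite yi mulr0.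
have y1 : 0 < dot y y by rewrite lt_neqAle eq_sym y0 dotxx_ge0.
have := dotxx_ge0 (dot y y *: x - dot x y *: y).
rewrite !dotBl !dotBr !dotZl !dotZr (dotC y x) => H.
rewrite -subr_ge0 -(pmulr_rge0 _ y1); apply: le_trans H _.
by rewrite le_eqVlt; apply/orP; left; apply/eqP; ring.
Qed.

Lemma dot_le_norm2 x y : `|dot x y| <= norm2 x * norm2 y.
Proof.
rewrite -(ler_pXn2r (_ : 0 < 2)%N)// ?nnegrE ?mulr_ge0 ?norm2_ge0//.
by rewrite exprMn !norm2_sq -normrX ger0_norm ?sqr_ge0// cauchy_schwarz.
Qed.

Lemma norm2_eq0 x : norm2 x = 0 -> x = 0.
Proof.
move=> x0; apply/rowP => i; rewrite mxE.
have := dot_le_norm2 x (delta_mx 0 i).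
by rewrite x0 mul0r dot_delta normr_le0 => /eqP.
Qed.

Lemma normp_ge0 p x : 0 <= normp p x.
Proof. exact: powR_ge0. Qed.

Lemma normp_powR p x : 0 < p -> normp p x `^ p = \sum_i `|x 0 i| `^ p.
Proof.
move=> p0; rewrite /normp -powRrM mulVf ?gt_eqF// powRr1//.
by rewrite sumr_ge0// => i _; rewrite powR_ge0.
Qed.

Lemma ler_coord_normp p x i : 0 < p -> `|x 0 i| <= normp p x.
Proof.
move=> p0; rewrite leNgt; apply/negP => H.
have : normp p x `^ p < `|x 0 i| `^ p.
  by rewrite gt0_ltr_powR// ?nnegrE ?normp_ge0.
rewrite normp_powR// (bigD1 i)//= ltNge => /negP; apply.
by rewrite lerDl sumr_ge0// => j _; rewrite powR_ge0.
Qed.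

(** After division by [normp p x] every coordinate has absolute value at most 1, and the powers of
    such a number decrease when the exponent rises from [p] to 2. *)
Lemma norm2_le_normp p x : 0 < p <= 2 -> dot x x <= normp p x ^+ 2.
Proof.
move=> /andP[p0 p2]; have [N0|N0] := eqVneq (normp p x) 0.
  rewrite dotxx big1 ?sqr_ge0// => i _.
  by have := ler_coord_normp x i p0; rewrite N0 normr_le0 => /eqP ->; rewrite expr0n.
have N1 : 0 < normp p x by rewrite lt_neqAle eq_sym N0 normp_ge0.
rewrite dotxx.
rewrite (_ : _ ^+ 2 = normp p x ^+ 2 * ((\sum_i `|x 0 i| `^ p) / normp p x `^ p)); last first.
  by rewrite -normp_powR// divff ?mulr1// gt_eqF// powR_gt0.
rewrite mulr_suml mulr_sumr; apply: ler_sum => i _.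
have [->|xi] := eqVneq (x 0 i) 0.
  by rewrite expr0n mulr_ge0 ?sqr_ge0// divr_ge0 ?powR_ge0.
have xi0 : 0 < `|x 0 i| by rewrite normr_gt0.
rewrite -[x 0 i ^+ 2]ger0_norm ?sqr_ge0// normrX.
rewrite -ler_pdivrMl ?exprn_gt0// mulrC -expr_div_n -powR_mulrn ?divr_ge0 ?normr_ge0//.
have -> : `|x 0 i| `^ p / normp p x `^ p = (`|x 0 i| / normp p x) `^ p.
  rewrite powRM ?invr_ge0 ?(ltW N1)//; congr (_ * _).
    by rewrite -[in RHS]powR_inv1 ?(ltW N1)// -powRrM mulN1r powRN.
apply: ger_powR => //; rewrite divr_gt0//=.
- by rewrite ler_pdivrMr// mul1r ler_coord_normp.
- exact: normp_ge0.
Qed.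

End Vectors.

(** * A polynomial bound on the dual norm *)

Section DualNorm.
Context {R : realType}.
Implicit Types (a c p q B X : R).

(** The right side minus the left is the gap between the convex function [X ^+ k.+1] and its tangent
    at [c]. *)
Lemma amgm_tangent X c k : 0 <= X -> 0 <= c ->
  k.+1%:R * X * c ^+ k <= k%:R * c ^+ k.+1 + X ^+ k.+1.
Proof.
move=> X0 c0; elim: k => [|k IH].
  by rewrite expr0 mulr1 mul0r add0r mul1r expr1.
rewrite -subr_ge0.
have -> : k.+1%:R * c ^+ k.+2 + X ^+ k.+2 - k.+2%:R * X * c ^+ k.+1 =
    X * (k%:R * c ^+ k.+1 + X ^+ k.+1 - k.+1%:R * X * c ^+ k)
    + k.+1%:R * c ^+ k * (c - X) ^+ 2.
  by rewrite -!natr1 !exprS; ring.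
apply: addr_ge0; first by apply: mulr_ge0 => //; rewrite subr_ge0.
by rewrite mulr_ge0 ?sqr_ge0// mulr_ge0 ?ler0n ?exprn_ge0.
Qed.

(** Hoelder's inequality through Young's inequality on each coordinate; [B] stands for a power mean
    of the coordinates of [e]. *)
Lemma hoelder_mean n p q B (e v : 'rV[R]_n) :
  (0 < n)%N -> 0 < p -> 0 < q -> p^-1 + q^-1 = 1 -> 0 < B ->
  \sum_i (`|e 0 i| / B) `^ q <= n%:R ->
  `|dot e v| <= n%:R `^ q^-1 * B * normp p v.
Proof.
move=> n0 p0 q0 pq B0 eB.
have nR : 0 < n%:R :> R by rewrite ltr0n.
have [V0|V0] := eqVneq (normp p v) 0.
  rewrite V0 mulr0 /dot big1 ?normr0// => i _.
  by have := ler_coord_normp v i p0; rewrite V0 normr_le0 => /eqP ->; rewrite mulr0.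
have V1 : 0 < normp p v by rewrite lt_neqAle eq_sym V0 normp_ge0.
(* Chosen so that the [p]-th powers of the [|v_i| * c] sum to exactly [n]. *)
pose c := n%:R `^ p^-1 / normp p v.
have c0 : 0 < c by rewrite divr_gt0// powR_gt0.
have cp : c `^ p = n%:R / normp p v `^ p.
  rewrite /c powRM ?powR_ge0 ?invr_ge0 ?(ltW V1)// -powRrM mulVf ?gt_eqF//.
  by rewrite powRr1 ?ler0n// -[in LHS]powR_inv1 ?(ltW V1)// -powRrM mulN1r powRN.
have -> : n%:R `^ q^-1 * B * normp p v = (B / c) * n%:R.
  have nE : n%:R `^ p^-1 * n%:R `^ q^-1 = n%:R :> R.
    by rewrite -powRD pq ?powRr1 ?ler0n// oner_eq0.
  transitivity ((B / c) * (n%:R `^ p^-1 * n%:R `^ q^-1)); last by rewrite nE.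
  have np0 : n%:R `^ p^-1 != 0 :> R by rewrite gt_eqF// powR_gt0.
  by rewrite /c; field; rewrite np0 V0.
apply: (@le_trans _ _ ((B / c) * \sum_i (`|e 0 i| / B) * (`|v 0 i| * c))).
  rewrite /dot (le_trans (ler_norm_sum _ _ _))// mulr_sumr ler_sum// => i _.
  rewrite normrM le_eqVlt; apply/orP; left; apply/eqP; field.
  by rewrite !gt_eqF.
apply: ler_wpM2l; first by rewrite divr_ge0 ?ltW.
apply: (@le_trans _ _ (\sum_i ((`|e 0 i| / B) `^ q / q + (`|v 0 i| * c) `^ p / p))).
  apply: ler_sum => i _; apply: conjugate_powR => //; last by rewrite addrC.
  - by rewrite divr_ge0 ?(ltW B0).
  - by rewrite mulr_ge0 ?(ltW c0).
rewrite big_split/= -!mulr_suml.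
have -> : \sum_i (`|v 0 i| * c) `^ p = n%:R.
  under eq_bigr do rewrite powRM ?(ltW c0)// cp.
  rewrite -mulr_suml -normp_powR// mulrCA divff ?mulr1//.
  by rewrite gt_eqF// powR_gt0.
apply: (@le_trans _ _ (n%:R / q + n%:R / p)); last by rewrite -mulrDr addrC pq mulr1.
by rewrite lerD2r ler_pM2r ?invr_gt0.
Qed.

(* Reduces a bound by the [k]-th root of a power sum to one by the sum itself,
   through the tangent of the root at [c ^ k]. *)
Lemma root_bound_tangent n p k c (G s r : R) (f : 'rV[R]_n -> 'rV[R]_n -> R) :
  0 < c -> 0 <= G -> 0 <= s -> s * n%:R * r ^+ k.+1 <= c ^+ k.+1 ->
  (forall (e v : 'rV[R]_n) Y, 0 <= Y -> s * \sum_i e 0 i ^+ (2 * k.+1) = Y ^+ k.+1 ->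
     f e v <= G * Y * normp p v ^+ 2) ->
  exists a b, [/\ 0 <= a, 0 <= b,
    forall e v : 'rV[R]_n, f e v <= (a + b * \sum_i e 0 i ^+ (2 * k.+1)) * normp p v ^+ 2 &
    a + b * (n%:R * r ^+ k.+1) <= G * c].
Proof.
move=> c0 G0 s0 sc H.
have k0 : 0 < k.+1%:R :> R by rewrite ltr0n.
have ck0 : 0 < c ^+ k by rewrite exprn_gt0.
(* By [amgm_tangent], [Y] is at most [(k c^(k+1) + s S) / ((k+1) c^k)]; the witnesses are the
   constant and the linear coefficient of this bound in [S], times [G]. *)
exists (G * (k%:R * c / k.+1%:R)), (G * (s / (k.+1%:R * c ^+ k))); split.
- by rewrite !mulr_ge0 ?ler0n ?invr_ge0 ?(ltW c0).
- by rewrite mulr_ge0// divr_ge0// mulr_ge0 ?ler0n ?ltW.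
- move=> e v; set S := \sum_i _.
  have S0 : 0 <= S.
    by apply: sumr_ge0 => i _; rewrite exprM exprn_ge0 ?sqr_ge0.
  pose Y := (s * S) `^ (k.+1%:R)^-1.
  have Y0 : 0 <= Y by exact: powR_ge0.
  have YS : s * S = Y ^+ k.+1.
    by rewrite -powR_mulrn// -powRrM mulVf ?gt_eqF// powRr1 ?mulr_ge0.
  apply: le_trans (H e v Y Y0 YS) _.
  rewrite ler_wpM2r ?sqr_ge0// -!mulrA -mulrDr ler_wpM2l//.
  have -> : k%:R * (c * k.+1%:R^-1) + s * ((k.+1%:R * c ^+ k)^-1 * S) =
      (k%:R * c ^+ k.+1 + s * S) / (k.+1%:R * c ^+ k).
    by rewrite exprS; field; rewrite !gt_eqF.
  rewrite ler_pdivlMr ?mulr_gt0// YS mulrCA mulrA.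
  exact: amgm_tangent (ltW _).
rewrite -!mulrA -mulrDr ler_wpM2l//.
have -> : k%:R * (c * k.+1%:R^-1) + s * ((k.+1%:R * c ^+ k)^-1 * (n%:R * r ^+ k.+1)) =
    (k%:R * c ^+ k.+1 + s * n%:R * r ^+ k.+1) / (k.+1%:R * c ^+ k).
  by rewrite [c ^+ k.+1]exprS; field; rewrite !gt_eqF.
rewrite ler_pdivrMr ?mulr_gt0//.
apply: le_trans (_ : k%:R * c ^+ k.+1 + c ^+ k.+1 <= _); first by rewrite lerD2l.
by rewrite le_eqVlt; apply/orP; left; apply/eqP; rewrite -natr1 exprS; ring.
Qed.

(** Monotonicity of power means: [B] is the power mean of order [2 * k.+1] of [e], and [q] is an
    order at most that. *)
Lemma sum_pow_le1 n q k (e : 'rV[R]_n) B : 0 < q <= (2 * k.+1)%:R -> 0 < B ->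
  \sum_i e 0 i ^+ (2 * k.+1) = n%:R * B ^+ (2 * k.+1) ->
  \sum_i (`|e 0 i| / B) `^ q <= n%:R.
Proof.
move=> /andP[q0 qk] B0 eB; set K := (2 * k.+1)%N in qk eB *.
have K0 : 0 < K%:R :> R by rewrite ltr0n.
(* Bernoulli's inequality for the exponent [q / K], at most 1, from Young's inequality with second
   factor 1. Summed over [i], the correction vanishes by [eB]. *)
have pt i : (`|e 0 i| / B) `^ q <= 1 + q / K%:R * (e 0 i ^+ K / B ^+ K - 1).
  set t := `|e 0 i| / B.
  have t0 : 0 <= t by rewrite divr_ge0 ?(ltW B0).
  have -> : e 0 i ^+ K / B ^+ K = t `^ K%:R.
    by rewrite powR_mulrn// expr_div_n -normrX ger0_norm// exprM exprn_ge0 ?sqr_ge0.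
  move: qk; rewrite le_eqVlt => /predU1P[->|qK].
    by rewrite divff ?gt_eqF// mul1r addrC subrK.
  have d0 : 0 < 1 - q / K%:R by rewrite subr_gt0 ltr_pdivrMr// mul1r.
  have := @conjugate_powR R (t `^ q) 1 (K%:R / q) (1 - q / K%:R)^-1.
  rewrite powR_ge0 ler01 divr_gt0// invr_gt0 d0 => /(_ isT isT isT isT).
  rewrite mulr1 powR1 -powRrM mulrCA divff ?gt_eqF// mulr1 invrK mul1r invf_div.
  rewrite addrC subrK => /(_ erefl) H; apply: le_trans H _.
  by rewrite mulrC; lra.
apply: le_trans (ler_sum _ (fun i _ => pt i)) _.
rewrite big_split/= sumr_const card_ord -mulr_sumr sumrB sumr_const card_ord.
rewrite -mulr_suml eB mulfK ?gt_eqF ?exprn_gt0//.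
by rewrite subrr mulr0 addr0.
Qed.

Lemma ln2_ge : 1 / 2 <= ln 2 :> R.
Proof.
have := @le_ln1Dx R (- (1 / 2)); rewrite (_ : 1 + - (1 / 2) = 2^-1); last by lra.
by rewrite lnV ?posrE//; lra.
Qed.

(** [ln n] is at least [3 ln 2] and [ln 2] at least [1 / 2]. Hence [16 ln n - 8] is at least 16,
    which gives positivity of [rho] and room for the logarithmic exponent. *)
Lemma ln_nat_ge n : (8 <= n)%N -> 3 / 2 <= ln n%:R :> R.
Proof.
move=> n8; have h : ln (8%:R) <= ln n%:R :> R.
  by rewrite ler_ln ?posrE ?ltr0n ?ler_nat// (leq_trans _ n8).
apply: le_trans _ h; rewrite (_ : 8%:R = 2 ^+ 3 :> R); last by rewrite -natrX.
by rewrite lnXn// mulr_natl; have := ln2_ge; lra.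
Qed.

End DualNorm.

Section DualBound.
Context {R : realType}.

Lemma dual_sq_bound n (p q B : R) (e v : 'rV[R]_n) :
  (0 < n)%N -> 0 < p -> 0 < q -> p^-1 + q^-1 = 1 -> 0 < B ->
  \sum_i (`|e 0 i| / B) `^ q <= n%:R ->
  dot e v ^+ 2 <= n%:R `^ (2 / q) * B ^+ 2 * normp p v ^+ 2.
Proof.
move=> n0 p0 q0 pq B0 /(hoelder_mean v n0 p0 q0 pq B0) H.
have -> : n%:R `^ (2 / q) = (n%:R `^ q^-1) ^+ 2 :> R.
  by rewrite -powR_mulrn ?powR_ge0// -powRrM mulrC.
rewrite -!exprMn -[leLHS]ger0_norm ?sqr_ge0// normrX.
by rewrite lerXn2r// nnegrE ?(le_trans _ H)// !mulr_ge0 ?powR_ge0 ?ltW.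
Qed.

(** Settles the degenerate case [Y = 0], where the coordinates cannot be divided by [Num.sqrt Y]. *)
Lemma dot_eq0_of_sum n k (e v : 'rV[R]_n) (s Y : R) : s != 0 ->
  s * \sum_i e 0 i ^+ (2 * k.+1) = Y ^+ k.+1 -> Y = 0 -> dot e v = 0.
Proof.
move=> s0 + Y0; rewrite Y0 expr0n/= => /eqP; rewrite mulf_eq0 (negbTE s0)/=.
rewrite psumr_eq0 => [/allP H|i _]; last by rewrite exprM exprn_ge0 ?sqr_ge0.
rewrite /dot big1// => i _; have := H i; rewrite mem_index_enum => /(_ isT).
by rewrite /= expf_eq0 => /andP[_ /eqP ->]; rewrite mul0r.
Qed.

Lemma sqrt_exp2M (Y : R) k : 0 <= Y -> Num.sqrt Y ^+ (2 * k) = Y ^+ k.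
Proof. by move=> Y0; rewrite exprM sqr_sqrtr. Qed.

Lemma coord_le_sqrt n k (e : 'rV[R]_n) (Y : R) i : 0 <= Y ->
  1 * \sum_i e 0 i ^+ (2 * k.+1) = Y ^+ k.+1 -> `|e 0 i| <= Num.sqrt Y.
Proof.
move=> Y0; rewrite mul1r => eY.
rewrite -(ler_pXn2r (_ : 0 < 2 * k.+1)%N)// ?nnegrE ?sqrtr_ge0//.
rewrite sqrt_exp2M// -eY (bigD1 i)//= -normrX ger0_norm; last first.
  by rewrite exprM exprn_ge0 ?sqr_ge0.
by rewrite lerDl sumr_ge0// => j _; rewrite exprM exprn_ge0 ?sqr_ge0.
Qed.

(* For such an exponent [n^(1/k)] is bounded, so the l_(2k) norm is comparable
   with the l_oo one. *)
Lemma log_exponent n : (8 <= n)%N ->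
  exists k, (n <= 2 ^ k.+1)%N /\ 4 * k.+1%:R <= 8 * (16 * ln n%:R - 8) :> R.
Proof.
move=> n8; exists (trunc_log 2 n); split; first exact/ltnW/trunc_log_ltn.
have n0 : (0 < n)%N by rewrite (leq_trans _ n8).
have h : (trunc_log 2 n)%:R * ln 2 <= ln n%:R :> R.
  rewrite mulr_natl -lnXn// ler_ln ?posrE ?exprn_gt0 ?ltr0n//.
  by rewrite -natrX ler_nat trunc_logP.
have h2 := @ln2_ge R; have h3 := @ln_nat_ge R n n8.
have h4 : 0 <= (trunc_log 2 n)%:R :> R by rewrite ler0n.
by rewrite -natr1; nra.
Qed.

(** Two choices of exponent. If [q - 1] attains the minimum in [rho], the power mean of order
    [2 * k.+1] just above [q] controls the dual norm. Otherwise, and for [q = +oo], each coordinate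
    is bounded by the norm of order [2 * K.+1] with [K] from [log_exponent]. *)
Theorem dual_bound n (p : R) (q : \bar R) :
  (8 <= n)%N -> 1 <= p <= 2 -> (2%:E <= q)%E -> ((p^-1)%:E + q^-1 = 1)%E ->
  exists a b k, [/\ 0 <= a, 0 <= b,
    forall e v : 'rV[R]_n,
      dot e v ^+ 2 <= (a + b * \sum_i e 0 i ^+ (2 * k)) * normp p v ^+ 2 &
    a + b * (n%:R * ((2 * k)%:R / n%:R) ^+ k) <= 8 * rho n q].
Proof.
move=> n8 /andP[p1 p2] q2 pq.
have n0 : (0 < n)%N by rewrite (leq_trans _ n8).
have nR : 0 < n%:R :> R by rewrite ltr0n.
have p0 : 0 < p by rewrite (lt_le_trans _ p1).
have [K [nK Kln]] := log_exponent n8.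
have K0 : 0 < K.+1%:R :> R by rewrite ltr0n.
(* Twice the moment ratio [2 * K.+1 / n]: the factor 2, raised to the power [K.+1], absorbs the [n]
   summands. *)
pose c := 4 * K.+1%:R / n%:R : R.
have c0 : 0 < c by rewrite divr_gt0// mulr_gt0.
have cK : 1 * n%:R * ((2 * K.+1)%:R / n%:R) ^+ K.+1 <= c ^+ K.+1.
  have -> : c = 2 * ((2 * K.+1)%:R / n%:R) by rewrite natrM /c; field; rewrite gt_eqF.
  rewrite [leRHS]exprMn mul1r ler_wpM2r ?exprn_ge0 ?divr_ge0//.
  by rewrite -natrX ler_nat.
case: q q2 pq => [q| |] // q2 pq.
- have q0 : 0 < q by rewrite lee_fin in q2; lra.
  have pq' : p^-1 + q^-1 = 1.
    by move: pq; rewrite inver gt_eqF// -EFinD => -[].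
  have G0 : 0 <= n%:R `^ (2 / q) :> R by exact: powR_ge0.
  have rhoE : rho n q%:E = Num.min (q - 1) (16 * ln n%:R - 8) * (n%:R `^ (2 / q) / n%:R) :> R.
    rewrite /rho powRB; last by apply/implyP => _; rewrite gt_eqF.
    by rewrite powRr1 ?ler0n.
  rewrite rhoE; have [_|_] := leP (q - 1) (16 * ln n%:R - 8).
    (* With [k] the floor of [q / 2], [q < 2 * k.+1 <= q + 2 <= 8 * (q - 1)], the last step because
       [q >= 2]. *)
    have /andP[tr1 tr2] := truncn_itv (ltW (divr_gt0 q0 (ltr0Sn R 1))).
    set k := Num.truncn (q / 2) in tr1 tr2.
    have k0 : 0 < k.+1%:R :> R by rewrite ltr0n.
    pose d := (2 * k.+1)%:R / n%:R : R.
    have d0 : 0 < d by rewrite divr_gt0// ltr0n.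
    have dk : n%:R^-1 * n%:R * ((2 * k.+1)%:R / n%:R) ^+ k.+1 <= d ^+ k.+1.
      by rewrite mulVf ?gt_eqF// mul1r.
    have nV0 : 0 <= n%:R^-1 :> R by rewrite invr_ge0 ler0n.
    have [|a [b [a0 b0 ab1 ab2]]] := @root_bound_tangent R n p k d _ _ _
      (fun e v => dot e v ^+ 2) d0 G0 nV0 dk.
      move=> e v Y; rewrite le_eqVlt => /predU1P[<- /dot_eq0_of_sum -> //|Y0 eY].
      - by rewrite expr0n mulr0 mul0r.
      - by rewrite invr_eq0 gt_eqF.
      - rewrite -[Y in _ * Y * _]sqr_sqrtr ?(ltW Y0)//.
        apply: dual_sq_bound => //; first by rewrite sqrtr_gt0.
        apply: (@sum_pow_le1 _ _ _ k) => //; last 1 first.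
          by rewrite sqrt_exp2M ?(ltW Y0)// -eY mulrA divff ?mul1r// gt_eqF.
        - by rewrite q0/= natrM -ler_pdivrMl// mulrC ltW.
        - by rewrite sqrtr_gt0.
    exists a, b, k.+1; split => //; apply: le_trans ab2 _.
    have -> : 8 * ((q - 1) * (n%:R `^ (2 / q) / n%:R)) =
        n%:R `^ (2 / q) * (8 * (q - 1) / n%:R) by ring.
    rewrite ler_wpM2l// ler_pM2r ?invr_gt0// natrM -natr1.
    by rewrite lee_fin in q2; lra.
  have [|a [b [a0 b0 ab1 ab2]]] := @root_bound_tangent R n p K c _ _ _
    (fun e v => dot e v ^+ 2) c0 G0 ler01 cK.
    move=> e v Y; rewrite le_eqVlt => /predU1P[<- /dot_eq0_of_sum -> //|Y0 eY].
    - by rewrite expr0n mulr0 mul0r.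
    - rewrite -[Y in _ * Y * _]sqr_sqrtr ?(ltW Y0)//.
      apply: dual_sq_bound => //; first by rewrite sqrtr_gt0.
      apply: le_trans (_ : \sum_(i < n) 1 <= _); last by rewrite sumr_const card_ord.
      apply: ler_sum => i _.
      have h : `|e 0 i| / Num.sqrt Y <= 1.
        by rewrite ler_pdivrMr ?sqrtr_gt0// mul1r (coord_le_sqrt _ (ltW Y0) eY).
      have h0 : 0 <= `|e 0 i| / Num.sqrt Y by rewrite divr_ge0 ?sqrtr_ge0.
      apply: le_trans (_ : 1 `^ q <= 1); last by rewrite powR1.
      by rewrite ge0_ler_powR ?nnegrE ?(ltW q0).
  exists a, b, K.+1; split => //; apply: le_trans ab2 _.
  have -> : 8 * ((16 * ln n%:R - 8) * (n%:R `^ (2 / q) / n%:R)) =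
      n%:R `^ (2 / q) * (8 * (16 * ln n%:R - 8) / n%:R) by ring.
  by rewrite ler_wpM2l// ler_pM2r ?invr_gt0.
- have p1' : p = 1.
    by move: pq; rewrite invey adde0 => -[] /(congr1 GRing.inv); rewrite invrK invr1.
  have [e v Y Y0 eY|a [b [a0 b0 ab1 ab2]]] := @root_bound_tangent R n p K c 1 _ _
    (fun e v => dot e v ^+ 2) c0 ler01 ler01 cK.
    rewrite mul1r -[Y in Y * _](sqr_sqrtr Y0) -exprMn -[leLHS]ger0_norm ?sqr_ge0//.
    rewrite normrX; have h : `|dot e v| <= Num.sqrt Y * normp p v.
      rewrite p1' /normp invr1 powRr1; last by apply: sumr_ge0 => i _; rewrite powR_ge0.
      rewrite mulr_sumr (le_trans (ler_norm_sum _ _ _))// ler_sum// => i _.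
      by rewrite normrM powRr1// ler_wpM2r// (coord_le_sqrt _ Y0 eY).
    by rewrite lerXn2r// nnegrE ?(le_trans _ h).
  exists a, b, K.+1; split => //; apply: le_trans ab2 _.
  by rewrite mul1r /rho powR_inv1 ?ler0n// mulrA ler_pM2r ?invr_gt0.
Qed.

End DualBound.

(** * Borel row vectors *)

Section BorelVectors.
Context {R : realType} {n : nat}.

Lemma continuous_borel_measurable (f : 'rV[R]_n -> R) :
  continuous f -> measurable_fun [set: borel_rV R n] f.
Proof.
move=> cf; apply: (measurability _ (RGenOInfty.measurableE R)).
move=> _ [_ [x ->] <-]; rewrite setTI; apply: sub_sigma_algebra => /=.
by apply: open_comp => //; exact: open_gt.
Qed.

Lemma measurable_coord (i : 'I_n) :
  measurable_fun [set: borel_rV R n] (fun u : 'rV[R]_n => u 0 i).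
Proof. by apply: continuous_borel_measurable; exact: coord_continuous. Qed.

Context d (T : measurableType d).

(* Rational cubes form a countable base of the topology. *)
Lemma measurable_rV (f : T -> 'rV[R]_n) :
  (forall i, measurable_fun [set: T] (fun w => f w 0 i)) ->
  measurable_fun [set: T] (f : T -> borel_rV R n).
Proof.
move=> mf; apply: (@measurability _ _ _ (borel_rV R n) setT f (@open 'rV[R]_n)) => //.
move=> _ [U oU <-]; rewrite setTI.
pose cube (ck : 'rV[rat]_n * nat) :=
  [set u : 'rV[R]_n | forall i, `|u 0 i - ratr (ck.1 0 i)| < ck.2.+1%:R^-1].
have -> : f @^-1` U =
    \bigcup_(ck : 'rV[rat]_n * nat) (if `[< cube ck `<=` U >] then f @^-1` cube ck else set0).
  apply/seteqP; split => w; last by move=> [ck _] /=; case: asboolP => [h /h|_ []].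
  move=> /= Uw; have /nbhs_ballP[e /= e0 eU] : nbhs (f w) U by exact: open_nbhs_nbhs.
  (* Balls of row vectors are those of the sup norm, so a cube of half side below [e / 2] that
     contains [f w] stays within distance [e] of it. *)
  have [k ke] : exists k : nat, k.+1%:R^-1 < e / 2.
    have e2 : 0 < e / 2 by rewrite divr_gt0.
    exists (Num.truncn (e / 2)^-1); rewrite -[ltRHS]invrK ltf_pV2 ?posrE ?invr_gt0//.
    by rewrite truncnS_gt.
  have kp : 0 < k.+1%:R^-1 :> R by rewrite invr_gt0.
  move def_dl: (k.+1%:R^-1 : R) ke kp => dl ke kp.
  have /choice[c cP] : forall i, exists r : rat, `|f w 0 i - ratr r| < dl.
    move=> i; have [r] : exists r : rat, ratr r \in `]f w 0 i - dl, f w 0 i + dl[.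
      by apply: (@rat_in_itvoo R); rewrite ltrBlDr -addrA ltrDl addr_gt0.
    by rewrite in_itv/= => /andP[r1 r2]; exists r; rewrite ltr_norml; apply/andP; split; lra.
  exists (\row_i c i, k) => //; rewrite asboolT.
    by move=> i /=; rewrite mxE def_dl.
  move=> u uk; apply: eU; split=> // j i; rewrite ord1.
  have := cP i; have := uk i; rewrite /= mxE def_dl => h1 h2.
  rewrite /ball/= (_ : _ - _ = (f w 0 i - ratr (c i)) - (u 0 i - ratr (c i))); last by ring.
  rewrite (le_lt_trans (ler_normB _ _))//; lra.
apply: countable_bigcupT_measurable => [|ck]; first exact: countableP.
case: asboolP => // _.
have -> : f @^-1` cube ck = \bigcap_(i in [set: 'I_n])
    [set w | `|f w 0 i - ratr (ck.1 0 i)| < ck.2.+1%:R^-1].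
  by apply/seteqP; split => w /= h i; [move=> _|]; exact: h.
apply: fin_bigcap_measurable => // i _.
have mi : measurable_fun setT (fun w => `|f w 0 i - ratr (ck.1 0 i)| < ck.2.+1%:R^-1).
  apply: measurable_fun_ltr => //; apply: measurableT_comp => //.
  by apply: measurable_funB => //; exact: mf.
by have := mi measurableT [set true] I; rewrite setTI.
Qed.

End BorelVectors.

(** * Independence *)

Section Independence.
Context {d : measure_display} {T : measurableType d} {R : realType}.

(** Dynkin's pi-lambda argument. Total masses are compared separately because [setT] need not belong
    to [P]; their finiteness serves the complements. *)
Lemma eq_measure_sigma (P : set (set T)) (m1 m2 : {measure set T -> \bar R}) :
  setI_closed P -> P `<=` measurable -> m1 setT = m2 setT -> (m1 setT < +oo)%E ->
  (forall A, P A -> m1 A = m2 A) ->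
  forall A, <<s P >> A -> measurable A /\ m1 A = m2 A.
Proof.
move=> PI Pm mT mfin mP.
suff: <<s P >> `<=` [set A | measurable A /\ m1 A = m2 A] by [].
apply: lambda_system_subset => //; last first.
  by move=> A PA; split; [exact: Pm|exact: mP].
apply/dynkin_lambda_system; split => //.
- move=> A [mA mE]; split; first exact: measurableC.
  have CE (m : {measure set T -> \bar R}) : (m setT < +oo)%E ->
      m (~` A) = (m setT - m A)%E.
    by move=> mfT; rewrite -setTD measureD// setTI.
  by rewrite !CE -?mT -?mE.
- move=> F tF mF; split; first by apply: bigcup_measurable => k _; case: (mF k).
  rewrite !measure_bigcup//; try by move=> i _; case: (mF i).
  by apply: eq_eseriesr => i _; case: (mF i).
Qed.

Variable Q : probability T R.

(** Both sides are finite measures in [A]: the restriction of [Q] to [B], and [Q] scaled by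
    [Q B]. *)
Lemma independent_sigma (P : set (set T)) B :
  setI_closed P -> P `<=` measurable -> measurable B ->
  (forall A, P A -> Q (A `&` B) = (Q A * Q B)%E) ->
  forall A, <<s P >> A -> measurable A /\ Q (A `&` B) = (Q A * Q B)%E.
Proof.
move=> PI Pm mB PB.
have QB0 : 0 <= fine (Q B) by rewrite fine_ge0.
pose m2 := mscale (NngNum QB0) Q.
have E A : m2 A = (Q A * Q B)%E.
  by rewrite /m2 /mscale/= fineK ?fin_num_measure// muleC.
have H := @eq_measure_sigma P (mrestr Q mB) m2 PI Pm.
move=> A PA; have [||A' PA'|mA] := H _ _ _ A PA.
- suff : Q (setT `&` B) = (Q setT * Q B)%E by rewrite -E.
  by rewrite setTI probability_setT mul1e.
- suff : (Q (setT `&` B) < +oo)%E by [].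
  by rewrite setTI ltey_eq fin_num_measure.
- suff : Q (A' `&` B) = (Q A' * Q B)%E by rewrite -E.
  exact: PB.
- by move=> mE; split => //; rewrite -E.
Qed.

Context {I : finType} (G : I -> set (set T)).

Definition joint_generator (J : {set I}) : set (set T) :=
  \bigcup_(j in [set` J]) G j.

Hypotheses (GT : forall i, G i setT) (GI : forall i, setI_closed (G i)).
Hypothesis Gm : forall i, G i `<=` measurable.

(** Unlike [joint_generator J], these rectangles form a pi-system, and they are the sets on which
    [independent] evaluates [Q]. *)
Let rect (J : {set I}) : set (set T) :=
  [set A | exists2 F : I -> set T, forall i, G i (F i) &
           A = \bigcap_(i in [set` J]) F i].

Let rectI J : setI_closed (rect J).
Proof.
move=> _ _ [F GF ->] [F' GF' ->]; exists (fun i => F i `&` F' i).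
  by move=> i; exact: GI.
by rewrite bigcapI.
Qed.

Let rectm J : rect J `<=` measurable.
Proof.
by move=> _ [F GF ->]; apply: fin_bigcap_measurable => // i _; exact/Gm/GF.
Qed.

Let joint_sub_rect J : <<s joint_generator J >> `<=` <<s rect J >>.
Proof.
apply: smallest_sub; first exact: smallest_sigma_algebra.
move=> A [j Jj GA]; apply: sub_sigma_algebra.
exists (fun i => if i == j then A else setT).
  by move=> i; case: eqP => // ->.
apply/seteqP; split => [w Aw i _|w /(_ j Jj)]; last by rewrite /= eqxx.
by case: ifP.
Qed.

(** Two passes of [independent_sigma]: the inner one extends the product formula to [B] for a fixed
    rectangle [A'], the outer one extends it to [A]. *)
Lemma independent_joint (J1 J2 : {set I}) A B :
  independent Q G -> disjoint (mem J1) (mem J2) ->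
  <<s joint_generator J1 >> A -> <<s joint_generator J2 >> B ->
  Q (A `&` B) = (Q A * Q B)%E.
Proof.
move=> GQ J12 /joint_sub_rect JA /joint_sub_rect JB.
have mT : <<s rect J2 >> B -> measurable B.
  by move=> h; apply: (smallest_sub (sigma_algebra_measurable T) (@rectm J2)).
have [||_ ->//] := @independent_sigma (rect J1) B (@rectI J1) (@rectm J1) _ _ A JA.
  exact: mT.
move=> A' rA'.
have [|A'' rA''|_ h] := @independent_sigma (rect J2) A' (@rectI J2) (@rectm J2) _ _ B JB.
- exact: rectm rA'.
- move: rA' rA'' => [F1 GF1 ->] [F2 GF2 ->].
  (* Disjointness lets the two families be merged into one, to which [independent] applies over
     [J1 :|: J2]. *)
  pose F i := if i \in J1 then F1 i else F2 i.
  have GF i : G i (F i) by rewrite /F; case: ifP.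
  have E1 : \bigcap_(i in [set` J1]) F1 i = \bigcap_(i in [set` J1]) F i.
    by apply: eq_bigcapr => i /= iJ; rewrite /F iJ.
  have E2 : \bigcap_(i in [set` J2]) F2 i = \bigcap_(i in [set` J2]) F i.
    by apply: eq_bigcapr => i /= iJ; rewrite /F (disjointFl J12 iJ).
  rewrite E1 E2 setIC -bigcap_setU (_ : _ `|` _ = [set` J1 :|: J2]); last first.
    by apply/seteqP; split => i /=; rewrite inE => /orP.
  rewrite !GQ// muleC -(@bigU _ _ _ _ _ _ _ J12); apply: eq_bigl => i.
  by rewrite finset.in_setU.
by rewrite setIC muleC h.
Qed.

End Independence.

(** * Pairs of independent variables: product law, Tonelli and Fubini *)

Section IndependentPair.
Context {d : measure_display} {T : measurableType d} {R : realType}.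
Variable Q : probability T R.

Definition indep2 d1 d2 (T1 : measurableType d1) (T2 : measurableType d2)
    (X : T -> T1) (Y : T -> T2) :=
  forall A B, measurable A -> measurable B ->
    Q (X @^-1` A `&` Y @^-1` B) = (Q (X @^-1` A) * Q (Y @^-1` B))%E.

Context d1 d2 (T1 : measurableType d1) (T2 : measurableType d2).
Variables (X : T -> T1) (Y : T -> T2).
Hypotheses (mX : measurable_fun setT X) (mY : measurable_fun setT Y).
Hypothesis XY : indep2 X Y.

Let X' : {mfun T >-> T1} := HB.pack X (isMeasurableFun.Build _ _ _ _ X mX).
Let Y' : {mfun T >-> T2} := HB.pack Y (isMeasurableFun.Build _ _ _ _ Y mY).
Let Z w := (X w, Y w).
Let mZ : measurable_fun setT Z. Proof. exact: measurable_fun_pair. Qed.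
Let Z' : {mfun T >-> (T1 * T2)%type} := HB.pack Z (isMeasurableFun.Build _ _ _ _ Z mZ).

Let joint_law A : measurable A ->
  (distribution Q X' \x distribution Q Y')%E A = distribution Q Z' A.
Proof.
by apply: product_measure_unique => U V mU mV; exact: XY.
Qed.

(** The joint law is a product. Pulled back to [T], Tonelli's formula freezes [X w] while [Y] is
    averaged over a fresh outcome [w']; this takes the place of conditioning on the past. *)
Lemma tonelli_indep (phi : (T1 * T2)%type -> \bar R) :
  measurable_fun setT phi -> (forall u, 0 <= phi u)%E ->
  (\int[Q]_w phi (X w, Y w) = \int[Q]_w \int[Q]_w' phi (X w, Y w'))%E.
Proof.
move=> mphi phi0.
transitivity (\int[distribution Q Z']_z phi z)%E.
  by rewrite ge0_integral_distribution.
rewrite (eq_measure_integral (distribution Q X' \x distribution Q Y')%E); last first.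
  by move=> A mA _; exact/esym/joint_law.
rewrite fubini_tonelli1// ge0_integral_distribution//; last 2 first.
- exact: measurable_fun_fubini_tonelli_F.
- by move=> x; exact: integral_ge0.
apply: eq_integral => w _ /=; rewrite /fubini_F ge0_integral_distribution//.
exact: measurableT_comp.
Qed.

Lemma measurable_partial_integral (phi : (T1 * T2)%type -> \bar R) :
  measurable_fun setT phi -> (forall v, 0 <= phi v)%E ->
  measurable_fun setT (fun w => \int[Q]_w' phi (X w, Y w'))%E.
Proof.
move=> mphi phi0.
have mF := measurable_fun_fubini_tonelli_F phi mphi phi0 (m2 := distribution Q Y').
rewrite (_ : (fun w => _) = fubini_F (distribution Q Y') phi \o X).
  exact: (measurableT_comp mF mX).
apply/funext => w; rewrite /fubini_F /= ge0_integral_distribution//.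
exact: measurableT_comp.
Qed.

(** Tonelli's theorem on absolute values gives the product of two finite first moments. *)
Lemma integrable_indep_prod (u : T1 -> R) (v : T2 -> R) :
  measurable_fun setT u -> measurable_fun setT v ->
  Q.-integrable setT (EFin \o (u \o X)) -> Q.-integrable setT (EFin \o (v \o Y)) ->
  Q.-integrable setT (EFin \o (fun w => u (X w) * v (Y w))).
Proof.
move=> mu mv iu iv.
apply/integrableP; split.
  apply/measurable_EFinP; apply: measurable_funM; exact: measurableT_comp.
pose phi (z : (T1 * T2)%type) := (`|u z.1 * v z.2|)%:E : \bar R.
rewrite (_ : (\int[Q]_x _)%E = \int[Q]_w phi (X w, Y w))%E//.
rewrite tonelli_indep//; last 2 first.
- apply/measurable_EFinP; apply: measurableT_comp => //.
  by apply: measurable_funM; exact: measurableT_comp.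
- by move=> z; rewrite lee_fin.
move: iu iv => /integrableP[_ iu] /integrableP[_ iv].
under eq_integral.
  move=> w _; under eq_integral => w' _ do rewrite /phi/= normrM EFinM.
  rewrite ge0_integralZl//; last first.
    by apply/measurable_EFinP; do 2 apply: measurableT_comp => //.
  over.
rewrite /= ge0_integralZr//; last 2 first.
- by apply/measurable_EFinP; do 2 apply: measurableT_comp => //.
- exact: integral_ge0.
by rewrite lte_mul_pinfty// ?ge0_fin_numE//; exact: integral_ge0.
Qed.

Lemma integral_indep_prod (u : T1 -> R) (v : T2 -> R) :
  measurable_fun setT u -> measurable_fun setT v ->
  Q.-integrable setT (EFin \o (u \o X)) -> Q.-integrable setT (EFin \o (v \o Y)) ->
  (\int[Q]_w (u (X w) * v (Y w))%:E =
   \int[Q]_w (u (X w))%:E * \int[Q]_w (v (Y w))%:E)%E.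
Proof.
move=> mu mv iu iv; pose f (z : (T1 * T2)%type) := (u z.1 * v z.2)%:E : \bar R.
have mf : measurable_fun setT f.
  by apply/measurable_EFinP; apply: measurable_funM; exact: measurableT_comp.
have fZ : Q.-integrable setT (f \o Z') by exact: integrable_indep_prod.
have fi : (distribution Q X' \x distribution Q Y')%E.-integrable setT f.
  apply/integrableP; split => //.
  rewrite (eq_measure_integral (distribution Q Z')); last by move=> A mA _; exact: joint_law.
  rewrite ge0_integral_distribution//; last exact: measurableT_comp.
  by case/integrableP : fZ.
transitivity (\int[distribution Q Z']_z f z)%E; first by rewrite integral_distribution.
rewrite (eq_measure_integral (distribution Q X' \x distribution Q Y')%E); last first.
  by move=> A mA _; exact/esym/joint_law.
rewrite -integral12_prod_meas1// /fubini_F.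
have iuX : (\int[distribution Q X']_x (u x)%:E = \int[Q]_w (u (X w))%:E)%E.
  by rewrite integral_distribution//; exact/measurable_EFinP.
have ivY : (\int[distribution Q Y']_x (v x)%:E = \int[Q]_w (v (Y w))%:E)%E.
  by rewrite integral_distribution//; exact/measurable_EFinP.
have iu' : (distribution Q X').-integrable setT (EFin \o u).
  by apply: integrable_pushforward => //; exact/measurable_EFinP.
have iv' : (distribution Q Y').-integrable setT (EFin \o v).
  by apply: integrable_pushforward => //; exact/measurable_EFinP.
under eq_integral.
  move=> x _; under eq_integral do rewrite /f/= EFinM.
  rewrite integralZl//.
  over.
rewrite /= ivY -iuX.
have /fineK <- : (\int[Q]_w (v (Y w))%:E)%E \is a fin_num by exact: integrable_fin_num iv.
by rewrite integralZr.
Qed.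

End IndependentPair.

(** * Expectations of real random variables *)

Section Mean.
Context {d : measure_display} {T : measurableType d} {R : realType}.
Variable Q : probability T R.
Implicit Types (f g : T -> R) (c : R).

Definition integ f := Q.-integrable setT (EFin \o f).

(** [fine] sends an infinite integral to 0, so a value of [mean] is to be read together with
    [integ]. *)
Definition mean f : R := fine (\int[Q]_w (f w)%:E).

Lemma EFin_mean f : integ f -> (\int[Q]_w (f w)%:E = (mean f)%:E)%E.
Proof. by move=> fi; rewrite fineK//; exact: integrable_fin_num. Qed.

Lemma integ_measurable f : integ f -> measurable_fun setT f.
Proof. by case/integrableP => /measurable_EFinP. Qed.

Lemma integ_cst c : integ (fun=> c).
Proof. exact: finite_measure_integrable_cst. Qed.

Lemma integD f g : integ f -> integ g -> integ (fun w => f w + g w).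
Proof. by move=> fi gi; exact: (integrableD _ fi gi). Qed.

Lemma integZ c f : integ f -> integ (fun w => c * f w).
Proof. by move=> fi; exact: (integrableZl _ c fi). Qed.

Lemma integN f : integ f -> integ (fun w => - f w).
Proof. by move=> /(integZ (-1)); rewrite /integ; under eq_fun do rewrite /= mulN1r. Qed.

Lemma integB f g : integ f -> integ g -> integ (fun w => f w - g w).
Proof. by move=> fi gi; apply: integD => //; exact: integN. Qed.

Lemma integ_sum (I : finType) (f : I -> T -> R) :
  (forall i, integ (f i)) -> integ (fun w => \sum_i f i w).
Proof.
move=> fi; rewrite /integ (_ : _ \o _ = fun w => (\sum_i (f i w)%:E)%E); last first.
  by apply/funext => w /=; rewrite -sumEFin.
by apply: integrable_sum => // i _; exact: fi.
Qed.

Lemma integ_le f g : measurable_fun setT f -> integ g ->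
  {ae Q, forall w, `|f w| <= g w} -> integ f.
Proof.
move=> mf gi fg; apply/integrableP; split; first exact/measurable_EFinP.
case/integrableP : (gi) => /measurable_EFinP mg; apply: le_lt_trans.
apply: ae_ge0_le_integral => //.
- by do 2 apply: measurableT_comp => //.
- by do 2 apply: measurableT_comp => //.
- apply: filterS fg => w fgw _ /=; rewrite lee_fin.
  exact: le_trans fgw (ler_norm _).
Qed.

Lemma mean_cst c : mean (fun=> c) = c.
Proof.
rewrite /mean integral_cst//; transitivity (fine (c%:E * 1)%E); last by rewrite mule1.
by congr (fine (_ * _)%E); exact: probability_setT.
Qed.

Lemma meanD f g : integ f -> integ g -> mean (fun w => f w + g w) = mean f + mean g.
Proof.
move=> fi gi; apply: EFin_inj; rewrite -EFin_mean ?EFinD -?EFin_mean//; last exact: integD.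
by rewrite -integralD_EFin.
Qed.

Lemma meanZ c f : integ f -> mean (fun w => c * f w) = c * mean f.
Proof.
move=> fi; apply: EFin_inj; rewrite -EFin_mean ?EFinM -?EFin_mean//; last exact: integZ.
by rewrite -integralZl.
Qed.

Lemma integZD c f g : integ f -> integ g -> integ (fun w => c * f w + g w).
Proof. by move=> fi gi; apply: integD => //; exact: integZ. Qed.

Lemma meanZD c f g : integ f -> integ g ->
  mean (fun w => c * f w + g w) = c * mean f + mean g.
Proof. by move=> fi gi; rewrite meanD ?meanZ//; exact: integZ. Qed.

Lemma meanN f : integ f -> mean (fun w => - f w) = - mean f.
Proof. by move=> fi; rewrite -mulN1r -meanZ//; congr mean; apply/funext => w; rewrite mulN1r. Qed.

Lemma meanB f g : integ f -> integ g -> mean (fun w => f w - g w) = mean f - mean g.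
Proof. by move=> fi gi; rewrite meanD ?meanN//; exact: integN. Qed.

Lemma mean_sum (I : finType) (f : I -> T -> R) :
  (forall i, integ (f i)) -> mean (fun w => \sum_i f i w) = \sum_i mean (f i).
Proof.
move=> fi; apply: EFin_inj; rewrite -EFin_mean ?integ_sum//.
under eq_integral do rewrite -sumEFin.
rewrite integral_sum//.
by rewrite -sumEFin; apply: eq_bigr => i _; rewrite EFin_mean.
Qed.

Lemma mean_ge0 f : {ae Q, forall w, 0 <= f w} -> integ f -> 0 <= mean f.
Proof.
move=> f0 fi; have mf := integ_measurable fi.
rewrite /mean (ae_eq_integral (fun w => (`|f w|)%:E))//.
- by apply: fine_ge0; apply: integral_ge0 => w _; rewrite lee_fin.
- exact/measurable_EFinP.
- by apply/measurable_EFinP; apply: measurableT_comp.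
- by apply: filterS f0 => w fw _; rewrite ger0_norm.
Qed.

Lemma mean_le f g : {ae Q, forall w, f w <= g w} -> integ f -> integ g ->
  mean f <= mean g.
Proof.
move=> fg fi gi; rewrite -subr_ge0 -meanB// mean_ge0//; last exact: integB.
by apply: filterS fg => w; rewrite subr_ge0.
Qed.

Lemma eq_mean_ae f g : {ae Q, forall w, f w = g w} -> integ f -> integ g ->
  mean f = mean g.
Proof.
by move=> fg fi gi; apply/eqP; rewrite eq_le; apply/andP; split; apply: mean_le => //;
  apply: filterS fg => w ->.
Qed.

Lemma integM_sq f g : measurable_fun setT f -> measurable_fun setT g ->
  integ (fun w => f w ^+ 2) -> integ (fun w => g w ^+ 2) ->
  integ (fun w => f w * g w).
Proof.
move=> mf mg fi gi; apply: (@integ_le _ (fun w => f w ^+ 2 + g w ^+ 2)).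
- exact: measurable_funM.
- exact: integD.
- apply: aeW => w; rewrite normrM -(real_normK (num_real (f w))).
  rewrite -(real_normK (num_real (g w))).
  have := sqr_ge0 (`|f w| - `|g w|); have := sqr_ge0 `|f w|; have := sqr_ge0 `|g w|.
  by rewrite sqrrB; lra.
Qed.

Lemma integ_of_sq f : measurable_fun setT f -> integ (fun w => f w ^+ 2) -> integ f.
Proof.
move=> mf fi; have m1 : measurable_fun setT (fun _ : T => 1 : R) by [].
have := integM_sq mf m1 fi (integ_cst _).
by rewrite (_ : (fun w => _) = f)//; apply/funext => w; rewrite mulr1.
Qed.

(** Nonnegativity of the variance. *)
Lemma mean_sqr_le f : measurable_fun setT f -> integ (fun w => f w ^+ 2) ->
  mean f ^+ 2 <= mean (fun w => f w ^+ 2).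
Proof.
move=> mf fi; have fi1 := integ_of_sq mf fi.
have : 0 <= mean (fun w => (f w - mean f) ^+ 2).
  apply: mean_ge0; first by apply: aeW => w; exact: sqr_ge0.
  rewrite (_ : (fun w => _) = fun w => f w ^+ 2 + (- 2 * mean f * f w + mean f ^+ 2)).
    by apply: integD => //; apply: integD; [exact: integZ|exact: integ_cst].
  by apply/funext => w; ring.
rewrite (_ : (fun w => _) = fun w => f w ^+ 2 + (- 2 * mean f * f w + mean f ^+ 2)).
  rewrite meanD// ?meanD ?meanZ ?mean_cst//; try exact: integZ; try exact: integ_cst; last first.
    by apply: integD; [exact: integZ|exact: integ_cst].
  by lra.
by apply/funext => w; ring.
Qed.

Lemma mean_indep d1 d2 (T1 : measurableType d1) (T2 : measurableType d2)
    (X : T -> T1) (Y : T -> T2) (u : T1 -> R) (v : T2 -> R) :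
  measurable_fun setT X -> measurable_fun setT Y -> indep2 Q X Y ->
  measurable_fun setT u -> measurable_fun setT v ->
  integ (fun w => u (X w)) -> integ (fun w => v (Y w)) ->
  integ (fun w => u (X w) * v (Y w)) /\
  mean (fun w => u (X w) * v (Y w)) =
    mean (fun w => u (X w)) * mean (fun w => v (Y w)).
Proof.
move=> mX mY XY mu mv iu iv.
have iuv : integ (fun w => u (X w) * v (Y w)).
  exact: (integrable_indep_prod mX mY XY mu mv iu iv).
split=> //; apply: EFin_inj; rewrite -EFin_mean// EFinM -!EFin_mean//.
exact: (integral_indep_prod mX mY XY mu mv iu iv).
Qed.

End Mean.

(** * The uniform distribution on the sphere *)

Section Reflection.
Context {R : realType} {n : nat}.
Implicit Types u v x y : 'rV[R]_n.

(** Householder reflection in the hyperplane orthogonal to [v]. It flips the sign of a coordinate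
    for a basis vector [v], transposes two coordinates for a difference of basis vectors, and
    carries one vector to another of equal length when [v] is their difference. *)
Definition refl v x : 'rV[R]_n := x - (2 * dot x v / dot v v) *: v.

Definition refl_mx v : 'M[R]_n := 1%:M - (2 / dot v v) *: (v^T *m v).

Lemma mul_tr_dot x v : x *m v^T = (dot x v)%:M.
Proof.
apply/matrixP => i j; rewrite !ord1 !mxE eqxx mulr1n.
by apply: eq_bigr => k _; rewrite !mxE.
Qed.

Lemma mul_refl_mx v x : x *m refl_mx v = refl v x.
Proof.
rewrite mulmxBr mulmx1 -scalemxAr mulmxA mul_tr_dot mul_scalar_mx scalerA /refl.
by congr (_ - _ *: _); ring.
Qed.

Lemma reflK v x : dot v v != 0 -> refl v (refl v x) = x.
Proof.
move=> v0; have h : dot (refl v x) v = - dot x v.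
  by rewrite /refl dotBl dotZl divfK//; ring.
rewrite {1}/refl h mulrN mulNr scaleNr opprK /refl subrK//.
Qed.

Lemma refl_mx_orthogonal v : dot v v != 0 -> refl_mx v *m (refl_mx v)^T = 1%:M.
Proof.
move=> v0; have -> : (refl_mx v)^T = refl_mx v.
  by rewrite /refl_mx linearB/= linearZ/= trmx1 trmx_mul trmxK.
apply/row_matrixP => i; rewrite !rowE mulmxA !mul_refl_mx reflK//.
by rewrite mulmx1.
Qed.

Lemma dot_refl v x y : dot v v != 0 -> dot (refl v x) y = dot x (refl v y).
Proof.
move=> v0; rewrite /refl dotBl dotBr dotZl dotZr (dotC v y); field.
by [].
Qed.

Lemma refl_swap u v : dot u u = dot v v -> u != v -> refl (u - v) u = v.
Proof.
move=> uv nuv; have w0 : dot (u - v) (u - v) != 0.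
  apply: contra nuv => /eqP h; rewrite -subr_eq0; apply/eqP/norm2_eq0.
  by rewrite norm2E h sqrtr0.
have c1 : 2 * dot u (u - v) / dot (u - v) (u - v) = 1.
  rewrite (_ : 2 * _ = dot (u - v) (u - v)) ?divff//.
  by rewrite !dotBl !dotBr (dotC v u) -uv; ring.
by rewrite /refl c1 scale1r subKr.
Qed.

Lemma refl_sub_neq0 u v : u != v -> dot (u - v) (u - v) != 0.
Proof.
move=> nuv; apply: contra nuv => /eqP h; rewrite -subr_eq0; apply/eqP/norm2_eq0.
by rewrite norm2E h sqrtr0.
Qed.

Lemma dot_delta2 (i j : 'I_n) : dot (delta_mx 0 i : 'rV[R]_n) (delta_mx 0 j) = (i == j)%:R.
Proof. by rewrite dot_delta mxE eqxx eq_sym. Qed.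

Lemma refl_delta (i : 'I_n) x k :
  refl (delta_mx 0 i) x 0 k = if k == i then - x 0 i else x 0 k.
Proof.
rewrite /refl !mxE dot_delta dot_delta2 !eqxx divr1; case: eqP => [->|_].
  by rewrite mulr1; ring.
by rewrite mulr0 subr0.
Qed.

Lemma refl_delta_sub (i j : 'I_n) x k : i != j ->
  refl (delta_mx 0 i - delta_mx 0 j) x 0 k = x 0 (tperm i j k).
Proof.
move=> ij; rewrite /refl !dotBl !dotBr !dot_delta !mxE !eqxx.
rewrite (eq_sym j i) (negbTE ij)/= !subr0 sub0r opprK.
rewrite (_ : 2 * (x 0 i - x 0 j) / (1 + 1) = x 0 i - x 0 j); last by field.
case: tpermP => [->|->|/eqP/negbTE-> /eqP/negbTE->].
- by rewrite eqxx (negbTE ij) mulr1n mulr0n; ring.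
- by rewrite eqxx eq_sym (negbTE ij) mulr1n mulr0n; ring.
- by rewrite subrr mulr0 subr0.
Qed.

Lemma coord_le_norm2 x i : `|x 0 i| <= norm2 x.
Proof.
have := dot_le_norm2 x (delta_mx 0 i).
by rewrite dot_delta norm2_delta mulr1.
Qed.

Lemma coord_norm2_1 x i : norm2 x = 1 -> `|x 0 i| <= 1.
Proof. by move=> <-; exact: coord_le_norm2. Qed.

End Reflection.

Section UniformSphere.
Context {R : realType} {n : nat} {d : measure_display} {T : measurableType d}.
Variables (Q : probability T R) (e : {mfun T >-> borel_rV R n}).
Hypothesis unif : uniform_sphere (distribution Q e).
Implicit Types (phi : 'rV[R]_n -> R) (C : R).

Lemma measurable_norm2 : measurable_fun [set: borel_rV R n] (@norm2 R n).
Proof.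
apply: (measurableT_comp (continuous_measurable_fun (@sqrt_continuous R))).
by apply: measurable_sum => i; apply: measurable_funX; exact: measurable_coord.
Qed.

Lemma sphere_norm1 : {ae Q, forall w, norm2 (e w : 'rV[R]_n) = 1}.
Proof.
pose S := [set x : borel_rV R n | norm2 x = 1].
have mS : measurable S.
  have := measurable_norm2 measurableT (measurable_set1 (1 : R)).
  by rewrite setTI.
have meS : measurable (e @^-1` S).
  by rewrite -[X in measurable X]setTI; exact: (measurable_funP e).
exists (~` (e @^-1` S)); split; [exact: measurableC| |by []].
rewrite -setTD measureD ?setTI//; last by rewrite ltey_eq fin_num_measure.
transitivity (1 - 1 : \bar R)%E; last by rewrite subee.
by congr (_ - _)%E; [exact: probability_setT|exact: unif.1].
Qed.

(** The direction lies on the sphere almost surely, so a bound there is enough for integrability;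
    polynomials have one. *)
Definition on_sphere_bounded phi C := forall x, norm2 x = 1 -> `|phi x| <= C.

Lemma integ_sphere phi C : measurable_fun [set: borel_rV R n] phi ->
  on_sphere_bounded phi C -> integ Q (fun w => phi (e w)).
Proof.
move=> mphi bphi; apply: (@integ_le _ _ _ Q _ (fun=> C)).
- exact: (measurableT_comp mphi (measurable_funP e)).
- exact: integ_cst.
- by apply: filterS sphere_norm1 => w; exact: bphi.
Qed.

Lemma measurable_refl v : measurable_fun [set: borel_rV R n] (refl v : _ -> borel_rV R n).
Proof.
apply: measurable_rV => i; rewrite (_ : (fun w => _) =
    fun w : 'rV[R]_n => w 0 i - (2 * (\sum_k w 0 k * v 0 k) / dot v v) * v 0 i); last first.
  by apply/funext => w; rewrite /refl !mxE.
apply: measurable_funB; first exact: measurable_coord.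
apply: measurable_funM => //; apply: measurable_funM => //; apply: measurable_funM => //.
by apply: measurable_sum => k; apply: measurable_funM => //; exact: measurable_coord.
Qed.

(** Reflections are orthogonal, so [refl v (e w)] has the same law as [e]. *)
Lemma mean_refl v phi C : dot v v != 0 -> measurable_fun [set: borel_rV R n] phi ->
  on_sphere_bounded phi C ->
  mean Q (fun w => phi (refl v (e w))) = mean Q (fun w => phi (e w)).
Proof.
move=> v0 mphi bphi.
have mr : measurable_fun setT (fun w => refl v (e w) : borel_rV R n).
  exact: (measurableT_comp (measurable_refl v) (measurable_funP e)).
pose e' : {mfun T >-> borel_rV R n} := HB.pack (fun w => refl v (e w) : borel_rV R n)
  (isMeasurableFun.Build _ _ _ _ (fun w => refl v (e w) : borel_rV R n) mr).
have law A : measurable A -> distribution Q e' A = distribution Q e A.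
  move=> mA; rewrite -(unif.2 (refl_mx v) (refl_mx_orthogonal v0) A mA).
  by congr (Q _); apply/seteqP; split => w /=; rewrite mul_refl_mx.
have ie := integ_sphere mphi bphi.
have ie' : integ Q (fun w => phi (e' w)).
  apply: (@integ_le _ _ _ Q _ (fun=> C)).
  - exact: (measurableT_comp mphi mr).
  - exact: integ_cst.
  - apply: filterS sphere_norm1 => w ew; apply: bphi.
    by rewrite norm2E /= dot_refl// reflK// -norm2E.
have mphi' : measurable_fun [set: borel_rV R n] (EFin \o phi) by exact/measurable_EFinP.
congr fine.
rewrite -[LHS](integral_distribution (X := e') mphi' ie').
rewrite -[RHS](integral_distribution (X := e) mphi' ie).
by apply: eq_measure_integral => A mA _; exact: law.
Qed.

End UniformSphere.

Section SphereMoments.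
Context {R : realType} {n : nat} {d : measure_display} {T : measurableType d}.
Variables (Q : probability T R) (e : {mfun T >-> borel_rV R n}).
Hypothesis unif : uniform_sphere (distribution Q e).

Local Notation "'\E' phi" := (mean Q (fun w => phi (e w : 'rV[R]_n)))
  (at level 10, phi at level 8).

Lemma measurable_dot (u : 'rV[R]_n) : measurable_fun [set: borel_rV R n] (dot u).
Proof.
by apply: measurable_sum => i; apply: measurable_funM => //; exact: measurable_coord.
Qed.

(** The reflection along [u - v] is self-adjoint and exchanges [u] and [v]. *)
Lemma mean_dot_pow (u v : 'rV[R]_n) k : dot u u = dot v v ->
  \E (fun x => dot u x ^+ k) = \E (fun x => dot v x ^+ k).
Proof.
move=> uv; have [->//|nuv] := eqVneq u v.
have w0 := refl_sub_neq0 nuv.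
rewrite -(@mean_refl _ _ _ _ Q e unif (u - v) (fun x => dot u x ^+ k) (norm2 u ^+ k))//.
- by congr mean; apply/funext => w; rewrite -dot_refl// refl_swap.
- by apply: measurable_funX; exact: measurable_dot.
- move=> x x1; rewrite normrX lerXn2r ?nnegrE ?norm2_ge0//.
  by rewrite (le_trans (dot_le_norm2 _ _))// x1 mulr1.
Qed.

Lemma monomial_bounded (i j : 'I_n) a b :
  on_sphere_bounded (fun x : 'rV[R]_n => x 0 i ^+ a * x 0 j ^+ b) 1.
Proof.
move=> x x1; rewrite normrM !normrX -[1](mulr1 1).
by rewrite ler_pM ?exprn_ile1 ?coord_norm2_1.
Qed.

Lemma measurable_monomial (i j : 'I_n) a b :
  measurable_fun [set: borel_rV R n] (fun x : 'rV[R]_n => x 0 i ^+ a * x 0 j ^+ b).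
Proof. by apply: measurable_funM; apply: measurable_funX; exact: measurable_coord. Qed.

Lemma integ_monomial (i j : 'I_n) a b :
  integ Q (fun w => (e w : 'rV[R]_n) 0 i ^+ a * (e w : 'rV[R]_n) 0 j ^+ b).
Proof.
exact: (integ_sphere unif (measurable_monomial i j a b) (@monomial_bounded i j a b)).
Qed.

Lemma mean_ext (f g : T -> R) : f =1 g -> mean Q f = mean Q g.
Proof. by move=> fg; congr mean; apply/funext. Qed.

Lemma poly_eq_of_horner (p q : {poly R}) : (forall b, p.[b] = q.[b]) -> p = q.
Proof.
move=> pq; apply/eqP; rewrite -subr_eq0; apply/eqP.
apply: (@roots_geq_poly_eq0 _ _ [seq i%:R | i <- iota 0 (size (p - q))]).
- by apply/allP => b _; rewrite /root !hornerE pq subrr.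
- by rewrite map_inj_uniq ?iota_uniq// => i j /eqP; rewrite eqr_nat => /eqP.
- by rewrite size_map size_iota.
Qed.

Lemma coef2_exp1DXn2 k : ((1 + 'X^2) ^+ k : {poly R})`_2 = k%:R.
Proof.
have c0 : ((1 + 'X^2) ^+ k : {poly R})`_0 = 1.
  elim: k => [|k IH]; first by rewrite expr0 coef1.
  by rewrite exprSr mulrDr mulr1 coefD coefMXn IH addr0.
elim: k c0 => [|k IH] c0; first by rewrite expr0 coef1.
have c0' : ((1 + 'X^2) ^+ k : {poly R})`_0 = 1.
  by move: c0; rewrite exprSr mulrDr mulr1 coefD coefMXn addr0.
by rewrite exprSr mulrDr mulr1 coefD coefMXn/= IH// c0' natr1.
Qed.

(* Rotation invariance makes [E (e_i + b e_j)^(2k+2)] equal to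
   [(1 + b^2)^(k+1) E e_i^(2k+2)]: compare the coefficients of [b^2]. *)
Lemma mixed_moment (i j : 'I_n) k : i != j ->
  (2 * k + 1)%:R * \E (fun x => x 0 i ^+ (2 * k) * x 0 j ^+ 2) =
  \E (fun x => x 0 i ^+ (2 * k.+1)).
Proof.
move=> ij; set M := RHS; pose N := (2 * k.+1)%N.
pose c l := \E (fun x => x 0 i ^+ (N - l) * x 0 j ^+ l).
pose p : {poly R} := \poly_(l < N.+1) (c l *+ 'C(N, l)).
pose q : {poly R} := M *: (1 + 'X^2) ^+ k.+1.
have pq : p = q.
  apply: poly_eq_of_horner => b.
  rewrite /q hornerZ horner_exp !hornerE horner_poly.
  transitivity (\E (fun x => dot (delta_mx 0 i + b *: delta_mx 0 j) x ^+ N)).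
    rewrite (@mean_ext _ (fun w => \sum_(l < N.+1) ('C(N, l)%:R * b ^+ l) *
        ((e w : 'rV[R]_n) 0 i ^+ (N - l) * (e w : 'rV[R]_n) 0 j ^+ l))); last first.
      move=> w; rewrite dotDl dotZl !(dotC (delta_mx _ _)) !dot_delta exprDn.
      by apply: eq_bigr => l _; rewrite exprMn -mulr_natl; ring.
    rewrite mean_sum; last by move=> l; apply: integZ; exact: integ_monomial.
    apply: eq_bigr => l _; rewrite meanZ; last exact: integ_monomial.
    by rewrite /c -mulr_natl; ring.
  have b0 : 0 <= 1 + b ^+ 2 by rewrite addr_ge0 ?sqr_ge0.
  (* [delta_i + b delta_j] has squared length [1 + b ^+ 2], hence may be replaced by a multiple of
     [delta_i]. *)
  rewrite (@mean_dot_pow _ (Num.sqrt (1 + b ^+ 2) *: delta_mx 0 i)); last first.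
    rewrite !(dotDl, dotDr, dotZl, dotZr) !dot_delta2 !eqxx (eq_sym j i) (negbTE ij).
    by rewrite !mulr1n !mulr0n !mulr1 !mulr0 !addr0 add0r -!expr2 sqr_sqrtr.
  rewrite (@mean_ext _ (fun w => (1 + b ^+ 2) ^+ k.+1 * ((e w : 'rV[R]_n) 0 i ^+ N))).
    by rewrite meanZ 1?mulrC//; have := integ_monomial i i N 0; under eq_fun do rewrite expr0 mulr1.
  by move=> w; rewrite dotZl dotC dot_delta exprMn {1}/N exprM sqr_sqrtr.
have := congr1 (fun r : {poly R} => r`_2) pq.
rewrite /p /q coef_poly coefZ coef2_exp1DXn2 ifT; last by rewrite /N; lia.
(* The factor [k.+1] cancels the coefficient of ['X^2] in [(1 + 'X^2) ^+ k.+1] and leaves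
   [2 * k + 1]. *)
have -> : 'C(N, 2) = (k.+1 * (2 * k + 1))%N by rewrite bin2 /N; lia.
rewrite /c (_ : N - 2 = 2 * k)%N; last by rewrite /N; lia.
rewrite -[X in X = _ -> _]mulr_natl natrM -mulrA => h.
by apply: (@mulfI _ k.+1%:R); rewrite ?pnatr_eq0// h mulrC.
Qed.

(** Insert [\sum_j x_j^2 = 1] in the moment of order [2 * k]: the term [j = i] is the next even
    moment, and by [mixed_moment] each of the [n - 1] others is that moment over [2 * k + 1]. *)
Lemma moment_rec (i : 'I_n) k :
  (2 * k + n)%:R * \E (fun x => x 0 i ^+ (2 * k.+1)) =
  (2 * k + 1)%:R * \E (fun x => x 0 i ^+ (2 * k)).
Proof.
have -> : \E (fun x => x 0 i ^+ (2 * k)) =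
    \sum_j \E (fun x => x 0 i ^+ (2 * k) * x 0 j ^+ 2).
  rewrite -mean_sum; last by move=> j; exact: integ_monomial.
  apply: eq_mean_ae.
  - apply: filterS (sphere_norm1 unif) => w ew.
    by rewrite -mulr_sumr -dotxx -norm2_sq ew expr1n mulr1.
  - by have := integ_monomial i i (2 * k) 0; under eq_fun do rewrite expr0 mulr1.
  - by apply: integ_sum => j; exact: integ_monomial.
rewrite (bigD1 i)//= (eq_bigr (fun=> (2 * k + 1)%:R^-1 * \E (fun x => x 0 i ^+ (2 * k.+1)))); last first.
  by move=> j ji; rewrite -(@mixed_moment i j) 1?eq_sym// mulKf// pnatr_eq0 addn1.
rewrite sumr_const cardC1 card_ord mulrDr.
have -> : \E (fun x => x 0 i ^+ (2 * k) * x 0 i ^+ 2) = \E (fun x => x 0 i ^+ (2 * k.+1)).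
  by apply: mean_ext => w; rewrite -exprD mulnS addnC.
have k1 : (2 * k + 1)%:R != 0 :> R by rewrite pnatr_eq0 addn1.
rewrite -mulrnAr mulVKf// -[X in _ = _ + X]mulr_natl.
rewrite -mulrDl -natrD; congr (_%:R * _).
by have := ltn_ord i; lia.
Qed.

(** By [moment_rec] consecutive even moments have ratio [(2 k + 1) / (2 k + n)], at most
    [2 (k + 1) / n]. These bounds grow with [k], so the last one may replace all earlier ones. *)
Lemma moment_bound (i : 'I_n) k :
  \E (fun x => x 0 i ^+ (2 * k)) <= ((2 * k)%:R / n%:R) ^+ k.
Proof.
have n0 : 0 < n%:R :> R by rewrite ltr0n; have := ltn_ord i; lia.
elim: k => [|k IH].
  by rewrite expr0 muln0; under mean_ext do rewrite expr0; rewrite mean_cst.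
have M0 m : 0 <= \E (fun x => x 0 i ^+ (2 * m)).
  apply: mean_ge0; first by apply: aeW => w; rewrite exprM exprn_ge0 ?sqr_ge0.
  by have := integ_monomial i i (2 * m) 0; under eq_fun do rewrite expr0 mulr1.
have h : \E (fun x => x 0 i ^+ (2 * k.+1)) <=
    (2 * k.+1)%:R / n%:R * \E (fun x => x 0 i ^+ (2 * k)).
  rewrite mulrAC ler_pdivlMr// mulrC.
  apply: (@le_trans _ _ ((2 * k + n)%:R * \E (fun x => x 0 i ^+ (2 * k.+1)))).
    by rewrite ler_wpM2r// ler_nat; lia.
  by rewrite moment_rec ler_wpM2r// ler_nat; lia.
apply: le_trans h _; rewrite exprS ler_wpM2l ?divr_ge0//.
apply: le_trans IH _; rewrite lerXn2r ?nnegrE ?divr_ge0// ler_pM2r ?invr_gt0//.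
by rewrite ler_nat; lia.
Qed.

End SphereMoments.

(** * Quadratic forms in the direction against a symmetric weight *)

Section Isotropy.
Context {R : realType} {n : nat} {d : measure_display} {T : measurableType d}.
Variables (Q : probability T R) (e : {mfun T >-> borel_rV R n}).
Hypothesis unif : uniform_sphere (distribution Q e).

Local Notation "'\E' phi" := (mean Q (fun w => phi (e w : 'rV[R]_n)))
  (at level 10, phi at level 8).

Variables (D : 'rV[R]_n -> R) (C : R).
Hypotheses (mD : measurable_fun [set: borel_rV R n] D) (DC : on_sphere_bounded D C).
Hypothesis D_sign : forall i x, D (refl (delta_mx 0 i) x) = D x.
Hypothesis D_swap : forall (i j : 'I_n) x, i != j ->
  D (refl (delta_mx 0 i - delta_mx 0 j) x) = D x.

Let psi i j (x : 'rV[R]_n) := x 0 i * x 0 j * D x.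

Let mpsi i j : measurable_fun [set: borel_rV R n] (psi i j).
Proof. by do 2 (apply: measurable_funM => //); exact: measurable_coord. Qed.

Let psiC i j : on_sphere_bounded (psi i j) C.
Proof.
move=> x x1; rewrite normrM -[C]mul1r ler_pM// ?DC//.
by rewrite normrM -[1](mulr1 1) ler_pM// coord_norm2_1.
Qed.

Lemma integ_isotropic i j : integ Q (fun w => psi i j (e w)).
Proof. exact: (integ_sphere unif (@mpsi i j) (@psiC i j)). Qed.

(** Flipping the sign of coordinate [i] negates [psi i j] when [j] differs from [i]. Transpositions
    make the diagonal means equal, and these add up to the mean of [D] because [e] is a unit
    vector. *)
Lemma mean_isotropic i j : \E (psi i j) = (i == j)%:R * (\E D / n%:R).
Proof.
have n0 : n%:R != 0 :> R by rewrite pnatr_eq0; have := ltn_ord i; lia.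
have [<-{j}|ij] := eqVneq i j; last first.
  have d0 : dot (delta_mx 0 i) (delta_mx 0 i : 'rV[R]_n) != 0.
    by rewrite dot_delta2 eqxx oner_eq0.
  have := mean_refl unif d0 (@mpsi i j) (@psiC i j).
  rewrite (@mean_ext _ _ _ Q _ (fun w => - psi i j (e w))); last first.
    move=> w; rewrite /psi D_sign !refl_delta eqxx eq_sym (negbTE ij).
    by rewrite !mulNr.
  rewrite meanN; last exact: integ_isotropic.
  by rewrite mul0r => h; lra.
have same j : \E (psi j j) = \E (psi i i).
  have [->//|ij] := eqVneq i j.
  rewrite -(mean_refl unif (refl_sub_neq0 _) (@mpsi i i) (@psiC i i) (v := delta_mx 0 i - delta_mx 0 j)).
    by apply: mean_ext => w; rewrite /psi D_swap// !refl_delta_sub// tpermL.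
  apply/eqP => /rowP/(_ i); rewrite !mxE !eqxx (negbTE ij)/= => /eqP.
  by rewrite oner_eq0.
have : \sum_j \E (psi j j) = \E D.
  rewrite -mean_sum; last by move=> j; exact: integ_isotropic.
  apply: eq_mean_ae.
  - apply: filterS (sphere_norm1 unif) => w ew.
    rewrite /psi -mulr_suml; under eq_bigr do rewrite -expr2.
    by rewrite -dotxx -norm2_sq ew expr1n mul1r.
  - by apply: integ_sum => j; exact: integ_isotropic.
  - exact: (integ_sphere unif mD DC).
rewrite (eq_bigr (fun=> \E (psi i i))); last by move=> j _; exact: same.
by rewrite sumr_const card_ord mul1r => <-; rewrite -[X in X / _]mulr_natr mulfK.
Qed.

Context d1 (T1 : measurableType d1) (X : T -> T1) (A B : T1 -> 'rV[R]_n).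
Hypotheses (mX : measurable_fun setT X) (Xe : indep2 Q X (e : T -> borel_rV R n)).
Hypotheses (mA : forall i, measurable_fun setT (fun s => A s 0 i))
  (mB : forall i, measurable_fun setT (fun s => B s 0 i)).
Hypotheses (iA : forall i, integ Q (fun w => A (X w) 0 i ^+ 2))
  (iB : forall i, integ Q (fun w => B (X w) 0 i ^+ 2)).

Let iAB i j : integ Q (fun w => A (X w) 0 i * B (X w) 0 j).
Proof.
apply: integM_sq (iA i) (iB j); first exact: (measurableT_comp (mA i) mX).
exact: (measurableT_comp (mB j) mX).
Qed.

Let expand w : dot (A (X w)) (e w) * dot (B (X w)) (e w) * D (e w) =
  \sum_i \sum_j (A (X w) 0 i * B (X w) 0 j) * psi i j (e w).
Proof.
rewrite /dot mulr_suml mulr_suml; apply: eq_bigr => i _.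
by rewrite mulr_sumr mulr_suml; apply: eq_bigr => j _; rewrite /psi; ring.
Qed.

Let term i j :
  integ Q (fun w => (A (X w) 0 i * B (X w) 0 j) * psi i j (e w)) /\
  mean Q (fun w => (A (X w) 0 i * B (X w) 0 j) * psi i j (e w)) =
  mean Q (fun w => A (X w) 0 i * B (X w) 0 j) * ((i == j)%:R * (\E D / n%:R)).
Proof.
rewrite -mean_isotropic.
apply: (@mean_indep _ _ _ Q _ _ _ _ X (e : T -> borel_rV R n)
  (fun s => A s 0 i * B s 0 j) (psi i j)) => //.
- by apply: measurable_funM.
- exact: integ_isotropic.
Qed.

Lemma integ_sphere_bilinear :
  integ Q (fun w => dot (A (X w)) (e w) * dot (B (X w)) (e w) * D (e w)).
Proof.
rewrite (_ : (fun w => _) =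
    fun w => \sum_i \sum_j (A (X w) 0 i * B (X w) 0 j) * psi i j (e w)).
  by apply: integ_sum => i; apply: integ_sum => j; case: (term i j).
by apply/funext => w; exact: expand.
Qed.

Lemma integ_dot_indep : integ Q (fun w => dot (A (X w)) (B (X w))).
Proof. by apply: integ_sum => i; exact: iAB. Qed.

(** After expansion, independence of [X] and [e] splits each mean, and [mean_isotropic] keeps only
    the diagonal terms, all with the same factor. *)
Lemma mean_sphere_bilinear :
  mean Q (fun w => dot (A (X w)) (e w) * dot (B (X w)) (e w) * D (e w)) =
  mean Q (fun w => dot (A (X w)) (B (X w))) * (\E D / n%:R).
Proof.
rewrite (mean_ext _ expand) mean_sum; last first.
  by move=> i; apply: integ_sum => j; case: (term i j).
rewrite mean_sum; last by move=> i; exact: iAB.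
rewrite mulr_suml; apply: eq_bigr => i _.
rewrite mean_sum; last by move=> j; case: (term i j).
rewrite (bigD1 i)//= (term i i).2 eqxx mul1r big1 ?addr0// => j ji.
by rewrite (term i j).2 eq_sym (negbTE ji) mul0r mulr0.
Qed.

End Isotropy.

Section DualWeight.
Context {R : realType} {n : nat} {d : measure_display} {T : measurableType d}.
Variables (Q : probability T R) (e : {mfun T >-> borel_rV R n}).
Hypothesis unif : uniform_sphere (distribution Q e).

Definition power_weight (a b : R) k (x : 'rV[R]_n) : R := a + b * \sum_i x 0 i ^+ (2 * k).

Lemma measurable_power_weight a b k :
  measurable_fun [set: borel_rV R n] (power_weight a b k).
Proof.
apply: measurable_funD => //; apply: measurable_funM => //.
by apply: measurable_sum => i; apply: measurable_funX; exact: measurable_coord.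
Qed.

Lemma power_weight_bounded a b k : 0 <= a -> 0 <= b ->
  on_sphere_bounded (power_weight a b k) (a + b * n%:R).
Proof.
move=> a0 b0 x x1; rewrite ger0_norm; last first.
  rewrite addr_ge0// mulr_ge0// sumr_ge0// => i _.
  by rewrite exprM exprn_ge0 ?sqr_ge0.
rewrite lerD2l ler_wpM2l//.
apply: le_trans (_ : \sum_(i < n) 1 <= _); last by rewrite sumr_const card_ord.
apply: ler_sum => i _; rewrite -[leLHS]ger0_norm ?normrX ?exprn_ile1 ?coord_norm2_1//.
by rewrite exprM exprn_ge0 ?sqr_ge0.
Qed.

Lemma power_weight_sign a b k (i : 'I_n) x :
  power_weight a b k (refl (delta_mx 0 i) x) = power_weight a b k x.
Proof.
congr (_ + _ * _); apply: eq_bigr => j _; rewrite refl_delta.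
by case: eqP => // ->; rewrite !exprM sqrrN.
Qed.

Lemma power_weight_swap a b k (i j : 'I_n) x : i != j ->
  power_weight a b k (refl (delta_mx 0 i - delta_mx 0 j) x) = power_weight a b k x.
Proof.
move=> ij; congr (_ + _ * _).
rewrite [RHS](reindex_inj (@perm_inj _ (tperm i j))).
by apply: eq_bigr => l _; rewrite refl_delta_sub.
Qed.

Lemma mean_power_weight a b k : 0 <= a -> 0 <= b ->
  mean Q (fun w => power_weight a b k (e w)) <= a + b * (n%:R * ((2 * k)%:R / n%:R) ^+ k).
Proof.
move=> a0 b0.
have im (i : 'I_n) : integ Q (fun w => (e w : 'rV[R]_n) 0 i ^+ (2 * k)).
  by have := integ_monomial unif i i (2 * k) 0; under eq_fun do rewrite expr0 mulr1.
rewrite /power_weight meanD ?mean_cst ?meanZ ?mean_sum//; last 3 first.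
- exact: integ_sum.
- exact: integ_cst.
- by apply: integZ; exact: integ_sum.
rewrite lerD2l ler_wpM2l//.
apply: (@le_trans _ _ (\sum_(i < n) ((2 * k)%:R / n%:R) ^+ k)).
  by apply: ler_sum => i _; exact: moment_bound.
by rewrite sumr_const card_ord [leRHS]mulr_natl.
Qed.

End DualWeight.

(** * Smooth and strongly convex functions *)

Section Calculus.
Context {R : realType} {n : nat}.
Implicit Types (f : 'rV[R]_n -> R) (x y v s : 'rV[R]_n).

Lemma diff_dot f x v : differentiable f x -> 'd f x v = dot (grad f x) v.
Proof.
move=> df; rewrite [v in LHS]row_sum linear_sum; apply: eq_bigr => i _.
by rewrite linearZ/= mxE mulrC.
Qed.

Lemma is_derive_line f x v (t : R) : differentiable f (x + t *: v) ->
  is_derive t 1 (fun r : R => f (x + r *: v)) (dot (grad f (x + t *: v)) v).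
Proof.
move=> df; have E : (fun h : R => h^-1 *: (((fun r : R => f (x + r *: v)) \o shift t) (h *: 1) - f (x + t *: v)))
    = (fun h : R => h^-1 *: ((f \o shift (x + t *: v)) (h *: v) - f (x + t *: v))).
  apply/funext => h /=; congr (_ *: (f _ - _)).
  by rewrite [h *: 1]mulr1 scalerDl addrCA.
apply: DeriveDef.
  by rewrite /derivable E; exact: diff_derivable.
by rewrite /derive E -diff_dot// -deriveE.
Qed.

(** Fermat's rule along each coordinate line. At the argmin of the mirror step it gives the explicit
    increment of the dual variable. *)
Lemma grad_minimizer f s z : (forall x, differentiable f x) ->
  minimizer (fun u => f u - dot s u) z -> grad f z = s.
Proof.
move=> df zmin; apply/rowP => i; rewrite -!dot_delta; set v := delta_mx 0 i.
pose phi (r : R) := f (z + r *: v) - r * dot s v.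
have dphi (t : R) : is_derive t 1 phi (dot (grad f (z + t *: v)) v - dot s v).
  apply: is_deriveB; first exact: is_derive_line.
  apply: is_derive_eq; by rewrite scaler0 add0r [_ *: 1]mulr1.
have m11 : -1 <= 1 :> R by rewrite (@le_trans _ _ 0)// lerN10.
have d11 (t : R) : t \in `]-1, 1[ -> derivable phi t 1 by move=> _; case: (dphi t).
have i0 : (0 : R) \in `]-1, 1[ by rewrite in_itv/= ltrN10 ltr01.
have min0 (t : R) : t \in `]-1, 1[ -> phi 0 <= phi t.
  move=> _; have := zmin (z + t *: v).
  by rewrite /phi scale0r addr0 mul0r subr0 dotDr dotZr; lra.
have := derive1_at_min m11 d11 i0 min0.
move=> [_ h0]; have [_] := dphi 0; rewrite h0 scale0r addr0.
by move/eqP; rewrite eq_sym subr_eq0 => /eqP.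
Qed.

Lemma norm2_le_sum x : norm2 x <= \sum_i `|x 0 i|.
Proof.
rewrite -(ler_pXn2r (_ : 0 < 2)%N)// ?nnegrE ?norm2_ge0 ?sumr_ge0//.
rewrite norm2_sq dotxx expr2 mulr_suml; apply: ler_sum => i _.
rewrite -[leLHS]ger0_norm ?sqr_ge0// normrX expr2 ler_wpM2l//.
by rewrite (bigD1 i)//= lerDl sumr_ge0.
Qed.

Lemma near_norm2 x (r : R) : 0 < r -> \forall y \near x, norm2 (y - x) < r.
Proof.
(* The topology is that of the sup norm; dividing by [n.+1] rather than [n] makes the final
   inequality strict and covers [n = 0]. *)
move=> r0; have nr : 0 < r / n.+1%:R by rewrite divr_gt0.
apply/nbhs_ballP; exists (r / n.+1%:R) => //= y [_ xy].
apply: le_lt_trans (norm2_le_sum _) _.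
apply: (@le_lt_trans _ _ (\sum_(i < n) (r / n.+1%:R))).
  apply: ler_sum => i _; have := xy 0 i; rewrite /ball/= distrC => /ltW.
  by rewrite !mxE.
rewrite sumr_const card_ord -[ltLHS]mulr_natr -mulrA gtr_pMr// mulrC ltr_pdivrMr ?ltr0n//.
by rewrite mul1r ltr_nat.
Qed.

Lemma continuous_of_norm2 f :
  (forall x, exists K, forall y, norm2 (y - x) <= 1 -> `|f y - f x| <= K * norm2 (y - x)) ->
  continuous f.
Proof.
move=> H x; have [K HK] := H x.
have K1 : 0 < `|K| + 1 by rewrite ltr_wpDl.
have Fx : Filter (nbhs x) := nbhs_filter x.
apply/(@cvgrPdist_lt _ _ _ (nbhs x) Fx) => eps eps0.
have e0 : 0 < Num.min 1 (eps / (`|K| + 1)) by rewrite lt_min ltr01 divr_gt0.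
near=> y; have : norm2 (y - x) < Num.min 1 (eps / (`|K| + 1)).
  by near: y; exact: near_norm2.
rewrite lt_min => /andP[y1 ye]; rewrite distrC.
apply: (le_lt_trans (HK y (ltW y1))); apply: (@le_lt_trans _ _ ((`|K| + 1) * norm2 (y - x))).
  by rewrite ler_wpM2r ?norm2_ge0// (le_trans (ler_norm _))// lerDl.
by rewrite mulrC -ltr_pdivlMr.
Unshelve. all: by end_near. Qed.

Lemma continuous_lip f K : (forall x y, `|f y - f x| <= K * norm2 (y - x)) -> continuous f.
Proof. by move=> H; apply: continuous_of_norm2 => x; exists K => y _; exact: H. Qed.

Lemma norm2_triangle x y : norm2 (x + y) <= norm2 x + norm2 y.
Proof.
rewrite -(ler_pXn2r (_ : 0 < 2)%N)// ?nnegrE ?addr_ge0 ?norm2_ge0//.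
rewrite norm2_sq dotDl !dotDr (dotC y x) sqrrD !norm2_sq.
have := le_trans (ler_norm _) (dot_le_norm2 x y); lra.
Qed.

Lemma continuous_norm2 : continuous (@norm2 R n).
Proof.
apply: (@continuous_lip _ 1) => x y; rewrite mul1r ler_norml.
have h1 := norm2_triangle (y - x) x; have h2 := norm2_triangle (x - y) y.
have h3 : norm2 (x - y) = norm2 (y - x) by rewrite -opprB -scaleN1r norm2Z normrN normr1 mul1r.
by rewrite subrK in h1; rewrite subrK h3 in h2; apply/andP; split; lra.
Qed.

Lemma compact_norm2_ball (r : R) : compact [set x : 'rV[R]_n | norm2 x <= r].
Proof.
apply: bounded_closed_compact.
  exists r; split; first exact: num_real.
  move=> M rM x /= xr; rewrite (_ : `|x| = mx_norm x)// mx_normrE.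
  apply: bigmax_le; first exact: le_trans (le_trans (norm2_ge0 x) xr) (ltW rM).
  move=> [j i] _ /=; rewrite ord1.
  exact: le_trans (coord_le_norm2 _ _) (le_trans xr (ltW rM)).
apply: (@preimage_closed _ _ (@norm2 R n) [set a : R | a <= r]).
  by move=> x _; exact: continuous_norm2.
exact: closed_le.
Qed.

End Calculus.

(** * The inverse of the gradient of the prox-function, and the mirror step *)

Section MirrorMap.
Context {R : realType} {n : nat} (p : R) (prox : 'rV[R]_n -> R).
Hypotheses (p12 : 1 <= p <= 2) (proxP : prox_function p prox).
Implicit Types (x y z u v s : 'rV[R]_n).

Let p02 : 0 < p <= 2.
Proof. by case/andP: p12 => p1 ->; rewrite (lt_le_trans ltr01). Qed.

Lemma bregman_ge_normp z u : 2^-1 * normp p (u - z) ^+ 2 <= bregman prox z u.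
Proof. exact: prox_strongly_convex proxP _ _. Qed.

Lemma bregman_ge z u : 2^-1 * dot (u - z) (u - z) <= bregman prox z u.
Proof.
by apply: le_trans (bregman_ge_normp z u); rewrite ler_pM2l ?invr_gt0// norm2_le_normp.
Qed.

Lemma bregman_ge0 z u : 0 <= bregman prox z u.
Proof. by apply: le_trans (bregman_ge z u); rewrite mulr_ge0 ?invr_ge0 ?dotxx_ge0. Qed.

(** The strong convexity inequalities at [x] and at [y] add up to strong monotonicity with modulus 1
    in the Euclidean norm; Cauchy-Schwarz concludes. *)
Lemma grad_expansive x y : norm2 (x - y) <= norm2 (grad prox x - grad prox y).
Proof.
have h : dot (x - y) (x - y) <= dot (grad prox x - grad prox y) (x - y).
  have := bregman_ge x y; have := bregman_ge y x; rewrite /bregman.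
  move: (grad prox x) (grad prox y) (prox x) (prox y) => a b px py.
  rewrite -(opprB x y) [dot a _]dotNr dotNl dotNr (dotBl a b); lra.
have := le_trans h (le_trans (ler_norm _) (dot_le_norm2 _ _)).
rewrite -norm2_sq expr2; have [->|xy] := eqVneq (norm2 (x - y)) 0.
  by rewrite norm2_ge0.
by rewrite ler_pM2r// lt_neqAle eq_sym xy norm2_ge0.
Qed.

(** By strong convexity at 0, the tilted function is at least its value at 0 outside the ball of
    radius [r], so its minimum over this compact ball is global. *)
Lemma tilted_prox_minimizer s : exists z, minimizer (fun u => prox u - dot s u) z.
Proof.
pose phi u := prox u - dot s u.
pose r := 2 * norm2 (grad prox 0 - s).
pose K := [set x : 'rV[R]_n | norm2 x <= r].
have r0 : 0 <= r by rewrite mulr_ge0 ?norm2_ge0.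
have K0 : K 0 by rewrite /K/= norm2E dot0l sqrtr0.
have cphi : continuous phi.
  have cs : continuous (dot s).
    by apply: (@continuous_lip _ _ _ (norm2 s)) => y z; rewrite -dotBr dot_le_norm2.
  by move=> x; apply: (continuousB (prox_continuous proxP (x := x)) (cs x)).
have [|z zK zmin] := @EVT_min_rV _ _ phi K (ex_intro _ 0 K0) (@compact_norm2_ball R n r).
  exact: continuous_subspaceT.
exists z => u; have [uK|uK] := leP (norm2 u) r.
  by apply: zmin; rewrite inE.
apply: le_trans (zmin 0 _) _; first by rewrite inE.
have := bregman_ge 0 u; rewrite /bregman subr0 -norm2_sq /phi => h.
have h2 := le_trans (ler_norm _) (dot_le_norm2 (s - grad prox 0) u).
have h3 : norm2 (s - grad prox 0) = r / 2.
  by rewrite /r -opprB -scaleN1r norm2Z normrN normr1 mul1r mulrAC divff// mul1r.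
rewrite h3 dotBl in h2; rewrite [dot s 0]dotC dot0l.
have u0 : 0 <= norm2 u * (norm2 u - r) by rewrite mulr_ge0 ?norm2_ge0 ?subr_ge0 ?ltW.
by move: h h2 u0; rewrite expr2; lra.
Qed.

(** [Phi] is defined everywhere because the first-order condition at a tilted minimizer reads
    [grad prox z = s]. *)
Lemma mirror_map : exists Phi : 'rV[R]_n -> 'rV[R]_n,
  [/\ forall s, grad prox (Phi s) = s, forall z, Phi (grad prox z) = z &
      forall s s', norm2 (Phi s - Phi s') <= norm2 (s - s')].
Proof.
have /choice[Phi PhiP] : forall s, exists z, grad prox z = s.
  move=> s; have [z zmin] := tilted_prox_minimizer s; exists z.
  by apply: grad_minimizer zmin => x; exact: (prox_differentiable proxP).
exists Phi; split=> [//|z|s s'].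
- apply/eqP; rewrite -subr_eq0; apply/eqP/norm2_eq0/eqP.
  rewrite eq_le norm2_ge0 andbT (le_trans (grad_expansive _ _))// PhiP subrr.
  by rewrite norm2E dot0l sqrtr0.
- by rewrite (le_trans (grad_expansive _ _))// !PhiP.
Qed.

(* The inequality uses [c t <= c^2 D / 2 + t^2 / (2 D)] with [t = <e, z - z'>]. *)
Lemma mirror_descent z z' u e (c D : R) : 0 <= D ->
  (forall v, dot e v ^+ 2 <= D * normp p v ^+ 2) ->
  grad prox z' = grad prox z - c *: e ->
  bregman prox z' u <= bregman prox z u - c * dot e (z - u) + 2^-1 * c ^+ 2 * D.
Proof.
move=> D0 De gz.
(* Three-point identity of Bregman divergences. *)
have E : bregman prox z' u =
    bregman prox z u - c * dot e (z - u) + (c * dot e (z - z') - bregman prox z z').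
  rewrite /bregman gz; move: (grad prox z) (prox z) (prox z') (prox u) => a pz pz' pu.
  by rewrite (dotBl a) dotZl !(dotBr _ _ a) !(dotBr _ _ e); ring.
rewrite E lerD2l; have := bregman_ge_normp z z'.
have := De (z' - z); rewrite -[z - z']opprB dotNr.
set N := normp _ _ ^+ 2; set t := dot _ _ => h1 h2.
suff : - (c * t) <= 2^-1 * c ^+ 2 * D + 2^-1 * N by lra.
(* Young's inequality would divide by [D]; when [D = 0], the hypothesis [De] forces [t = 0]. *)
have [d0|d0] := eqVneq D 0.
  have N0 : 0 <= N by exact: sqr_ge0.
  move: h1; rewrite d0 mul0r => h1; have t0 : t = 0.
    by apply/eqP; rewrite -sqrf_eq0 eq_le h1 sqr_ge0.
  by rewrite t0 !mulr0 oppr0 add0r mulr_ge0 ?invr_ge0.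
have D1 : 0 < D by rewrite lt_neqAle eq_sym d0.
have h3 : 0 <= (c * D + t) ^+ 2 by exact: sqr_ge0.
rewrite -(ler_pM2l D1) -subr_ge0.
have -> : D * (2^-1 * c ^+ 2 * D + 2^-1 * N) - D * (- (c * t)) =
  2^-1 * (c * D + t) ^+ 2 + 2^-1 * (D * N - t ^+ 2) by field.
by apply: addr_ge0; apply: mulr_ge0; rewrite ?invr_ge0// subr_ge0.
Qed.

End MirrorMap.

Section Taylor.
Context {R : realType} {n : nat}.
Implicit Types (f : 'rV[R]_n -> R) (g : 'rV[R]_n -> 'rV[R]_n) (x y v : 'rV[R]_n).

(** The mean value theorem is applied on the segment to [f] minus [r * a + r ^+ 2 * c]. With [c]
    equal to plus or minus [K / 2 * dot v v], the term [2 * t * c] compensates the Lipschitz bound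
    [K * t * dot v v] at the unknown point [t], so no integral of the gradient is taken. *)
Lemma taylor_Lipschitz f g (K : R) x v : (forall y, has_gradient f y (g y)) ->
  (forall y z, norm2 (g y - g z) <= K * norm2 (y - z)) ->
  `|f (x + v) - f x - dot (g x) v| <= K / 2 * dot v v.
Proof.
move=> fg gK; set a := dot (g x) v.
have key c : exists t, [/\ 0 < t, t < 1 &
    f (x + v) - f x - a - c = dot (g (x + t *: v) - g x) v - 2 * t * c].
  pose psi (r : R) := f (x + r *: v) - (r * a + r ^+ 2 * c).
  have dpsi (t : R) : is_derive t 1 psi (dot (g (x + t *: v)) v - (a + 2 * t * c)).
    have [df gf] := fg (x + t *: v).
    apply: is_deriveB; first by rewrite -gf; exact: is_derive_line.
    apply: is_derive_eq; rewrite ?scaler0 ?add0r /=.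
    by rewrite /GRing.scale/=; ring.
  have cpsi (t : R) : {for t, continuous psi}.
    by have [h _] := dpsi t; apply: differentiable_continuous; exact/derivable1_diffP.
  have [|t t01 E] := @MVT R psi _ 0 1 ltr01 (fun t _ => dpsi t).
    by apply: continuous_subspaceT => t; exact: cpsi.
  move: t01; rewrite in_itv/= => /andP[t0 t1]; exists t; split=> //.
  move: E; rewrite /psi scale1r scale0r addr0 subr0 mulr1 expr1n !mul1r mul0r expr0n/= mul0r.
  by rewrite dotBl -/a; lra.
have bnd (t : R) : 0 < t -> `|dot (g (x + t *: v) - g x) v| <= K * t * dot v v.
  move=> t0; apply: le_trans (dot_le_norm2 _ _) _.
  have := gK (x + t *: v) x; rewrite addrAC subrr add0r norm2Z gtr0_norm// => h.
  rewrite -norm2_sq expr2 !mulrA ler_wpM2r ?norm2_ge0//.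
  by rewrite -mulrA.
rewrite ler_norml; apply/andP; split.
- have [t [t0 t1 E]] := key (- (K / 2 * dot v v)).
  by have := bnd t t0; rewrite ler_norml => /andP[h _]; lra.
- have [t [t0 t1 E]] := key (K / 2 * dot v v).
  by have := bnd t t0; rewrite ler_norml => /andP[_ h]; lra.
Qed.

End Taylor.

(** * The stochastic problem *)

Section ProblemFacts.
Context {R : realType} {n : nat} {d : measure_display} {X : measurableType d}.
Context (P : probability X R) (F : 'rV[R]_n -> X -> R) (f : 'rV[R]_n -> R)
  (g : 'rV[R]_n -> X -> 'rV[R]_n) (L : X -> R) (L2 sigma : R).
Hypotheses (n0 : (0 < n)%N) (pb : stochastic_problem P F f g L L2 sigma).
Implicit Types (x y v : 'rV[R]_n).

Definition mean_grad x : 'rV[R]_n := \row_i mean P (fun xi => g x xi 0 i).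

Lemma le_fine_integral_nneg (u : X -> R) (c : R) : measurable_fun setT u ->
  (forall xi, 0 <= u xi) -> (\int[P]_xi (u xi)%:E <= c%:E)%E ->
  integ P u /\ mean P u <= c.
Proof.
move=> mu u0 uc; have iu : integ P u.
  apply/integrableP; split; first exact/measurable_EFinP.
  under eq_integral do rewrite /= ger0_norm//.
  exact: le_lt_trans uc (ltry _).
by split=> //; rewrite -lee_fin -EFin_mean.
Qed.

Lemma sq_integ_L : integ P (fun xi => L xi ^+ 2) /\ mean P (fun xi => L xi ^+ 2) <= L2 ^+ 2.
Proof.
apply: le_fine_integral_nneg.
- by apply: measurable_funX; exact: measurable_L pb.
- by move=> xi; exact: sqr_ge0.
have := L2_bound pb; rewrite unlock => h.
have {}h : (sqrte (\int[P]_xi (L xi ^+ 2)%:E) <= sqrte (L2 ^+ 2)%:E)%E.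
  by rewrite [leRHS]/= sqrtr_sqr ger0_norm// ltW// (L2_gt0 pb).
by rewrite lee_sqrt ?lee_fin ?sqr_ge0 in h.
Qed.

(** Tested on a unit vector and 0, the Lipschitz inequality bounds a norm by [L xi]; a unit vector
    exists because [n] is positive. *)
Lemma L_ge0 : {ae P, forall xi, 0 <= L xi}.
Proof.
apply: filterS (Lipschitz_g pb) => xi H.
have := H (delta_mx 0 (Ordinal n0)) 0; rewrite subr0 norm2_delta mulr1.
exact: le_trans (norm2_ge0 _).
Qed.

Lemma mean_L : integ P L /\ mean P L <= L2.
Proof.
have [i2 m2] := sq_integ_L; have mL := measurable_L pb.
have iL := integ_of_sq mL i2; split=> //.
rewrite -(ler_pXn2r (_ : 0 < 2)%N)// ?nnegrE ?(ltW (L2_gt0 pb))//.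
  exact: le_trans (mean_sqr_le mL i2) m2.
exact: mean_ge0 L_ge0 iL.
Qed.

Lemma measurable_g_coord x i : measurable_fun setT (fun xi => g x xi 0 i).
Proof.
have mg : measurable_fun setT (fun xi => g x xi : borel_rV R n).
  by have := measurableT_comp (measurable_g pb) (pair1_measurable (x : borel_rV R n)).
exact: (measurableT_comp (measurable_coord i) mg).
Qed.

Lemma variance_integ x : integ P (fun xi => dot (g x xi - grad f x) (g x xi - grad f x)) /\
  mean P (fun xi => dot (g x xi - grad f x) (g x xi - grad f x)) <= sigma ^+ 2.
Proof.
apply: le_fine_integral_nneg; last 1 first.
- have := variance_g pb x; rewrite unlock.
  by under eq_integral do rewrite norm2_sq.
- apply: measurable_sum => i; under eq_fun do rewrite !mxE.
  by apply: measurable_funM; apply: measurable_funB => //; exact: measurable_g_coord.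
- by move=> xi; exact: dotxx_ge0.
Qed.

(** The variance hypothesis is centred at [grad f x]; changing the centre adds an affine function of
    an integrable variable. *)
Lemma sq_integ_centered x (c : R) i : integ P (fun xi => (g x xi 0 i - c) ^+ 2).
Proof.
have h : integ P (fun xi => (g x xi 0 i - (grad f x) 0 i) ^+ 2).
  apply: (@integ_le _ _ _ P _ (fun xi => dot (g x xi - grad f x) (g x xi - grad f x))).
  - apply: measurable_funX; apply: measurable_funB => //; exact: measurable_g_coord.
  - by case: (variance_integ x).
  - apply: aeW => xi; rewrite ger0_norm ?sqr_ge0// dotxx (bigD1 i)//= !mxE.
    by rewrite lerDl sumr_ge0// => j _; exact: sqr_ge0.
have h1 := integ_of_sq (measurable_funB (measurable_g_coord x i)
   (@measurable_cst _ _ _ _ setT ((grad f x) 0 i : R))) h.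
rewrite (_ : (fun xi => _) = fun xi => (g x xi 0 i - (grad f x) 0 i) ^+ 2
  + (2 * ((grad f x) 0 i - c) * (g x xi 0 i - (grad f x) 0 i) + ((grad f x) 0 i - c) ^+ 2)).
  by apply: integD => //; apply: integD; [exact: integZ|exact: integ_cst].
by apply/funext => xi; ring.
Qed.

Lemma sq_integ_g x i : integ P (fun xi => g x xi 0 i ^+ 2).
Proof. by have := sq_integ_centered x 0 i; under eq_fun do rewrite subr0. Qed.

Lemma integ_g x i : integ P (fun xi => g x xi 0 i).
Proof. exact: integ_of_sq (measurable_g_coord x i) (sq_integ_g x i). Qed.

Lemma integ_dot_g x v : integ P (fun xi => dot (g x xi) v).
Proof.
apply: integ_sum => i; under eq_fun do rewrite mulrC.
by apply: integZ; exact: integ_g.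
Qed.

Lemma mean_dot_g x v : mean P (fun xi => dot (g x xi) v) = dot (mean_grad x) v.
Proof.
rewrite mean_sum; last first.
  by move=> i; under eq_fun do rewrite mulrC; apply: integZ; exact: integ_g.
apply: eq_bigr => i _; rewrite mxE mulrC -meanZ; last exact: integ_g.
by apply: mean_ext => xi; rewrite mulrC.
Qed.

(* The mean minimizes the mean square deviation, so the variance bound around
   [grad f x] holds around the mean whether or not the two coincide. *)
Lemma variance_mean_grad x :
  mean P (fun xi => dot (g x xi - mean_grad x) (g x xi - mean_grad x)) <= sigma ^+ 2.
Proof.
apply: le_trans (variance_integ x).2.
set c := grad f x; set h := mean_grad x.
have E xi : dot (g x xi - c) (g x xi - c) = dot (g x xi - h) (g x xi - h) +
    (2 * dot (g x xi) (h - c) + (dot c c - dot h h)).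
  by rewrite !(dotBl, dotBr) (dotC c) (dotC h); ring.
rewrite [leRHS](mean_ext _ E) meanD.
- rewrite meanD ?meanZ ?mean_dot_g ?mean_cst -/h; first last.
  + exact: integ_cst.
  + by apply: integZ; exact: integ_dot_g.
  + exact: integ_dot_g.
  rewrite lerDl; have := dotxx_ge0 (h - c).
  by rewrite !(dotBl, dotBr) (dotC c h); lra.
- rewrite (_ : (fun xi => _) = fun xi => \sum_i (g x xi 0 i - h 0 i) ^+ 2).
    by apply: integ_sum => i; exact: sq_integ_centered.
  by apply/funext => xi; rewrite dotxx; apply: eq_bigr => i _; rewrite !mxE.
- by apply: integD; [apply: integZ; exact: integ_dot_g|exact: integ_cst].
Qed.

Lemma taylor_F : {ae P, forall xi, forall x v,
  `|F (x + v) xi - F x xi - dot (g x xi) v| <= L xi / 2 * dot v v}.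
Proof.
apply: filterS2 (gradient_F pb) (Lipschitz_g pb) => xi gF Lg x v.
exact: (@taylor_Lipschitz _ _ (F^~ xi) (g^~ xi) (L xi)).
Qed.

Lemma mean_F x : integ P (F x) /\ mean P (F x) = f x.
Proof.
have iF : integ P (F x) by exact: integrable_F pb x.
by split=> //; apply: EFin_inj; rewrite -EFin_mean// -(objectiveE pb x) unlock.
Qed.

(** Average of [taylor_F]: the linear term has mean [dot (mean_grad x) v], and the modulus [L] has
    mean at most [L2]. *)
Lemma taylor_f x v : `|f (x + v) - f x - dot (mean_grad x) v| <= L2 / 2 * dot v v.
Proof.
have [iF1 <-] := mean_F (x + v); have [iF <-] := mean_F x.
have [iL mL] := mean_L.
rewrite -mean_dot_g -!meanB//; [|exact: integB|exact: integ_dot_g].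
have iD : integ P (fun xi => F (x + v) xi - F x xi - dot (g x xi) v).
  by apply: integB; [exact: integB|exact: integ_dot_g].
have up : mean P (fun xi => dot v v / 2 * L xi) <= L2 / 2 * dot v v.
  by rewrite meanZ// (_ : L2 / 2 * _ = dot v v / 2 * L2) ?ler_wpM2l ?divr_ge0 ?dotxx_ge0//; ring.
have iv : integ P (fun xi => dot v v / 2 * L xi) by exact: integZ.
rewrite ler_norml; apply/andP; split.
- rewrite lerNl -meanN//; apply: le_trans up; apply: mean_le => //; last exact: integN.
  by apply: filterS taylor_F => xi /(_ x v); rewrite ler_norml => /andP[h _]; lra.
- apply: le_trans up; apply: mean_le => //.
  by apply: filterS taylor_F => xi /(_ x v); rewrite ler_norml => /andP[_ h]; lra.
Qed.

(** Over a step [s] towards [y], convexity bounds the increment of [f] by [s * (f y - f x)], while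
    [taylor_f] gives its linear part up to [K * s ^+ 2]. Division by [s] leaves an error [K * s]. *)
Lemma convex_f_grad x y : f x + dot (mean_grad x) (y - x) <= f y.
Proof.
set v := y - x; set K := L2 / 2 * dot v v.
have K0 : 0 <= K by rewrite mulr_ge0 ?dotxx_ge0 ?divr_ge0 ?ltW ?(L2_gt0 pb).
apply/ler_addgt0Pr => eps eps0.
(* Keeps [s] in []0, 1]] and [K * s] at most [eps], also when [K = 0]. *)
pose s := eps / (K + eps).
have Ke : 0 < K + eps by rewrite ltr_wpDl.
have s0 : 0 < s by rewrite divr_gt0.
have s1 : s <= 1 by rewrite ler_pdivrMr// mul1r lerDr.
have sK : K * s <= eps.
  by rewrite /s mulrA ler_pdivrMr// mulrC ler_pM2l// lerDl ltW.
have s01 : 0 <= s <= 1 by rewrite (ltW s0).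
have [_ cvx] := closed_convex_f pb.
have := cvx (Itv01 (ltW s0) s1) y x (in_setT _) (in_setT _).
rewrite /conv/= => C.
have E : s *: y + (1 - s) *: x = x + s *: v.
  by rewrite /v scalerBr scalerBl scale1r addrCA; congr (_ + _); rewrite addrC.
rewrite E in C.
have := taylor_f x (s *: v); rewrite dotZr dotZl dotZr ler_norml => /andP[T _].
rewrite -(ler_pM2l s0).
have T' : f x + s * dot (mean_grad x) v - s * (K * s) <= f (x + s *: v).
  by move: T; rewrite /K; lra.
have sKs : s * (K * s) <= s * eps by rewrite ler_pM2l.
have C' : f (x + s *: v) <= s * f y + (1 - s) * f x by exact: C.
lra.
Qed.

Lemma continuous_f : continuous f.
Proof.
apply: continuous_of_norm2 => x; exists (norm2 (mean_grad x) + L2 / 2) => y y1.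
have L20 := L2_gt0 pb.
have := taylor_f x (y - x); rewrite addrCA subrr addr0 -norm2_sq => h.
have h2 := dot_le_norm2 (mean_grad x) (y - x).
have h3 : norm2 (y - x) ^+ 2 <= norm2 (y - x).
  by rewrite expr2 ler_piMl ?norm2_ge0.
have h4 : L2 / 2 * norm2 (y - x) ^+ 2 <= L2 / 2 * norm2 (y - x).
  by rewrite ler_wpM2l// divr_ge0// ltW.
have -> : f y - f x = f y - f x - dot (mean_grad x) (y - x) + dot (mean_grad x) (y - x).
  by rewrite subrK.
by apply: le_trans (ler_normD _ _) _; lra.
Qed.

End ProblemFacts.

(** * One iteration in expectation *)

Section Pointwise.
Context {R : realType} {n : nat}.

(* The slack is [(a + 3 z)^2 / 12 + (b - z)^2 / 4] plus a multiple of
   [Z^2 - z^2], where [a = <h, e>], [b = <gm - h, e>] and [c = a + b + z]. *)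
Lemma gradient_step (f : 'rV[R]_n -> R) (L2 Z c : R) (x h gm e : 'rV[R]_n) :
  0 < L2 -> (forall v, `|f (x + v) - f x - dot h v| <= L2 / 2 * dot v v) ->
  dot e e = 1 -> `|c - dot gm e| <= Z ->
  f (x - (2 * L2)^-1 *: (c *: e)) <= f x + L2^-1 *
    (- (dot h e * dot h e) / 3 - dot (gm - h) e * dot h e / 4
     + dot (gm - h) e * dot (gm - h) e / 4 + 5 / 8 * Z ^+ 2).
Proof.
move=> L20 tf ee cZ; have := tf (- ((2 * L2)^-1 *: (c *: e))).
rewrite ler_norml => /andP[_]; rewrite dotNr dotNl dotNr !opprK !dotZr !dotZl ee mulr1.
rewrite dotBl; move: (dot h e) (dot gm e) cZ => a gme.
set z := c - gme => zZ; have -> : c = z + gme by rewrite /z subrK.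
set b := gme - a; have -> : gme = a + b by rewrite /b addrC subrK.
move: (f _) (f x) => f1 f0; move: b z zZ => b z zZ.
have zz : z ^+ 2 <= Z ^+ 2.
  by rewrite -[leLHS]ger0_norm ?sqr_ge0// normrX lerXn2r// nnegrE ?(le_trans _ zZ).
rewrite invfM => H.
have E : L2^-1 * (- (a * a) / 3 - b * a / 4 + b * b / 4 + 5 / 8 * Z ^+ 2)
   - (L2 / 2 * (2^-1 * L2^-1 * (2^-1 * L2^-1 * ((z + (a + b)) * (z + (a + b)))))
      - 2^-1 * L2^-1 * ((z + (a + b)) * a)) =
   L2^-1 * (5 / 8 * (Z ^+ 2 - z ^+ 2) + (a + 3 * z) ^+ 2 / 24 + (b - z) ^+ 2 / 8).
  by field; rewrite gt_eqF.
have : 0 <= L2^-1 * (5 / 8 * (Z ^+ 2 - z ^+ 2) + (a + 3 * z) ^+ 2 / 24 + (b - z) ^+ 2 / 8).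
  apply: mulr_ge0; first by rewrite invr_ge0 ltW.
  rewrite !addr_ge0 ?divr_ge0 ?sqr_ge0//.
  by rewrite mulr_ge0 ?divr_ge0// subr_ge0.
rewrite -E; lra.
Qed.

(** With [z = c - gme], the cross term [z * ev] is split by Young's inequality with parameter [l],
    and [(z + gme) ^+ 2] is at most [2 * (z ^+ 2 + gme ^+ 2)]. Only products with a known or bounded
    mean remain. *)
Lemma mirror_step_noise (V c1 c gme ev Z D l : R) : 0 <= c1 -> 0 <= D -> 0 < l ->
  `|c - gme| <= Z ->
  V - c1 * c * ev + 2^-1 * (c1 * c) ^+ 2 * D <=
  V - c1 * (gme * ev) + c1 * (l / 2 * Z ^+ 2 + ev * ev / (2 * l))
  + c1 ^+ 2 * (gme * gme * D + Z ^+ 2 * D).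
Proof.
move=> c10 D0 l0; set z := c - gme => zZ; have -> : c = z + gme by rewrite /z subrK.
have zz : z ^+ 2 <= Z ^+ 2.
  by rewrite -[leLHS]ger0_norm ?sqr_ge0// normrX lerXn2r// nnegrE ?(le_trans _ zZ).
have h1 : c1 * - (z * ev) <= c1 * (l / 2 * Z ^+ 2 + ev * ev / (2 * l)).
  rewrite ler_wpM2l// -subr_ge0.
  have -> : l / 2 * Z ^+ 2 + ev * ev / (2 * l) - - (z * ev) =
    l / 2 * (Z ^+ 2 - z ^+ 2) + (l * z + ev) ^+ 2 / (2 * l).
    by field; rewrite gt_eqF.
  have l2 : 0 <= 2 * l by rewrite mulr_ge0 ?(ltW l0).
  by apply: addr_ge0; [apply: mulr_ge0; rewrite ?divr_ge0 ?subr_ge0 ?(ltW l0)|rewrite divr_ge0 ?sqr_ge0].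
have h2 : 2^-1 * (c1 * (z + gme)) ^+ 2 * D <= c1 ^+ 2 * (gme * gme * D + Z ^+ 2 * D).
  have -> : c1 ^+ 2 * (gme * gme * D + Z ^+ 2 * D) =
    2^-1 * (c1 * (z + gme)) ^+ 2 * D +
    c1 ^+ 2 * D * (2^-1 * (z - gme) ^+ 2 + (Z ^+ 2 - z ^+ 2)) by field.
  rewrite lerDl; apply: mulr_ge0; first by rewrite mulr_ge0 ?sqr_ge0.
  by apply: addr_ge0; [rewrite mulr_ge0 ?invr_ge0 ?sqr_ge0|rewrite subr_ge0].
have -> : V - c1 * (z + gme) * ev = V - c1 * (gme * ev) + c1 * - (z * ev) by ring.
by apply: lerD => //; rewrite lerD2l.
Qed.

Lemma sqr_mean_le m (a : 'I_m -> R) : (0 < m)%N ->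
  (m%:R^-1 * \sum_i a i) ^+ 2 <= m%:R^-1 * \sum_i a i ^+ 2.
Proof.
move=> m0; have mR : 0 < m%:R :> R by rewrite ltr0n.
set M := m%:R^-1 * _.
have : 0 <= \sum_i (a i - M) ^+ 2 by apply: sumr_ge0 => i _; exact: sqr_ge0.
rewrite (eq_bigr (fun i => a i ^+ 2 + (- (2 * M) * a i + M ^+ 2))); last by move=> i _; ring.
rewrite !big_split/= -mulr_sumr sumr_const card_ord.
have -> : \sum_i a i = m%:R * M by rewrite /M mulVKf ?gt_eqF.
rewrite -[M ^+ 2 *+ m]mulr_natl => h; rewrite [leRHS]mulrC ler_pdivlMr//; lra.
Qed.

End Pointwise.

(** * Averages over a batch of samples *)

Section Samples.
Context {R : realType} {n m : nat} {d d' d1 : measure_display}.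
Context {X : measurableType d} {T : measurableType d'} {S : measurableType d1}.
Context (P : probability X R) (Q : probability T R).
Context (F : 'rV[R]_n -> X -> R) (f : 'rV[R]_n -> R)
  (g : 'rV[R]_n -> X -> 'rV[R]_n) (L : X -> R) (L2 sigma : R).
Hypotheses (m0 : (0 < m)%N) (pb : stochastic_problem P F f g L L2 sigma).
Context (W : T -> S) (xs : 'I_m -> S -> X).
Hypotheses (mW : measurable_fun setT W) (mxs : forall i, measurable_fun setT (xs i)).
Hypotheses (law : forall i (A : set X), measurable A -> Q ((xs i \o W) @^-1` A) = P A)
  (pairwise : forall i j, i != j -> indep2 Q (xs i \o W) (xs j \o W)).

Let mxi i : measurable_fun setT (xs i \o W).
Proof. exact: measurableT_comp. Qed.

Let mR : 0 < m%:R :> R. Proof. by rewrite ltr0n. Qed.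

Lemma transfer_ae i (p : X -> Prop) : {ae P, forall xi, p xi} ->
  {ae Q, forall w, p (xs i (W w))}.
Proof.
move=> [N [mN PN pN]]; exists ((xs i \o W) @^-1` N); split.
- by rewrite -[X in measurable X]setTI; exact: mxi.
- by rewrite law.
- by move=> w /= h; apply: pN.
Qed.

Lemma transfer_mean i (phi : X -> R) : integ P phi ->
  integ Q (fun w => phi (xs i (W w))) /\ mean Q (fun w => phi (xs i (W w))) = mean P phi.
Proof.
move=> iphi; have mphi := integ_measurable iphi.
pose xi : {mfun T >-> X} := HB.pack (xs i \o W) (isMeasurableFun.Build _ _ _ _ (xs i \o W) (mxi i)).
have me : measurable_fun setT (EFin \o phi) by exact/measurable_EFinP.
have lawE (u : X -> \bar R) : (\int[distribution Q xi]_y u y = \int[P]_y u y)%E.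
  by apply: eq_measure_integral => A mA _; exact: law.
have iQ : integ Q (fun w => phi (xs i (W w))).
  apply/integrableP; split; first exact: measurableT_comp me (mxi i).
  have /integrableP[_] := iphi; rewrite -lawE ge0_integral_distribution//.
  exact: measurableT_comp.
split=> //; congr fine; rewrite -(lawE (EFin \o phi)).
by rewrite (integral_distribution (X := xi) me iQ).
Qed.

Definition batch_grad x (s : S) : 'rV[R]_n := m%:R^-1 *: \sum_i g x (xs i s).

Lemma batch_grad_coord x s k : batch_grad x s 0 k = m%:R^-1 * \sum_i g x (xs i s) 0 k.
Proof. by rewrite /batch_grad mxE summxE. Qed.

Lemma measurable_batch_grad x k : measurable_fun setT (fun s => batch_grad x s 0 k).
Proof.
under eq_fun do rewrite batch_grad_coord.
apply: measurable_funM => //; apply: measurable_sum => i.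
exact: (measurableT_comp (measurable_g_coord pb x k) (mxs i)).
Qed.

Lemma sq_integ_batch_centered x (c : 'rV[R]_n) k :
  integ Q (fun w => (batch_grad x (W w) - c) 0 k ^+ 2).
Proof.
apply: (@integ_le _ _ _ Q _ (fun w => m%:R^-1 * \sum_i (g x (xs i (W w)) 0 k - c 0 k) ^+ 2)).
- apply: measurable_funX; under eq_fun do rewrite !mxE.
  apply: measurable_funB => //.
  by have := measurableT_comp (measurable_batch_grad x k) mW; under eq_fun do rewrite /= mxE.
- apply: integZ; apply: integ_sum => i.
  by case: (transfer_mean i (sq_integ_centered pb x (c 0 k) k)).
- apply: aeW => w; rewrite ger0_norm ?sqr_ge0//.
  apply: le_trans (sqr_mean_le (fun i => g x (xs i (W w)) 0 k - c 0 k) m0).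
  rewrite sumrB sumr_const card_ord mulrBr -[c 0 k *+ m]mulr_natl mulKf ?gt_eqF//.
  by rewrite mxE batch_grad_coord !mxE.
Qed.

Lemma sq_integ_batch x k : integ Q (fun w => batch_grad x (W w) 0 k ^+ 2).
Proof. by have := sq_integ_batch_centered x 0 k; under eq_fun do rewrite subr0. Qed.

Lemma mean_batch_grad x k : mean Q (fun w => batch_grad x (W w) 0 k) = mean_grad P g x 0 k.
Proof.
under mean_ext do rewrite batch_grad_coord.
have tr i := transfer_mean i (integ_g pb x k).
rewrite meanZ ?mean_sum; [|by move=> i; case: (tr i)|by apply: integ_sum => i; case: (tr i)].
rewrite (eq_bigr (fun=> mean_grad P g x 0 k)) => [|i _]; last first.
  by rewrite (tr i).2 mxE.
by rewrite sumr_const card_ord -[mean_grad P g x 0 k *+ m]mulr_natl mulKf ?gt_eqF.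
Qed.

Lemma mean_dot_batch x v : mean Q (fun w => dot (batch_grad x (W w)) v) =
  dot (mean_grad P g x) v.
Proof.
have ib k : integ Q (fun w => batch_grad x (W w) 0 k).
  apply: integ_of_sq (sq_integ_batch x k).
  exact: (measurableT_comp (measurable_batch_grad x k) mW).
have ibv k : integ Q (fun w => batch_grad x (W w) 0 k * v 0 k).
  by under eq_fun do rewrite mulrC; exact: integZ.
rewrite mean_sum//; apply: eq_bigr => k _; rewrite -mean_batch_grad.
by rewrite mulrC -meanZ//; apply: mean_ext => w; rewrite mulrC.
Qed.

(** Pairwise independence and centring at the mean gradient remove the products of distinct samples
    from the expanded square; [m] variances divided by the square of [m] remain. *)
Lemma variance_batch x : let dv w := batch_grad x (W w) - mean_grad P g x in
  integ Q (fun w => dot (dv w) (dv w)) /\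
  mean Q (fun w => dot (dv w) (dv w)) <= sigma ^+ 2 / m%:R.
Proof.
move=> dv; set h := mean_grad P g x in dv *.
have idv : integ Q (fun w => dot (dv w) (dv w)).
  under eq_fun do rewrite dotxx.
  by apply: integ_sum => k; exact: sq_integ_batch_centered.
split=> //.
pose a i k w := g x (xs i (W w)) 0 k - h 0 k.
have ma i k : measurable_fun setT (a i k).
  apply: measurable_funB => //.
  exact: (measurableT_comp (measurable_g_coord pb x k) (mxi i)).
have ia2 i k : integ Q (fun w => a i k w ^+ 2).
  by case: (transfer_mean i (sq_integ_centered pb x (h 0 k) k)).
have iaa i j k : integ Q (fun w => a i k w * a j k w) by exact: integM_sq.
have cross i j k : i != j -> mean Q (fun w => a i k w * a j k w) = 0.
  move=> ij; pose u xi := g x xi 0 k - h 0 k.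
  have mu : measurable_fun setT u.
    by apply: measurable_funB => //; exact: measurable_g_coord pb x k.
  have iu l : integ Q (fun w => u ((xs l \o W) w)) by exact: integ_of_sq (ma l k) (ia2 l k).
  have [_ ->] := mean_indep (mxi i) (mxi j) (pairwise ij) mu mu (iu i) (iu j).
  have -> : mean Q (fun w => u ((xs i \o W) w)) = 0; last by rewrite mul0r.
  have iP : integ P u by apply: integB; [exact: integ_g pb x k|exact: integ_cst].
  rewrite (transfer_mean i iP).2 /u meanB ?mean_cst; [|exact: integ_g pb x k|exact: integ_cst].
  by rewrite /h mxE subrr.
have E w : dot (dv w) (dv w) =
    m%:R ^- 2 * \sum_k \sum_i \sum_j a i k w * a j k w.
  rewrite dotxx mulr_sumr; apply: eq_bigr => k _.
  have -> : dv w 0 k = m%:R^-1 * \sum_i a i k w.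
    rewrite /a sumrB sumr_const card_ord mulrBr -[h 0 k *+ m]mulr_natl mulKf ?gt_eqF//.
    by rewrite /dv mxE batch_grad_coord !mxE.
  rewrite exprMn exprVn; congr (_ * _); rewrite expr2 mulr_suml.
  by apply: eq_bigr => i _; rewrite mulr_sumr.
rewrite (mean_ext _ E) meanZ; last by do 3 (apply: integ_sum => ?).
rewrite mean_sum; last by move=> k; do 2 (apply: integ_sum => ?).
have -> : \sum_k mean Q (fun w => \sum_i \sum_j a i k w * a j k w) =
    \sum_(i < m) mean P (fun xi => dot (g x xi - h) (g x xi - h)).
  transitivity (\sum_k \sum_(i < m) mean P (fun xi => (g x xi 0 k - h 0 k) ^+ 2)).
    apply: eq_bigr => k _; rewrite mean_sum; last by move=> i; apply: integ_sum.
    apply: eq_bigr => i _; rewrite mean_sum// (bigD1 i)//= big1 ?addr0; last first.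
      by move=> j ji; rewrite cross// eq_sym.
    by rewrite -(transfer_mean i (sq_integ_centered pb x (h 0 k) k)).2; apply: mean_ext.
  rewrite exchange_big/=; apply: eq_bigr => i _.
  rewrite -mean_sum; last by move=> k; exact: sq_integ_centered pb x _ k.
  by apply: mean_ext => xi; rewrite dotxx; apply: eq_bigr => k _; rewrite !mxE.
rewrite sumr_const card_ord -[mean P _ *+ m]mulr_natl mulrA.
have -> : m%:R ^- 2 * m%:R = m%:R^-1 :> R by field; rewrite gt_eqF.
by rewrite mulrC ler_pM2r ?invr_gt0//; exact: variance_mean_grad pb x.
Qed.

End Samples.

Lemma grad_estimateE (R : realType) (n m : nat) (d : measure_display)
    (X : measurableType d) (ft : 'rV[R]_n -> X -> R) (t : R) (e : 'rV[R]_n)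
    (xi : 'I_m -> X) (x : 'rV[R]_n) :
  grad_estimate ft t e xi x =
  (m%:R^-1 * \sum_(i < m) (ft (x + t *: e) (xi i) - ft x (xi i)) / t) *: e.
Proof. by rewrite /grad_estimate -scaler_suml scalerA. Qed.

(** * The finite-difference slope, and one step from a frozen state *)

Section OneStep.
Context {R : realType} {n m : nat} {d d' d1 : measure_display}.
Context {X : measurableType d} {T : measurableType d'} {S : measurableType d1}.
Context (P : probability X R) (Q : probability T R).
Context (F eta : 'rV[R]_n -> X -> R) (f : 'rV[R]_n -> R)
  (g : 'rV[R]_n -> X -> 'rV[R]_n) (L : X -> R) (L2 sigma Delta t : R).
Hypotheses (n0 : (0 < n)%N) (m0 : (0 < m)%N) (t0 : 0 < t).
Hypotheses (pb : stochastic_problem P F f g L L2 sigma) (noise : oracle_noise P eta Delta).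
Context (e : {mfun T >-> borel_rV R n}) (W : T -> S) (xs : 'I_m -> S -> X).
Hypotheses (unif : uniform_sphere (distribution Q e)) (mW : measurable_fun setT W)
  (mxs : forall i, measurable_fun setT (xs i)) (We : indep2 Q W (e : T -> borel_rV R n)).
Hypotheses (law : forall i (A : set X), measurable A -> Q ((xs i \o W) @^-1` A) = P A)
  (pairwise : forall i j, i != j -> indep2 Q (xs i \o W) (xs j \o W)).

Let mR : 0 < m%:R :> R. Proof. by rewrite ltr0n. Qed.

Let L20 : 0 < L2. Proof. exact: L2_gt0 pb. Qed.

Let B : R := L2 ^+ 2 * t ^+ 2 + 16 * Delta ^+ 2 / t ^+ 2.

(** A function of the samples alone, hence independent of the direction: the mean of its square
    times [D (e w)] factors. *)
Definition bias_bound (s : S) : R := m%:R^-1 * \sum_i (t / 2 * L (xs i s) + 2 * Delta / t).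

Definition slope x w : R := m%:R^-1 *
  \sum_i (oracle F eta (x + t *: (e w : 'rV[R]_n)) (xs i (W w)) -
          oracle F eta x (xs i (W w))) / t.

Lemma slope_error x : {ae Q, forall w,
  `|slope x w - dot (batch_grad g xs x (W w)) (e w)| <= bias_bound (W w)}.
Proof.
(* All unit [v] are covered outside a single null set, because the direction later substituted for
   [v] depends on the outcome [w]. *)
have pt (i : 'I_m) : {ae Q, forall w, forall v, dot v v = 1 ->
    `|(oracle F eta (x + t *: v) (xs i (W w)) - oracle F eta x (xs i (W w))) / t
      - dot (g x (xs i (W w))) v| <= t / 2 * L (xs i (W w)) + 2 * Delta / t}.
  pose p xi := forall v, dot v v = 1 ->
     `|(oracle F eta (x + t *: v) xi - oracle F eta x xi) / t - dot (g x xi) v|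
     <= t / 2 * L xi + 2 * Delta / t.
  suff pP : {ae P, forall xi, p xi} by exact: (transfer_ae mW mxs law i pP).
  apply: filterS2 (taylor_F pb) noise.2 => xi TF ND v vv.
  have := TF x (t *: v); rewrite dotZr dotZl dotZr vv mulr1 => h1.
  have h2 := ND (x + t *: v); have h3 := ND x.
  rewrite -(ler_pM2l t0) -[X in X * `|_|](gtr0_norm t0) -normrM.
  have -> : t * ((oracle F eta (x + t *: v) xi - oracle F eta x xi) / t - dot (g x xi) v)
     = (F (x + t *: v) xi - F x xi - t * dot (g x xi) v) + (eta (x + t *: v) xi - eta x xi).
    by rewrite /oracle; field; rewrite gt_eqF.
  have -> : t * (t / 2 * L xi + 2 * Delta / t) = L xi / 2 * (t * t) + (Delta + Delta).
    by field; rewrite gt_eqF.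
  apply: le_trans (ler_normD _ _) _; apply: lerD => //.
  by apply: le_trans (ler_normB _ _) _; exact: lerD.
have FQ : Filter (almost_everywhere Q) by exact: ae_filter_ringOfSetsType.
have all_i := filter_forall FQ pt.
apply: filterS2 all_i (sphere_norm1 unif) => w H ew.
have ee : dot (e w) (e w) = 1 by rewrite -norm2_sq ew expr1n.
rewrite /batch_grad dotZl dot_suml -mulrBr -sumrB normrM gtr0_norm ?invr_gt0//.
rewrite ler_pM2l ?invr_gt0//.
by apply: le_trans (ler_norm_sum _ _ _) _; apply: ler_sum => i _; exact: H.
Qed.

(** From [(a + b)^2 <= 2 a^2 + 2 b^2] on each sample and [E L^2 <= L2^2], the mean is at most
    [t^2 L2^2 / 2 + 8 Delta^2 / t^2], half of [B]. *)
Lemma bias_bound_sq : integ Q (fun w => bias_bound (W w) ^+ 2) /\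
  mean Q (fun w => bias_bound (W w) ^+ 2) <= B / 2.
Proof.
have [iL mL] := sq_integ_L pb.
pose u xi := t ^+ 2 / 2 * L xi ^+ 2 + 8 * Delta ^+ 2 / t ^+ 2.
have iu : integ P u by apply: integD; [exact: integZ|exact: integ_cst].
have mu : mean P u <= B / 2.
  have iu1 := integZ (t ^+ 2 / 2) iL; have iu2 := @integ_cst _ _ _ P (8 * Delta ^+ 2 / t ^+ 2).
  rewrite /u (meanD iu1 iu2) meanZ// mean_cst.
  rewrite /B; have h : t ^+ 2 / 2 * mean P (fun xi => L xi ^+ 2) <= t ^+ 2 / 2 * L2 ^+ 2.
    by rewrite ler_wpM2l// divr_ge0 ?sqr_ge0.
  have -> : (L2 ^+ 2 * t ^+ 2 + 16 * Delta ^+ 2 / t ^+ 2) / 2 =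
    t ^+ 2 / 2 * L2 ^+ 2 + 8 * Delta ^+ 2 / t ^+ 2 by field; rewrite gt_eqF.
  by rewrite lerD2r.
have tr i := transfer_mean mW mxs law i iu.
have iS : integ Q (fun w => m%:R^-1 * \sum_i u (xs i (W w))).
  by apply: integZ; apply: integ_sum => i; case: (tr i).
have pt w : bias_bound (W w) ^+ 2 <= m%:R^-1 * \sum_i u (xs i (W w)).
  apply: le_trans (sqr_mean_le _ m0) _; rewrite ler_pM2l ?invr_gt0//.
  apply: ler_sum => i _; rewrite /u -subr_ge0; set l := L _.
  have -> : t ^+ 2 / 2 * l ^+ 2 + 8 * Delta ^+ 2 / t ^+ 2 - (t / 2 * l + 2 * Delta / t) ^+ 2
    = (t / 2 * l - 2 * Delta / t) ^+ 2 by field; rewrite gt_eqF.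
  exact: sqr_ge0.
have mb : measurable_fun setT (fun w => bias_bound (W w)).
  apply: measurable_funM => //; apply: measurable_sum => i; apply: measurable_funD => //.
  apply: measurable_funM => //.
  exact: (measurableT_comp (measurable_L pb) (measurableT_comp (mxs i) mW)).
have iZ : integ Q (fun w => bias_bound (W w) ^+ 2).
  apply: (integ_le _ iS); first exact: measurable_funX.
  by apply: aeW => w; rewrite ger0_norm ?sqr_ge0.
split=> //; apply: le_trans mu.
apply: (@le_trans _ _ (mean Q (fun w => m%:R^-1 * \sum_i u (xs i (W w))))).
  by apply: mean_le => //; apply: aeW.
have it i := (tr i).1; rewrite meanZ ?mean_sum//; last exact: integ_sum.
rewrite (eq_bigr (fun=> mean P u)) => [|i _]; last by rewrite (tr i).2.
by rewrite sumr_const card_ord -[mean P u *+ m]mulr_natl mulKf ?gt_eqF.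
Qed.

Lemma sphere_bilinear_unit (A A' : S -> 'rV[R]_n) :
  (forall i, measurable_fun setT (fun s => A s 0 i)) ->
  (forall i, measurable_fun setT (fun s => A' s 0 i)) ->
  (forall i, integ Q (fun w => A (W w) 0 i ^+ 2)) ->
  (forall i, integ Q (fun w => A' (W w) 0 i ^+ 2)) ->
  integ Q (fun w => dot (A (W w)) (e w) * dot (A' (W w)) (e w)) /\
  mean Q (fun w => dot (A (W w)) (e w) * dot (A' (W w)) (e w)) =
  mean Q (fun w => dot (A (W w)) (A' (W w))) / n%:R.
Proof.
move=> mA mA' iA iA'.
have D1 : on_sphere_bounded (fun _ : 'rV[R]_n => 1 : R) 1 by move=> x _; rewrite normr1.
have mD : measurable_fun [set: borel_rV R n] (fun _ : 'rV[R]_n => 1 : R) by [].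
have ie := integ_sphere_bilinear unif mD D1 (fun _ _ => erefl) (fun _ _ _ _ => erefl)
  mW We mA mA' iA iA'.
have me := mean_sphere_bilinear unif mD D1 (fun _ _ => erefl) (fun _ _ _ _ => erefl)
  mW We mA mA' iA iA'.
have E : (fun w => dot (A (W w)) (e w) * dot (A' (W w)) (e w) * 1) =
    (fun w => dot (A (W w)) (e w) * dot (A' (W w)) (e w)).
  by apply/funext => w; rewrite mulr1.
by rewrite E mean_cst mul1r in ie me.
Qed.

(** [x], [z] and [u] are constants: only the present direction and samples are random. The integrand
    is bounded almost surely by a combination [U] of products, whose means are then evaluated or
    bounded one by one. *)
Lemma one_step (p : R) (prox : 'rV[R]_n -> R) (a b rD : R) (k : nat)
    (x z u : 'rV[R]_n) (K c1 l fs : R) (yp zp : T -> 'rV[R]_n)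
    (h := mean_grad P g x) (v := z - u) :
  1 <= p <= 2 -> prox_function p prox -> 0 <= a -> 0 <= b ->
  (forall e v : 'rV[R]_n, dot e v ^+ 2 <= power_weight a b k e * normp p v ^+ 2) ->
  mean Q (fun w => power_weight a b k (e w)) <= rD ->
  0 <= K -> 0 <= c1 -> 0 < l -> (forall y, fs <= f y) ->
  (forall w, yp w = x - (2 * L2)^-1 *: (slope x w *: (e w : 'rV[R]_n))) ->
  (forall w, grad prox (zp w) = grad prox z - (c1 * slope x w) *: (e w : 'rV[R]_n)) ->
  measurable_fun setT (fun w => K * (f (yp w) - fs) + bregman prox (zp w) u) ->
  (\int[Q]_w (K * (f (yp w) - fs) + bregman prox (zp w) u)%:E <=
   (K * (f x - fs) + bregman prox z u - c1 * (dot h v / n%:R)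
    + c1 / (2 * l) * (dot v v / n%:R)
    + (c1 ^+ 2 * rD - K / (3 * L2)) * (dot h h / n%:R)
    + (K / L2 / 4 + c1 ^+ 2 * rD) * (sigma ^+ 2 / m%:R / n%:R)
    + (K / L2 * (5 / 16) + c1 * l / 4 + c1 ^+ 2 * rD / 2) * B)%:E)%E.
Proof.
move=> p12 proxP a0 b0 dualD DrD K0 c10 l0 fsf ypE zpE mU.
set D := power_weight a b k in dualD DrD.
have nR : 0 < n%:R :> R by rewrite ltr0n.
have L2V : 0 < L2^-1 by rewrite invr_gt0.
have D0 x' : 0 <= D x'.
  rewrite addr_ge0// mulr_ge0// sumr_ge0// => i _.
  by rewrite exprM exprn_ge0 ?sqr_ge0.
pose gm := batch_grad g xs x.
pose dv s := gm s - h.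
have mgm i : measurable_fun setT (fun s => gm s 0 i) by exact: (measurable_batch_grad pb mxs).
have mdv i : measurable_fun setT (fun s => dv s 0 i).
  by under eq_fun do rewrite !mxE; apply: measurable_funB => //;
    have := mgm i; under eq_fun do rewrite mxE.
have mc (c : 'rV[R]_n) i : measurable_fun setT (fun _ : S => c 0 i) by [].
have igm i : integ Q (fun w => gm (W w) 0 i ^+ 2) by exact: (sq_integ_batch m0 pb mW mxs law).
have idv i : integ Q (fun w => dv (W w) 0 i ^+ 2) by exact: (sq_integ_batch_centered m0 pb mW mxs law).
have ic (c : 'rV[R]_n) i : integ Q (fun _ => c 0 i ^+ 2) by exact: integ_cst.
pose Z w := bias_bound (W w).
(* [T1] to [T3] come from [gradient_step], [T5] to [T8] from the mirror step, and [T4] from the bias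
   in both. *)
pose T1 w := dot h (e w) * dot h (e w).
pose T2 w := dot (dv (W w)) (e w) * dot h (e w).
pose T3 w := dot (dv (W w)) (e w) * dot (dv (W w)) (e w).
pose T4 w := Z w ^+ 2.
pose T5 w := dot (gm (W w)) (e w) * dot v (e w).
pose T6 w := dot v (e w) * dot v (e w).
pose T7 w := dot (gm (W w)) (e w) * dot (gm (W w)) (e w) * D (e w).
pose T8 w := Z w ^+ 2 * D (e w).
have [i1 e1] := @sphere_bilinear_unit (fun=> h) (fun=> h) (mc h) (mc h) (ic h) (ic h).
have [i2 e2] := @sphere_bilinear_unit dv (fun=> h) mdv (mc h) idv (ic h).
have [i3 e3] := @sphere_bilinear_unit dv dv mdv mdv idv idv.
have [i4 e4] := bias_bound_sq.
have [i5 e5] := @sphere_bilinear_unit gm (fun=> v) mgm (mc v) igm (ic v).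
have [i6 e6] := @sphere_bilinear_unit (fun=> v) (fun=> v) (mc v) (mc v) (ic v) (ic v).
have mD := measurable_power_weight a b k (n := n).
have bD := power_weight_bounded k a0 b0 (n := n).
have i7 := integ_sphere_bilinear unif mD bD (power_weight_sign a b k) (power_weight_swap a b k)
  mW We mgm mgm igm igm.
have e7 := mean_sphere_bilinear unif mD bD (power_weight_sign a b k) (power_weight_swap a b k)
  mW We mgm mgm igm igm.
have [i8 e8] : integ Q T8 /\ mean Q T8 = mean Q T4 * mean Q (fun w => D (e w)).
  have mb2 : measurable_fun setT (fun s => bias_bound s ^+ 2).
    apply: measurable_funX; apply: measurable_funM => //; apply: measurable_sum => i.
    apply: measurable_funD => //; apply: measurable_funM => //.
    exact: (measurableT_comp (measurable_L pb) (mxs i)).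
  exact: (mean_indep mW (measurable_funP e) We mb2 mD i4 (integ_sphere unif mD bD)).
pose cst0 := K * (f x - fs) + bregman prox z u.
pose U w := cst0 + (- (K / L2 / 3) * T1 w + (- (K / L2 / 4) * T2 w + (K / L2 / 4 * T3 w +
  ((K / L2 * (5 / 8) + c1 * (l / 2)) * T4 w + (- c1 * T5 w + (c1 / (2 * l) * T6 w +
   (c1 ^+ 2 * T7 w + c1 ^+ 2 * T8 w))))))).
have iU : integ Q U by do ?[apply: integD|apply: integZ|exact: integ_cst|by []].
have mUE : mean Q U = cst0 + (- (K / L2 / 3) * mean Q T1 + (- (K / L2 / 4) * mean Q T2 +
  (K / L2 / 4 * mean Q T3 + ((K / L2 * (5 / 8) + c1 * (l / 2)) * mean Q T4 +
   (- c1 * mean Q T5 + (c1 / (2 * l) * mean Q T6 +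
   (c1 ^+ 2 * mean Q T7 + c1 ^+ 2 * mean Q T8))))))).
  rewrite /U meanD ?mean_cst; [|exact: integ_cst|by do ?[apply: integZD|apply: integD|apply: integZ]].
  do 6 (rewrite meanZD//; last by do ?[apply: integZD|apply: integD|apply: integZ]).
  by rewrite meanZD ?meanZ//; exact: integZ.
have f1U : {ae Q, forall w, K * (f (yp w) - fs) + bregman prox (zp w) u <= U w}.
  apply: filterS2 (slope_error x) (sphere_norm1 unif) => w sl ew.
  have ee : dot (e w) (e w) = 1 by rewrite -norm2_sq ew expr1n.
  have hg := gradient_step L20 (taylor_f n0 pb x) ee sl.
  have hm := mirror_descent proxP u (D0 (e w)) (dualD (e w)) (zpE w).
  have hn := mirror_step_noise (bregman prox z u) (dot (e w) v) c10 (D0 (e w)) l0 sl.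
  rewrite -ypE in hg.
  have hg' := ler_wpM2l K0 hg.
  have {hm hn} := le_trans hm hn; move: hg'.
  rewrite /U /cst0 /T1 /T2 /T3 /T4 /T5 /T6 /T7 /T8 /Z /dv -/D -/gm -/h -/v (dotC (e w) v).
  move: (dot v (e w)) (dot (gm (W w)) (e w)) (dot (gm (W w) - h) (e w)) (dot h (e w))
    (bias_bound (W w)) (D (e w)) (bregman prox (zp w) u) (f (yp w)) => ev gme be he Zw Dw Vp fy.
  move: (bregman prox z u) (f x) => V fx hg' hV.
  by lra.
have f10 w : 0 <= K * (f (yp w) - fs) + bregman prox (zp w) u.
  apply: addr_ge0; last exact: bregman_ge0 p12 proxP _ _.
  by apply: mulr_ge0 => //; rewrite subr_ge0.
(* The energy is nonnegative, so it inherits integrability from its majorant. *)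
have i0 : integ Q (fun w => K * (f (yp w) - fs) + bregman prox (zp w) u).
  by apply: integ_le mU iU _; apply: filterS f1U => w; rewrite ger0_norm.
rewrite EFin_mean// lee_fin; apply: le_trans (mean_le f1U i0 iU) _.
rewrite mUE.
have idgm c : integ Q (fun w => dot (gm (W w)) c).
  exact: (integ_dot_indep mW mgm (mc c) igm (ic c)).
(* The batch gradient has mean [h], so the cross term averages to zero. *)
have eT2 : mean Q T2 = 0.
  rewrite e2; have -> : mean Q (fun w => dot (dv (W w)) h) = 0; last by rewrite mul0r.
  rewrite (@mean_ext _ _ _ Q _ (fun w => dot (gm (W w)) h - dot h h)); last first.
    by move=> w; rewrite /dv dotBl.
  rewrite meanB ?mean_cst//; last exact: integ_cst.
  by rewrite (mean_dot_batch m0 pb mW mxs law) subrr.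
have [ivar var] := variance_batch m0 pb mW mxs law pairwise x.
have eT3 : mean Q T3 <= sigma ^+ 2 / m%:R / n%:R.
  by rewrite e3 ler_pM2r ?invr_gt0.
have eT5 : mean Q T5 = dot h v / n%:R.
  by rewrite e5 (mean_dot_batch m0 pb mW mxs law).
have ED0 : 0 <= mean Q (fun w => D (e w)).
  have iD := integ_sphere unif mD bD.
  by apply: (mean_ge0 _ iD); apply: aeW.
have eT7 : mean Q T7 <= (dot h h + sigma ^+ 2 / m%:R) * (rD / n%:R).
  rewrite e7; apply: ler_pM.
  - apply: mean_ge0; first by apply: aeW => w; exact: dotxx_ge0.
    exact: (integ_dot_indep mW mgm mgm igm igm).
  - by rewrite divr_ge0.
  (* [|gm|^2 = 2 <gm, h> + |gm - h|^2 - |h|^2], whose mean is [|h|^2] plus the variance of the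
     batch. *)
  - rewrite (@mean_ext _ _ _ Q _ (fun w => 2 * dot (gm (W w)) h +
        (dot (dv (W w)) (dv (W w)) - dot h h))); last first.
      by move=> w; rewrite /dv !(dotBl, dotBr) (dotC h (gm _)); ring.
    rewrite meanZD//; last by apply: integB => //; exact: integ_cst.
    rewrite meanB ?mean_cst//; last exact: integ_cst.
    rewrite (mean_dot_batch m0 pb mW mxs law) -/h; move: var; rewrite -/gm -/h.
    move: (mean Q _) (dot h h) (sigma ^+ 2 / _) => mv hh sm hv.
    by lra.
  - by rewrite ler_pM2r ?invr_gt0.
have eT8 : mean Q T8 <= B / 2 * rD.
  rewrite e8; apply: ler_pM => //.
  by apply: mean_ge0 => //; apply: aeW => w; exact: sqr_ge0.
rewrite e1 e6 !mean_cst eT2 eT5 /cst0.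
have KL : 0 <= K / L2 by rewrite divr_ge0// ltW.
have q3 := ler_wpM2l (divr_ge0 KL (ler0n R 4)) eT3.
have q4 : (K / L2 * (5 / 8) + c1 * (l / 2)) * mean Q T4 <=
    (K / L2 * (5 / 8) + c1 * (l / 2)) * (B / 2).
  by rewrite ler_wpM2l// addr_ge0// mulr_ge0// divr_ge0// ltW.
have q7 := ler_wpM2l (sqr_ge0 c1) eT7.
have q8 := ler_wpM2l (sqr_ge0 c1) eT8.
have -> : K / (3 * L2) = K / L2 / 3 by field; rewrite gt_eqF.
move: q3 q4 q7 q8; move: (mean Q T3) (mean Q T4) (mean Q T7) (mean Q T8) => t3 t4 t7 t8.
move: (dot h v) (dot v v) (dot h h) (f x) (bregman prox z u) (sigma ^+ 2 / m%:R) B.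
move=> hv vv hh fx V sm B' q3 q4 q7 q8.
by lra.
Qed.

End OneStep.

(** * Measurability of the iterates *)

Section MeasurableVectors.
Context {R : realType} {n : nat} {d0 : measure_display} {T0 : measurableType d0}.

Lemma measurable_vec_coord (v : T0 -> borel_rV R n) i : measurable_fun setT v ->
  measurable_fun setT (fun w => (v w : 'rV[R]_n) 0 i).
Proof. by move=> mv; exact: (measurableT_comp (measurable_coord i) mv). Qed.

Lemma measurable_vecD (u v : T0 -> borel_rV R n) : measurable_fun setT u -> measurable_fun setT v ->
  measurable_fun setT (fun w => (u w : 'rV[R]_n) + v w : borel_rV R n).
Proof.
move=> mu mv; apply: measurable_rV => i; under eq_fun do rewrite mxE.
by apply: measurable_funD; exact: measurable_vec_coord.
Qed.

Lemma measurable_vecZ (c : T0 -> R) (v : T0 -> borel_rV R n) : measurable_fun setT c -> measurable_fun setT v ->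
  measurable_fun setT (fun w => c w *: (v w : 'rV[R]_n) : borel_rV R n).
Proof.
move=> mc mv; apply: measurable_rV => i; under eq_fun do rewrite mxE.
by apply: measurable_funM => //; exact: measurable_vec_coord.
Qed.

Lemma measurable_vecB (u v : T0 -> borel_rV R n) : measurable_fun setT u -> measurable_fun setT v ->
  measurable_fun setT (fun w => (u w : 'rV[R]_n) - v w : borel_rV R n).
Proof.
move=> mu mv; apply: measurable_rV => i; under eq_fun do rewrite !mxE.
by apply: measurable_funB; exact: measurable_vec_coord.
Qed.

Context {d : measure_display} {X : measurableType d} (m : nat).

Lemma measurable_slope (ft : 'rV[R]_n -> X -> R) (t : R) (x e : T0 -> borel_rV R n)
    (xi : 'I_m -> T0 -> X) :
  measurable_fun [set: borel_rV R n * X] (fun u => ft u.1 u.2) ->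
  measurable_fun setT x -> measurable_fun setT e ->
  (forall i, measurable_fun setT (xi i)) ->
  measurable_fun setT (fun w => m%:R^-1 * \sum_(i < m)
    (ft ((x w : 'rV[R]_n) + t *: (e w : 'rV[R]_n)) (xi i w) - ft (x w) (xi i w)) / t).
Proof.
move=> mft mx me mxi; apply: measurable_funM => //; apply: measurable_sum => i.
apply: measurable_funM => //.
apply: measurable_funB.
- have mp : measurable_fun setT (fun w =>
      ((x w : 'rV[R]_n) + t *: (e w : 'rV[R]_n) : borel_rV R n, xi i w)).
    by apply: measurable_fun_pair => //; apply: measurable_vecD => //; exact: measurable_vecZ.
  exact: (measurableT_comp mft mp).
- have mp := measurable_fun_pair mx (mxi i).
  exact: (measurableT_comp mft mp).
Qed.

End MeasurableVectors.

(** * Sigma-algebras generated by blocks of samples *)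

Section GeneratedSigmaAlgebra.
Context {d : measure_display} {T : measurableType d} {R : realType}.
Context {I : finType} (G : I -> set (set T)).

Lemma measurable_joint_generator d1 (T1 : measurableType d1) (J : {set I}) (j : I) (u : T -> T1) :
  j \in J -> (forall A, measurable A -> G j (u @^-1` A)) ->
  measurable_fun [set: g_sigma_algebraType (joint_generator G J)] (u : _ -> T1).
Proof.
by move=> jJ uG _ A mA; rewrite setTI; apply: sub_sigma_algebra; exists j => //; exact: uG.
Qed.

(** The identity onto the coarser sigma-algebra serves as the random variable that carries all
    samples indexed by [J]. *)
Lemma measurable_id_joint (J : {set I}) : (forall i, G i `<=` measurable) ->
  measurable_fun [set: T] (id : T -> g_sigma_algebraType (joint_generator G J)).
Proof.
move=> Gm _ A mA; rewrite setTI preimage_id.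
apply: (smallest_sub (sigma_algebra_measurable T)) mA.
by move=> B [j _]; exact: Gm.
Qed.

Lemma indep2_joint d1 d2 (T1 : measurableType d1) (T2 : measurableType d2)
    (Q : probability T R) (J1 J2 : {set I}) (u : T -> T1) (v : T -> T2) :
  (forall i, G i setT) -> (forall i, setI_closed (G i)) -> (forall i, G i `<=` measurable) ->
  independent Q G -> disjoint (mem J1) (mem J2) ->
  measurable_fun [set: g_sigma_algebraType (joint_generator G J1)] (u : _ -> T1) ->
  measurable_fun [set: g_sigma_algebraType (joint_generator G J2)] (v : _ -> T2) ->
  indep2 Q u v.
Proof.
move=> GT GI Gm GQ J12 mu mv A B mA mB; apply: (independent_joint GT GI Gm GQ J12).
- by have := mu measurableT A mA; rewrite setTI.
- by have := mv measurableT B mB; rewrite setTI.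
Qed.

End GeneratedSigmaAlgebra.

Lemma preimage_sigma_setT d d' (T : measurableType d) (T' : measurableType d') (u : T -> T') :
  g_sigma_algebra_preimage u setT.
Proof. by exists setT => //; rewrite setTI preimage_setT. Qed.

Lemma preimage_sigma_setI d d' (T : measurableType d) (T' : measurableType d') (u : T -> T') :
  setI_closed (g_sigma_algebra_preimage u).
Proof.
move=> _ _ [A mA <-] [B mB <-]; exists (A `&` B); first exact: measurableI.
by rewrite !setTI preimage_setI.
Qed.

Lemma preimage_sigma_measurable d d' (T : measurableType d) (T' : measurableType d')
    (u : {mfun T >-> T'}) : g_sigma_algebra_preimage u `<=` measurable.
Proof. by move=> _ [A mA <-]; exact: (measurable_funP u). Qed.

Lemma preimage_sigma_in d d' (T : measurableType d) (T' : measurableType d') (u : T -> T') A :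
  measurable A -> g_sigma_algebra_preimage u (u @^-1` A).
Proof. by move=> mA; exists A => //; rewrite setTI. Qed.

(** * Numerical recursions *)

Section Arithmetic.
Context {R : realType}.

Lemma rho_gt0 n (q : \bar R) : (8 <= n)%N -> (2%:E <= q)%E -> 0 < rho n q.
Proof.
move=> n8; have nR : 0 < n%:R :> R by rewrite ltr0n (leq_trans _ n8).
have ln0 : 0 < 16 * ln n%:R - 8 :> R by have := @ln_nat_ge R n n8; lra.
case: q => [q| |]//= q2; rewrite mulr_gt0 ?powR_gt0//.
by rewrite lt_min ln0 andbT; rewrite lee_fin in q2; lra.
Qed.

(* [b k] is controlled through [b k * (1 - s_k)], where [s_k] is the partial sum
   of the growth rates; the total of the rates is [1 / 2]. *)
Lemma perturbed_recursion_bound N (Theta r1 r2 : R) (b : nat -> R) :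
  (0 < N)%N -> 0 <= r1 -> 0 <= r2 -> b 0%N <= Theta ->
  (forall k, 0 <= b k) ->
  (forall k, b k.+1 = (1 + k.+2%:R / (N%:R * (N%:R + 3))) * b k
     + (k.+2%:R ^+ 2 * r1 + k.+2%:R * r2)) ->
  b N <= 2 * (Theta + N%:R * (N%:R + 1) ^+ 2 * r1 + N%:R * (N%:R + 3) / 2 * r2).
Proof.
move=> N0 r10 r20 b0 bp bS.
have NR : 0 < N%:R :> R by rewrite ltr0n.
have M0 : 0 < N%:R * (N%:R + 3) :> R by rewrite mulr_gt0// addr_gt0.
(* The rates [(j + 2) / (N (N + 3))] with [j < k] sum to [k (k + 3) / (2 N (N + 3))]. *)
have main k : (k <= N)%N -> b k * (1 - k%:R * (k%:R + 3) / (2 * (N%:R * (N%:R + 3)))) <=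
    Theta + k%:R * (N%:R + 1) ^+ 2 * r1 + k%:R * (k%:R + 3) / 2 * r2.
  elim: k => [|k IH] kN; first by rewrite !mul0r !addr0 subr0 mulr1.
  have {}IH := IH (ltnW kN).
  have k0 : 0 <= k%:R :> R by rewrite ler0n.
  have kR : k%:R + 1 <= N%:R :> R by rewrite natr1 ler_nat.
  rewrite bS.
  have -> : k.+2%:R = k%:R + 2 :> R by rewrite -addn2 natrD.
  have -> : k.+1%:R = k%:R + 1 :> R by rewrite natr1.
  move: (b k) (bp k) IH => B Bp; move: M0; set M := N%:R * (N%:R + 3) => M0.
  set a := (k%:R + 2) / M; set s := k%:R * (k%:R + 3) / (2 * M).
  have -> : (k%:R + 1) * (k%:R + 1 + 3) / (2 * M) = s + a.
    by rewrite /s /a; field; rewrite gt_eqF.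
  have a0 : 0 <= a by rewrite /a divr_ge0 ?addr_ge0 ?(ltW M0).
  have s0 : 0 <= s by rewrite /s divr_ge0 ?mulr_ge0 ?addr_ge0 ?(ltW M0).
  have sa : s + a <= 1.
    rewrite /s /a (_ : _ + _ = (k%:R + 1) * (k%:R + 4) / (2 * M)); last by field; rewrite gt_eqF.
    rewrite ler_pdivrMr ?mulr_gt0// mul1r /M; nra.
  move=> IH.
  have h1 : ((1 + a) * B) * (1 - (s + a)) <= B * (1 - s).
    rewrite -subr_ge0 (_ : _ - _ = B * (a * s + a ^+ 2)); last by ring.
    by apply: mulr_ge0 => //; apply: addr_ge0; [apply: mulr_ge0|exact: sqr_ge0].
  (* The factor [1 - (s + a)] is dropped, and [k + 2] is raised to [N + 1] in the [r1] term only;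
     the [r2] terms still sum to [k (k + 3) / 2]. *)
  have h2 : ((k%:R + 2) ^+ 2 * r1 + (k%:R + 2) * r2) * (1 - (s + a)) <=
      (N%:R + 1) ^+ 2 * r1 + (k%:R + 2) * r2.
    apply: (@le_trans _ _ ((k%:R + 2) ^+ 2 * r1 + (k%:R + 2) * r2)).
      rewrite ler_piMr//; last by lra.
      by rewrite addr_ge0 ?mulr_ge0 ?addr_ge0 ?sqr_ge0.
    rewrite lerD2r ler_wpM2r// lerXn2r ?nnegrE ?addr_ge0 ?(ltW NR)//; lra.
  rewrite mulrDl; lra.
have := main N (leqnn N).
rewrite (_ : 1 - _ = 1 / 2); last by field; rewrite !gt_eqF// addr_gt0.
lra.
Qed.

(** Multiplication by [D / (N (N + 2))] isolates [E], and the factor 2 of the recursion bound turns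
    192 into 384. *)
Lemma final_rate n N m (rh L2 Theta s2 B E : R) :
  (0 < n)%N -> (0 < N)%N -> (0 < m)%N -> 0 < rh -> 0 < L2 ->
  0 <= Theta -> 0 <= s2 -> 0 <= B ->
  let D := 192 * n%:R ^+ 2 * rh * L2 in
  N%:R * (N%:R + 2) / D * E <=
    2 * (Theta + N%:R * (N%:R + 1) ^+ 2 *
      (1 / (D * L2) * (5 / 12 * (s2 / m%:R / n%:R) + 19 / 48 * B))
     + N%:R * (N%:R + 3) / 2 * (n%:R * (N%:R * (N%:R + 3)) / D ^+ 2 * B)) ->
  E <= 384 * n%:R ^+ 2 * rh * L2 * Theta / N%:R ^+ 2
     + 384 * N%:R / (n%:R * L2) * (s2 / m%:R)
     + 6 * N%:R / L2 * B + N%:R ^+ 2 / (24 * n%:R * rh * L2) * B.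
Proof.
rewrite -(ltr0n R n) -(ltr0n R N) -(ltr0n R m) => n0 N0 m0 rh0 L20 T0 s20 B0 D.
have N1 : 1 <= N%:R :> R by move: N0; rewrite ltr0n ler1n.
move: (n%:R) (N%:R) (m%:R) n0 N0 m0 N1 @D => nn NN mm n0 N0 m0 N1 D H.
have D0 : 0 < D.
  have p192 : 0 < 192 :> R by rewrite ltr0n.
  exact: (mulr_gt0 (mulr_gt0 (mulr_gt0 p192 (exprn_gt0 2 n0)) rh0) L20).
have N2 : 0 < NN + 2 by rewrite addr_gt0.
pose c := D / (NN * (NN + 2)).
have c0 : 0 < c by rewrite divr_gt0// mulr_gt0.
have {}H : E <= c * (2 * (Theta + NN * (NN + 1) ^+ 2 *
      (1 / (D * L2) * (5 / 12 * (s2 / mm / nn) + 19 / 48 * B))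
     + NN * (NN + 3) / 2 * (nn * (NN * (NN + 3)) / D ^+ 2 * B))).
  have -> : E = c * (NN * (NN + 2) / D * E) by rewrite /c; field; rewrite !gt_eqF.
  by rewrite ler_wpM2l// ltW.
apply: le_trans H _.
have -> : c * (2 * (Theta + NN * (NN + 1) ^+ 2 *
      (1 / (D * L2) * (5 / 12 * (s2 / mm / nn) + 19 / 48 * B))
     + NN * (NN + 3) / 2 * (nn * (NN * (NN + 3)) / D ^+ 2 * B))) =
   384 * nn ^+ 2 * rh * L2 * Theta / NN / (NN + 2)
   + 5 / 6 * ((NN + 1) ^+ 2 / (NN + 2)) / (nn * L2) * (s2 / mm)
   + 19 / 24 * ((NN + 1) ^+ 2 / (NN + 2)) / L2 * B
   + NN * ((NN + 3) ^+ 2 / (NN + 2)) / (192 * nn * rh * L2) * B.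
  by rewrite /c /D; field; rewrite !gt_eqF.
(* Both bounds rest on [NN >= 1]; the second gives the last constant, [8 / 192 = 1 / 24]. *)
have q1 : (NN + 1) ^+ 2 / (NN + 2) <= 2 * NN.
  by rewrite ler_pdivrMr//; nra.
have q2 : (NN + 3) ^+ 2 / (NN + 2) <= 8 * NN.
  by rewrite ler_pdivrMr//; nra.
apply: lerD; first apply: lerD; first apply: lerD.
- have -> : 384 * nn ^+ 2 * rh * L2 * Theta / NN ^+ 2 = 384 * nn ^+ 2 * rh * L2 * Theta / NN / NN.
    by field; rewrite gt_eqF.
  apply: ler_wpM2l; last by rewrite lef_pV2 ?posrE//; lra.
  apply: divr_ge0; last exact: ltW.
  have := ltW L20; have := ltW rh0 => h1 h2.
  exact: (mulr_ge0 (mulr_ge0 (mulr_ge0 (mulr_ge0 (ler0n R 384) (sqr_ge0 nn)) h1) h2) T0).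
- rewrite ler_wpM2r ?divr_ge0 ?(ltW m0)// ler_pM2r ?invr_gt0 ?mulr_gt0//; lra.
- rewrite ler_wpM2r// ler_pM2r ?invr_gt0//; lra.
- rewrite ler_wpM2r// ler_pdivrMr ?mulr_gt0//.
  rewrite (_ : NN ^+ 2 / _ * _ = NN * (8 * NN)); last by field; rewrite !gt_eqF.
  by rewrite ler_pM2l.
Qed.

(** The identity [K = ck + al] splits [K * (fx - fs)]. By [h3] the mirror inner products attach
    [hxy] to the [ck] part and [hxu] to the [al] part; convexity at [y] and at the minimizer then
    bounds these by [ck * (fy - fs)] and by 0. *)
Lemma coupling_step (k nn NN mm rh L2 s2 B fx fy fs V hzx hxu hxy vv hh : R) :
  0 <= k -> 0 < nn -> 0 < NN -> 0 < mm -> 0 < rh -> 0 < L2 ->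
  0 <= hh -> fs <= fy -> vv <= 2 * V -> fx - hxu <= fs -> fx - hxy <= fy ->
  let D := 192 * nn ^+ 2 * rh * L2 in
  let al := (k + 2) / (96 * nn ^+ 2 * rh * L2) in
  let ck := k * (k + 2) / D in
  let K := (k + 2) ^+ 2 / D in
  let c1 := al * nn in
  let l := 2 * (NN * (NN + 3)) / D in
  al * hzx = ck * hxy ->
  K * (fx - fs) + V - c1 * ((hzx + hxu) / nn) + c1 / (2 * l) * (vv / nn)
    + (c1 ^+ 2 * (8 * rh) - K / (3 * L2)) * (hh / nn)
    + (K / L2 / 4 + c1 ^+ 2 * (8 * rh)) * (s2 / mm / nn)
    + (K / L2 * (5 / 16) + c1 * l / 4 + c1 ^+ 2 * (8 * rh) / 2) * B <=
  (1 + (k + 2) / (NN * (NN + 3))) * (ck * (fy - fs) + V) +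
  ((k + 2) ^+ 2 * (1 / (D * L2) * (5 / 12 * (s2 / mm / nn) + 19 / 48 * B)) +
   (k + 2) * (nn * (NN * (NN + 3)) / D ^+ 2 * B)).
Proof.
move=> k0 n0 N0 m0 rh0 L20 hh0 fsy vvV h1 h2 D al ck K c1 l h3.
have p192 : 0 < 192 :> R by rewrite ltr0n.
have D0 : 0 < D := mulr_gt0 (mulr_gt0 (mulr_gt0 p192 (exprn_gt0 2 n0)) rh0) L20.
have k2 : 0 < k + 2 by rewrite ltr_wpDl.
have M0 : 0 < NN * (NN + 3) by rewrite mulr_gt0// addr_gt0.
have alE : al = 2 * (k + 2) / D by rewrite /al /D; field; rewrite !gt_eqF.
have al0 : 0 <= al.
  by rewrite alE; apply: divr_ge0; [apply: mulr_ge0 => //; exact: ltW|exact: ltW].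
have ck0 : 0 <= ck.
  by rewrite /ck; apply: divr_ge0; [apply: mulr_ge0 => //; exact: ltW|exact: ltW].
have K0 : 0 <= K / L2.
  by apply: divr_ge0; [apply: divr_ge0; [exact: sqr_ge0|exact: ltW]|exact: ltW].
have KE : K = ck + al by rewrite alE /K /ck; field; rewrite gt_eqF.
(* Half of the decrease [K / L2 / 3] in [hh]. The same cost enters the noise: [1/4 + 1/6 = 5/12] for
   the variance and [5/16 + 1/12 = 19/48] for [B]. *)
have E1 : c1 ^+ 2 * (8 * rh) = K / L2 / 6.
  by rewrite /c1 /al /K /D; field; rewrite !gt_eqF.
have E2 : c1 * ((hzx + hxu) / nn) = al * hzx + al * hxu.
  by rewrite /c1; field; rewrite gt_eqF.
set w := (k + 2) / (NN * (NN + 3)).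
have w0 : 0 <= w by apply: divr_ge0; exact: ltW.
(* [l] is tuned so that this is at most [w * V], with [w] the growth rate of the recursion. *)
have E3 : c1 / (2 * l) * (vv / nn) = w / 2 * vv.
  by rewrite /c1 alE /l /w; field; rewrite !gt_eqF// addr_gt0.
have E4 : c1 * l / 4 = (k + 2) * (nn * (NN * (NN + 3)) / D ^+ 2).
  by rewrite /c1 alE /l; field; rewrite !gt_eqF.
have E5 : (k + 2) ^+ 2 * (1 / (D * L2) * (5 / 12 * (s2 / mm / nn) + 19 / 48 * B)) =
    K / L2 * (5 / 12 * (s2 / mm / nn) + 19 / 48 * B).
  by rewrite /K; field; rewrite !gt_eqF.
have E6 : K / (3 * L2) = K / L2 / 3 by field; rewrite gt_eqF.
rewrite E1 E2 E3 E4 E5 E6 h3 [_ * (_ / D ^+ 2 * B)]mulrA {1}KE.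
have q1 := ler_wpM2l al0 h1; have q2 := ler_wpM2l ck0 h2; have q3 := ler_wpM2l w0 vvV.
(* Lets the growth factor [1 + w] multiply the whole energy and not only [V]. *)
have q4 : 0 <= w * (ck * (fy - fs)).
  by apply: mulr_ge0 => //; apply: mulr_ge0 => //; rewrite subr_ge0.
have q5 : 0 <= K / L2 / 6 * (hh / nn).
  apply: mulr_ge0; first exact: divr_ge0.
  by apply: divr_ge0 => //; exact: ltW.
move: q1 q2 q3 q4 q5; clear; move: (K / L2) (s2 / mm / nn) (hh / nn) => KL sn hn.
move: (nn * (NN * (NN + 3)) / D ^+ 2) w ck al => M w ck al q1 q2 q3 q4 q5.
lra.
Qed.

End Arithmetic.

(** * The accelerated method *)

Section Process.
Context {R : realType} {n N m : nat} {d d' : measure_display}.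
Context {X : measurableType d} {T : measurableType d'}.
Context (p : R) (q : \bar R) (P : probability X R) (Q : probability T R)
  (F eta : 'rV[R]_n -> X -> R) (f : 'rV[R]_n -> R)
  (g : 'rV[R]_n -> X -> 'rV[R]_n) (L : X -> R) (L2 sigma Delta t Theta : R)
  (prox : 'rV[R]_n -> R) (x0 u : 'rV[R]_n)
  (e : 'I_N -> {mfun T >-> borel_rV R n}) (xi : 'I_N -> 'I_m -> {mfun T >-> X})
  (x y z : nat -> T -> 'rV[R]_n) (Phi : 'rV[R]_n -> 'rV[R]_n) (a b : R) (kk : nat).
Hypotheses (n8 : (8 <= n)%N) (p12 : 1 <= p <= 2) (q2 : (2%:E <= q)%E)
  (N0 : (0 < N)%N) (m0 : (0 < m)%N) (t0 : 0 < t)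
  (pb : stochastic_problem P F f g L L2 sigma) (noise : oracle_noise P eta Delta)
  (proxP : prox_function p prox) (samp : ardfds_sampling Q P e xi)
  (alg : ardfds (oracle F eta) prox q L2 t x0 e xi x y z)
  (umin : minimizer f u) (uTheta : bregman prox x0 u <= Theta).
Hypotheses (PhiK : forall s, grad prox (Phi s) = s) (gradK : forall v, Phi (grad prox v) = v)
  (Phi_lip : forall s s', norm2 (Phi s - Phi s') <= norm2 (s - s')).
Hypotheses (a0 : 0 <= a) (b0 : 0 <= b)
  (dualD : forall e v : 'rV[R]_n,
     dot e v ^+ 2 <= power_weight a b kk e * normp p v ^+ 2)
  (rhoD : a + b * (n%:R * ((2 * kk)%:R / n%:R) ^+ kk) <= 8 * rho n q).

Let I := ('I_N + 'I_N * 'I_m)%type.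

Let G (j : I) : set (set T) := match j with
  | inl k => g_sigma_algebra_preimage (e k)
  | inr (k, i) => g_sigma_algebra_preimage (xi k i)
  end.

Let GT j : G j setT.
Proof. by case: j => [k|[k i]]; exact: preimage_sigma_setT. Qed.

Let GI j : setI_closed (G j).
Proof. by case: j => [k|[k i]]; exact: preimage_sigma_setI. Qed.

Let Gm j : G j `<=` measurable.
Proof. by case: j => [k|[k i]]; exact: preimage_sigma_measurable. Qed.

Let GQ : independent Q G.
Proof. exact: sampling_independent samp. Qed.

(** Blocks of sample indices: [past] against [present] serves the averaging over the state,
    [samples] against [directions] a single iteration, and [sample] the pairwise independence inside
    a batch. *)
Let past (k : nat) : {set I} := finset (fun j : I =>
  match j with inl l => (l < k)%N | inr (l, _) => (l < k)%N end).
Let directions (k : 'I_N) : {set I} := finset (fun j : I =>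
  match j with inl l => l == k | inr _ => false end).
Let samples (k : 'I_N) : {set I} := finset (fun j : I =>
  match j with inl _ => false | inr (l, _) => l == k end).
Let sample (k : 'I_N) (i : 'I_m) : {set I} := finset (fun j : I =>
  match j with inl _ => false | inr li => li == (k, i) end).
Let present (k : 'I_N) : {set I} := finset (fun j : I =>
  match j with inl l => l == k | inr (l, _) => l == k end).

Local Notation TJ J := (g_sigma_algebraType (joint_generator G J)).

Let me_J (k : 'I_N) (J : {set I}) : inl k \in J ->
  measurable_fun [set: TJ J] (e k : _ -> borel_rV R n).
Proof. by move=> kJ; apply: (measurable_joint_generator kJ) => A mA; exact: preimage_sigma_in. Qed.

Let mxi_J (k : 'I_N) (i : 'I_m) (J : {set I}) : inr (k, i) \in J ->
  measurable_fun [set: TJ J] (xi k i : _ -> X).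
Proof. by move=> kJ; apply: (measurable_joint_generator kJ) => A mA; exact: preimage_sigma_in. Qed.

Let ft := oracle F eta.
Local Notation S := (borel_rV R n * borel_rV R n)%type.

Let xx (k : nat) (st : S) : 'rV[R]_n :=
  (ardfds_tau k : R) *: Phi st.2 + (1 - (ardfds_tau k : R)) *: (st.1 : 'rV[R]_n).
Let slp (x' e' : 'rV[R]_n) (xi' : 'I_m -> X) : R :=
  m%:R^-1 * \sum_(i < m) (ft (x' + t *: e') (xi' i) - ft x' (xi' i)) / t.
Let al (k : nat) : R := @ardfds_alpha R n q L2 k.+1.
Let nextS (k : nat) (st : S) (e' : 'rV[R]_n) (xi' : 'I_m -> X) : S :=
  (xx k st - (2 * L2)^-1 *: (slp (xx k st) e' xi' *: e'),
   (st.2 : 'rV[R]_n) - (al k * n%:R * slp (xx k st) e' xi') *: e').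
Let state (k : nat) (w : T) : S := (y k w, grad prox (z k w)).

Let state_next (k : 'I_N) w : state k.+1 w = nextS k (state k w) (e k w) (fun i => xi k i w).
Proof.
have zE : z k w = Phi (grad prox (z k w)) by rewrite gradK.
have xE : x k.+1 w = xx k (state k w).
  by rewrite (ardfds_x alg) /xx /state /= -zE.
have gE := grad_estimateE ft t (e k w) (fun i => xi k i w) (x k.+1 w).
rewrite /state /nextS -xE; congr pair.
  by rewrite (ardfds_y alg) gE.
(* Up to a constant, the objective of the argmin is [prox] tilted by the new dual variable. *)
apply: grad_minimizer => [v|]; first exact: prox_differentiable proxP v.
move=> v; have := ardfds_z alg k w v; rewrite /bregman gE.
rewrite -/(slp (x k.+1 w) (e k w) (fun i => xi k i w)) -/(al k).
move: (slp _ _ _) => c.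
rewrite !(dotBl, dotBr, dotZl); move: (grad prox (z k w)) => gz.
lra.
Qed.

Let L20 : 0 < L2. Proof. exact: L2_gt0 pb. Qed.
Let n0 : (0 < n)%N. Proof. exact: leq_trans n8. Qed.
Let rh := rho n q.
Let rh0 : 0 < rh. Proof. exact: rho_gt0. Qed.
Let nR : 0 < n%:R :> R. Proof. by rewrite ltr0n. Qed.

Let mPhi : measurable_fun [set: borel_rV R n] (Phi : _ -> borel_rV R n).
Proof.
apply: measurable_rV => i; apply: continuous_borel_measurable.
apply: (@continuous_lip _ _ _ 1) => v v'; rewrite mul1r.
have := coord_le_norm2 (Phi v' - Phi v) i; rewrite !mxE => h.
by apply: le_trans (Phi_lip _ _); rewrite distrC in h; rewrite distrC.
Qed.

Let mft : measurable_fun [set: borel_rV R n * X] (fun v => ft v.1 v.2).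
Proof. by apply: measurable_funD; [exact: measurable_F pb|exact: noise.1]. Qed.

(** The domain is left arbitrary: the map is used on [T], on [T] with a generated sigma-algebra, and
    on a product with the state space. *)
Let measurable_nextS d0 (T0 : measurableType d0) k (st : T0 -> S)
    (e' : T0 -> borel_rV R n) (xi' : 'I_m -> T0 -> X) :
  measurable_fun setT st -> measurable_fun setT e' ->
  (forall i, measurable_fun setT (xi' i)) ->
  measurable_fun setT (fun w => nextS k (st w) (e' w) (fun i => xi' i w)).
Proof.
move=> mst me mxi.
have m1 : measurable_fun setT (fun w => (st w).1) by exact: measurableT_comp mst.
have m2 : measurable_fun setT (fun w => (st w).2) by exact: measurableT_comp mst.
have mx : measurable_fun setT (fun w => xx k (st w) : borel_rV R n).
  apply: measurable_vecD; apply: measurable_vecZ => //.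
  exact: (measurableT_comp mPhi m2).
have ms := measurable_slope t mft mx me mxi.
apply: measurable_fun_pair.
- apply: measurable_vecB => //; apply: measurable_vecZ => //.
  exact: measurable_vecZ.
- apply: measurable_vecB => //; apply: measurable_vecZ => //.
  exact: measurable_funM.
Qed.

(** Any [J] containing [past k] is allowed, so that the induction step has one sigma-algebra for the
    previous state and the new samples. *)
Let measurable_state k (J : {set I}) : (k <= N)%N -> {subset past k <= J} ->
  measurable_fun [set: TJ J] (state k : _ -> S).
Proof.
elim: k => [|k IH] kN kJ.
  have -> : state 0%N = fun=> (x0, grad prox x0).
    by apply/funext => w; rewrite /state (ardfds_y0 alg) (ardfds_z0 alg).
  exact: measurable_cst.
have -> : state k.+1 = fun w => nextS k (state k w) (e (Ordinal kN) w) (fun i => xi (Ordinal kN) i w).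
  by apply/funext => w; rewrite (state_next (Ordinal kN)).
apply: measurable_nextS.
- apply: IH; first exact: ltnW.
  move=> j jk; apply: kJ; move: jk; rewrite !inE.
  by case: j => [l|[l i]] /ltnW.
- by apply: me_J; apply: kJ; rewrite inE /=.
- by move=> i; apply: mxi_J; apply: kJ; rewrite inE /=.
Qed.

Let V (s : 'rV[R]_n) : R := bregman prox (Phi s) u.

Let V_ge0 s : 0 <= V s. Proof. exact: bregman_ge0 p12 proxP _ _. Qed.

Let measurable_V : measurable_fun [set: borel_rV R n] V.
Proof.
have cprox : measurable_fun [set: borel_rV R n] prox.
  by apply: continuous_borel_measurable; exact: prox_continuous proxP.
apply: measurable_funB.
  by apply: measurable_funB => //; exact: (measurableT_comp cprox mPhi).
apply: measurable_sum => i; apply: measurable_funM.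
  by under eq_fun do rewrite PhiK; exact: measurable_coord.
under eq_fun do rewrite !mxE; apply: measurable_funB => //.
exact: measurable_vec_coord.
Qed.

Let measurable_f : measurable_fun [set: borel_rV R n] f.
Proof. by apply: continuous_borel_measurable; exact: (continuous_f n0 pb). Qed.

Let D0 := 192 * n%:R ^+ 2 * rh * L2.
Let B := L2 ^+ 2 * t ^+ 2 + 16 * Delta ^+ 2 / t ^+ 2.
Let r1 : R := 1 / (D0 * L2) * (5 / 12 * (sigma ^+ 2 / m%:R / n%:R) + 19 / 48 * B).
Let r2 : R := n%:R * (N%:R * (N%:R + 3)) / D0 ^+ 2 * B.

Let D00 : 0 < D0.
Proof.
have p192 : 0 < 192 :> R by rewrite ltr0n.
exact: (mulr_gt0 (mulr_gt0 (mulr_gt0 p192 (exprn_gt0 2 nR)) rh0) L20).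
Qed.

Let B0 : 0 <= B.
Proof.
apply: addr_ge0; first by rewrite mulr_ge0 ?sqr_ge0.
by apply: divr_ge0; [apply: mulr_ge0; rewrite ?sqr_ge0|exact: sqr_ge0].
Qed.

Let NR : 0 < N%:R :> R. Proof. by rewrite ltr0n. Qed.

Let r10 : 0 <= r1.
Proof.
apply: mulr_ge0; first by apply: divr_ge0 => //; apply: mulr_ge0; exact: ltW.
apply: addr_ge0; apply: mulr_ge0 => //.
by apply: divr_ge0 => //; apply: divr_ge0 => //; exact: sqr_ge0.
Qed.

Let r20 : 0 <= r2.
Proof.
apply: mulr_ge0 => //; apply: divr_ge0; last exact: sqr_ge0.
by apply: mulr_ge0 => //; apply: mulr_ge0 => //; apply: addr_ge0.
Qed.

(** Vanishes at [k = 0], so the initial energy is the Bregman divergence alone. Since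
    [(k + 1) (k + 3) = (k + 2)^2 - 1], the weight [ck k.+1] is just below the weight
    [(k + 2)^2 / D0] produced by an iteration. *)
Let ck (k : nat) : R := k%:R * (k%:R + 2) / D0.

Let ck0 k : 0 <= ck k.
Proof. by apply: divr_ge0; [apply: mulr_ge0 => //; apply: addr_ge0|exact: ltW]. Qed.

Let energy (c : R) (st : S) : R := c * (f st.1 - f u) + V st.2.

Let energy_ge0 c st : 0 <= c -> 0 <= energy c st.
Proof.
move=> c0; apply: addr_ge0 => //; apply: mulr_ge0 => //.
by rewrite subr_ge0; exact: umin.
Qed.

Let measurable_energy c d0 (T0 : measurableType d0) (st : T0 -> S) :
  measurable_fun setT st -> measurable_fun setT (fun w => energy c (st w)).
Proof.
move=> mst; apply: measurable_funD.
  apply: measurable_funM => //; apply: measurable_funB => //.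
  exact: (measurableT_comp measurable_f (measurableT_comp measurable_fst mst)).
exact: (measurableT_comp measurable_V (measurableT_comp measurable_snd mst)).
Qed.

Let disj (J1 J2 : {set I}) : (forall j, j \in J1 -> j \in J2 -> False) ->
  disjoint (mem J1) (mem J2).
Proof.
move=> H; rewrite disjoint_subset; apply/fintype.subsetP => j j1.
by apply/negP => j2; exact: H j1 j2.
Qed.

Let iteration (k : 'I_N) (st : S) :
  (\int[Q]_w (energy ((k%:R + 2) ^+ 2 / D0)
     (nextS k st (e k w) (fun i => xi k i w)))%:E <=
   ((1 + (k%:R + 2) / (N%:R * (N%:R + 3))) * energy (ck k) st
    + ((k%:R + 2) ^+ 2 * r1 + (k%:R + 2) * r2))%:E)%E.
Proof.
(* The variable [W] of [one_step] is the identity onto the sigma-algebra of the current batch. *)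
have mW := measurable_id_joint (J := samples k) Gm.
have mxs i : measurable_fun [set: TJ (samples k)] (xi k i : _ -> X).
  by apply: mxi_J; rewrite inE /= eqxx.
have We : indep2 Q (id : T -> TJ (samples k)) (e k : T -> borel_rV R n).
  apply: (@indep2_joint _ _ _ _ G _ _ _ _ _ (samples k) (directions k) _ _ GT GI Gm GQ).
  - by apply: disj => -[l|[l i]]; rewrite !inE.
  - exact: measurable_id.
  - by apply: me_J; rewrite inE /= eqxx.
have law i (A : set X) : measurable A -> Q ((xi k i \o id) @^-1` A) = P A.
  by move=> mA; rewrite -(sample_distribution samp k i mA).
have pairwise i j : i != j -> indep2 Q (xi k i \o id) (xi k j \o id).
  move=> ij; apply: (@indep2_joint _ _ _ _ G _ _ _ _ _ (sample k i) (sample k j) _ _ GT GI Gm GQ).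
  - apply: disj => -[l|[l i']]; rewrite !inE// => /eqP[-> ->] /eqP[ij'].
    by rewrite ij' eqxx in ij.
  - by apply: mxi_J; rewrite inE /= eqxx.
  - by apply: mxi_J; rewrite inE /= eqxx.
have unif := direction_uniform samp k.
have DrD : mean Q (fun w => power_weight a b kk (e k w)) <= 8 * rh.
  exact: (le_trans (mean_power_weight unif kk a0 b0) rhoD).
set K := (k%:R + 2) ^+ 2 / D0.
have K0 : 0 <= K by apply: divr_ge0; [exact: sqr_ge0|exact: ltW].
pose l := 2 * (N%:R * (N%:R + 3)) / D0.
have l0 : 0 < l by rewrite divr_gt0// mulr_gt0// mulr_gt0// addr_gt0.
have alE : al k = (k%:R + 2) / (96 * n%:R ^+ 2 * rh * L2).
  by rewrite /al /ardfds_alpha -addn2 natrD.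
have al0 : 0 <= al k.
  rewrite alE; apply: divr_ge0; first exact: addr_ge0.
  by apply: ltW; rewrite mulr_gt0// mulr_gt0// mulr_gt0 ?exprn_gt0// ltr0n.
have c10 : 0 <= al k * n%:R by rewrite mulr_ge0.
have mU : measurable_fun setT (fun w =>
    energy K (nextS k st (e k w) (fun i => xi k i w))).
  apply: measurable_energy; apply: measurable_nextS; first exact: measurable_cst.
  - exact: (measurable_funP (e k)).
  - by move=> i; exact: (measurable_funP (xi k i)).
pose yp w : 'rV[R]_n := (nextS k st (e k w) (fun i => xi k i w)).1.
pose zp w : 'rV[R]_n := Phi (nextS k st (e k w) (fun i => xi k i w)).2.
have ypE w : yp w = xx k st - (2 * L2)^-1 *:
    (slope F eta t (e k) id (xi k) (xx k st) w *: (e k w : 'rV[R]_n)) by [].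
have zpE w : grad prox (zp w) = grad prox (Phi st.2) - (al k * n%:R *
    slope F eta t (e k) id (xi k) (xx k st) w) *: (e k w : 'rV[R]_n).
  by rewrite /zp !PhiK.
have := one_step n0 m0 t0 pb noise unif mW mxs We law pairwise p12 proxP a0 b0 dualD DrD
  K0 c10 l0 umin ypE zpE mU.
move=> H; apply: (le_trans H); rewrite lee_fin -/(V st.2).
set h := mean_grad P g (xx k st).
have -> : dot h (Phi st.2 - u) = dot h (Phi st.2 - xx k st) + dot h (xx k st - u).
  by rewrite -dotDr addrA subrK.
have hf v : f (xx k st) - dot h (xx k st - v) <= f v.
  by have := convex_f_grad n0 pb (xx k st) v; rewrite -(opprB (xx k st)) dotNr.
have vvV : dot (Phi st.2 - u) (Phi st.2 - u) <= 2 * V st.2.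
  have := bregman_ge p12 proxP (Phi st.2) u; rewrite -/(V st.2).
  by rewrite -(opprB (Phi st.2)) dotNl dotNr opprK; lra.
have k20 : k.+2%:R != 0 :> R by rewrite pnatr_eq0.
have k2E : k.+2%:R = k%:R + 2 :> R by rewrite -addn2 natrD.
(* As [x] divides the segment from [y] to [z] in the ratio given by [tau], [z - x] is [k / 2] times
   [x - y], and [al k * k / 2 = ck k]. *)
have coup : al k * dot h (Phi st.2 - xx k st) = ck k * dot h (xx k st - (st.1 : 'rV[R]_n)).
  rewrite /xx /ardfds_tau !dotBr !dotDr !dotZr alE /ck /D0 k2E.
  by field; rewrite -k2E k20 !gt_eqF.
rewrite /energy alE; rewrite alE in coup.
have mR : 0 < m%:R :> R by rewrite ltr0n.
have C := coupling_step (sigma ^+ 2) B (ler0n R k) nR NR mR rh0 L20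
  (dotxx_ge0 h) (umin st.1) vvV (hf u) (hf st.1) coup.
apply: C.
Qed.

Let bnd := fix bnd (k : nat) : R := if k is k'.+1 then
  (1 + k'.+2%:R / (N%:R * (N%:R + 3))) * bnd k' + (k'.+2%:R ^+ 2 * r1 + k'.+2%:R * r2)
  else Theta.

Let M0 : 0 < N%:R * (N%:R + 3) :> R.
Proof. by rewrite mulr_gt0// addr_gt0. Qed.

Let Theta0 : 0 <= Theta.
Proof. exact: (le_trans (bregman_ge0 p12 proxP _ _) uTheta). Qed.

Let bnd_ge0 k : 0 <= bnd k.
Proof.
elim: k => [|k IH] //=; apply: addr_ge0.
  by apply: mulr_ge0 => //; apply: addr_ge0 => //; apply: divr_ge0 => //; exact: ltW.
by apply: addr_ge0; apply: mulr_ge0 => //; exact: sqr_ge0.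
Qed.

Let measurable_state_Q k : (k <= N)%N -> measurable_fun setT (state k : T -> S).
Proof.
move=> kN; have mi := measurable_id_joint (J := past k) Gm.
have ms : measurable_fun [set: TJ (past k)] (state k : _ -> S) by exact: measurable_state.
exact: (measurableT_comp ms mi).
Qed.

(** In [phi] the past enters only through the state and the present through a separate outcome;
    [tonelli_indep] then exposes an inner integral that [iteration] bounds. *)
Let energy_bound k : (k <= N)%N ->
  (\int[Q]_w (energy (ck k) (state k w))%:E <= (bnd k)%:E)%E.
Proof.
elim: k => [|k IH] kN.
  have -> : (fun w => (energy (ck 0) (state 0%N w))%:E) = fun=> (bregman prox x0 u)%:E.
    apply/funext => w; rewrite /energy /ck !mul0r add0r /V /state /= gradK.
    by rewrite (ardfds_z0 alg).
  rewrite integral_cst//; apply: (@le_trans _ _ ((bregman prox x0 u)%:E * 1)%E).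
    by apply: lee_wpmul2l; [rewrite lee_fin; exact: bregman_ge0 p12 proxP _ _|exact: probability_le1].
  by rewrite mule1 lee_fin.
have {}IH := IH (ltnW kN); pose ko := Ordinal kN.
pose a' : R := (k%:R + 2) / (N%:R * (N%:R + 3)).
pose r' : R := (k%:R + 2) ^+ 2 * r1 + (k%:R + 2) * r2.
have k2E : k.+2%:R = k%:R + 2 :> R by rewrite -addn2 natrD.
pose K := (k%:R + 2) ^+ 2 / D0.
have K0 : 0 <= K by apply: divr_ge0; [exact: sqr_ge0|exact: ltW].
have a'0 : 0 <= a' by apply: divr_ge0; [exact: addr_ge0|exact: ltW].
have r'0 : 0 <= r'.
  by apply: addr_ge0; [apply: mulr_ge0 => //; exact: sqr_ge0|apply: mulr_ge0 => //; exact: addr_ge0].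
pose phi (v : S * TJ (present ko)) : \bar R :=
  (energy K (nextS k v.1 (e ko v.2) (fun i => xi ko i v.2)))%:E.
have mst := measurable_state_Q (ltnW kN).
have mphi : measurable_fun setT phi.
  apply/measurable_EFinP; apply: measurable_energy; apply: measurable_nextS => //.
  - have me' : measurable_fun [set: TJ (present ko)] (e ko : _ -> borel_rV R n).
      by apply: me_J; rewrite inE /= eqxx.
    exact: (measurableT_comp me' measurable_snd).
  - move=> i; have mx' : measurable_fun [set: TJ (present ko)] (xi ko i : _ -> X).
      by apply: mxi_J; rewrite inE /= eqxx.
    exact: (measurableT_comp mx' measurable_snd).
have phi0 v : (0 <= phi v)%E by rewrite lee_fin; exact: energy_ge0.
have mid := measurable_id_joint (J := present ko) Gm.
have ind : indep2 Q (state k : T -> S) (id : T -> TJ (present ko)).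
  apply: (@indep2_joint _ _ _ _ G _ _ _ _ _ (past k) (present ko) _ _ GT GI Gm GQ).
  - by apply: disj => -[l|[l i]]; rewrite !inE => lk /eqP lE; rewrite lE ltnn in lk.
  - exact: measurable_state (ltnW kN) _.
  - exact: measurable_id.
have menergy c k' : (k' <= N)%N ->
    measurable_fun setT (fun w => (energy c (state k' w))%:E).
  by move=> k'N; apply/measurable_EFinP; apply: measurable_energy; exact: measurable_state_Q.
(* The weight [ck k.+1] is raised here to [(k + 2)^2 / D0]. *)
apply: (@le_trans _ _ (\int[Q]_w phi (state k w, w))%E).
  apply: ge0_le_integral => //.
  - by move=> w _; rewrite lee_fin; exact: energy_ge0.
  - exact: menergy.
  - have := menergy K k.+1 kN; congr measurable_fun; apply/funext => w.
    by rewrite /phi (state_next ko).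
  - move=> w _; rewrite lee_fin /phi -(state_next ko) /energy lerD2r.
    apply: ler_wpM2r; first by rewrite subr_ge0; exact: umin.
    rewrite /ck /K ler_pM2r ?invr_gt0// -natr1; have := ler0n R k; nra.
rewrite (tonelli_indep mst mid ind mphi phi0).
apply: (@le_trans _ _ (\int[Q]_w ((1 + a')%:E * (energy (ck k) (state k w))%:E + r'%:E))%E).
  apply: ge0_le_integral => //.
  - by move=> w _; exact: integral_ge0.
  - exact: (measurable_partial_integral Q mst mid mphi phi0).
  - apply: emeasurable_funD => //; apply: measurable_funeM.
    exact: (menergy _ _ (ltnW kN)).
  - by move=> w _; exact: (iteration ko (state k w)).
rewrite ge0_integralD//; last 2 first.
- by move=> w _; apply: mule_ge0; rewrite lee_fin; [exact: addr_ge0|exact: energy_ge0].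
- by apply: measurable_funeM; exact: (menergy _ _ (ltnW kN)).
rewrite ge0_integralZl//; last 3 first.
- exact: (menergy _ _ (ltnW kN)).
- by move=> w _; rewrite lee_fin; exact: energy_ge0.
- by rewrite lee_fin addr_ge0.
rewrite integral_cst//=.
have QT : (r'%:E * Q setT <= r'%:E)%E.
  apply: (@le_trans _ _ (r'%:E * 1)%E); last by rewrite mule1.
  by apply: lee_wpmul2l => //; exact: probability_le1.
apply: (le_trans (leeD (lexx _) QT)).
have bE : bnd k.+1 = (1 + a') * bnd k + r' by rewrite /= k2E.
apply: (@le_trans _ _ ((1 + a') * bnd k + r')%:E); last by rewrite -bE.
rewrite [leRHS]EFinD [in leRHS]EFinM; apply: leeD => //; apply: lee_wpmul2l => //.
by rewrite lee_fin addr_ge0.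
Qed.

(** The energy at [N] dominates [ck N] times the gap, and [ck N] is positive. Integrability of
    [f (y N)] is read off the same inequality. *)
Lemma ardfds_rate :
  (('E_Q[fun w => f (y N w)] - (f u)%:E) <=
   (384 * n%:R ^+ 2 * rho n q * L2 * Theta / N%:R ^+ 2
    + 384 * N%:R / (n%:R * L2) * (sigma ^+ 2 / m%:R)
    + 6 * N%:R / L2 * (L2 ^+ 2 * t ^+ 2 + 16 * Delta ^+ 2 / t ^+ 2)
    + N%:R ^+ 2 / (24 * n%:R * rho n q * L2)
        * (L2 ^+ 2 * t ^+ 2 + 16 * Delta ^+ 2 / t ^+ 2))%:E)%E.
Proof.
have ckN : 0 < ck N.
  by rewrite divr_gt0// mulr_gt0// addr_gt0.
have mE : measurable_fun setT (fun w => energy (ck N) (state N w)).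
  by apply: measurable_energy; exact: measurable_state_Q.
have E0 w : 0 <= energy (ck N) (state N w) by exact: energy_ge0.
have [iE leE] := le_fine_integral_nneg mE E0 (energy_bound (leqnn N)).
have mf : measurable_fun setT (fun w => f (y N w)).
  exact: (measurableT_comp measurable_f
    (measurableT_comp measurable_fst (measurable_state_Q (leqnn N)))).
have gap w : ck N * (f (y N w) - f u) <= energy (ck N) (state N w).
  by rewrite /energy lerDl.
have fu w : 0 <= f (y N w) - f u by rewrite subr_ge0; exact: umin.
have ig : integ Q (fun w => f (y N w) - f u).
  apply: (integ_le _ (integZ (ck N)^-1 iE)); first exact: measurable_funB.
  by apply: aeW => w; rewrite ger0_norm// ler_pdivlMl.
have iy : integ Q (fun w => f (y N w)).
  have := integD ig (integ_cst Q (f u)).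
  by under eq_fun do rewrite subrK.
have mgap : ck N * mean Q (fun w => f (y N w) - f u) <= bnd N.
  rewrite -meanZ//; apply: le_trans leE; apply: mean_le => //; last exact: integZ.
  exact: aeW.
have bndN : bnd N <= 2 * (Theta + N%:R * (N%:R + 1) ^+ 2 * r1 + N%:R * (N%:R + 3) / 2 * r2).
  exact: perturbed_recursion_bound.
rewrite unlock EFin_mean// -EFinB lee_fin.
have -> : mean Q (fun w => f (y N w)) - f u = mean Q (fun w => f (y N w) - f u).
  by rewrite meanB ?mean_cst//; exact: integ_cst.
exact: (final_rate n0 N0 m0 rh0 L20 Theta0 (sqr_ge0 sigma) B0 (le_trans mgap bndN)).
Qed.

End Process.

(** [Delta] dominates an absolute value outside a null set of a probability measure. *)
Lemma oracle_noise_ge0 (R : realType) (n : nat) (d : measure_display) (X : measurableType d)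
    (P : probability X R) (eta : 'rV[R]_n -> X -> R) (Delta : R) :
  oracle_noise P eta Delta -> 0 <= Delta.
Proof.
move=> [_ noise]; rewrite -(mean_cst P Delta); apply: mean_ge0; last exact: integ_cst.
by apply: filterS noise => xi /(_ 0); exact: le_trans.
Qed.

Theorem theorem2p2 (R : realType) (n : nat) (p : R) (q : \bar R) (N m : nat)
    (d : measure_display) (X : measurableType d) (P : probability X R)
    (F eta : 'rV[R]_n -> X -> R) (f : 'rV[R]_n -> R)
    (g : 'rV[R]_n -> X -> 'rV[R]_n) (L : X -> R) (L2 sigma Delta t Theta : R)
    (prox : 'rV[R]_n -> R) (x0 xstar : 'rV[R]_n)
    (d' : measure_display) (Omega : measurableType d') (Q : probability Omega R)
    (e : 'I_N -> {mfun Omega >-> borel_rV R n})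
    (xi : 'I_N -> 'I_m -> {mfun Omega >-> X})
    (x y z : nat -> Omega -> 'rV[R]_n) :
  (8 <= n)%N ->
  1 <= p <= 2 ->
  (2%:E <= q)%E ->
  ((p^-1)%:E + q^-1 = 1)%E ->
  (1 <= N)%N ->
  (1 <= m)%N ->
  0 < t ->
  stochastic_problem P F f g L L2 sigma ->
  oracle_noise P eta Delta ->
  prox_function p prox ->
  ardfds_sampling Q P e xi ->
  ardfds (oracle F eta) prox q L2 t x0 e xi x y z ->
  minimizer f xstar ->
  bregman prox x0 xstar <= Theta ->
  ('E_Q[fun w => f (y N w)] - (f xstar)%:E <=
    (384 * n%:R ^+ 2 * rho n q * L2 * Theta / N%:R ^+ 2
     + 384 * N%:R / (n%:R * L2) * (sigma ^+ 2 / m%:R)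
     + 12 * Num.sqrt (2 * n%:R * Theta) / N%:R ^+ 2
         * (L2 * t / 2 + 2 * Delta / t)
     + 6 * N%:R / L2 * (L2 ^+ 2 * t ^+ 2 + 16 * Delta ^+ 2 / t ^+ 2)
     + N%:R ^+ 2 / (24 * n%:R * rho n q * L2)
         * (L2 ^+ 2 * t ^+ 2 + 16 * Delta ^+ 2 / t ^+ 2))%:E)%E.
Proof.
move=> n8 p12 q2 pq N0 m0 t0 pb noise proxP samp alg xmin xTheta.
have [a [b [k [a0 b0 dualD rhoD]]]] := dual_bound n8 p12 q2 pq.
have [Phi [PhiK gradK Phi_lip]] := mirror_map p12 proxP.
apply: (le_trans (ardfds_rate n8 p12 q2 N0 m0 t0 pb noise proxP samp alg xmin xTheta
  PhiK gradK Phi_lip a0 b0 dualD rhoD)).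
(* [ardfds_rate] bounds the gap by the other four terms, the bias towards the minimizer being
   absorbed by Young's inequality; the term with [Num.sqrt] is nonnegative. *)
rewrite lee_fin !lerD2r lerDl.
have L20 := L2_gt0 pb; have D0 := oracle_noise_ge0 noise.
apply: mulr_ge0.
  by apply: divr_ge0; [apply: mulr_ge0 => //; exact: sqrtr_ge0|exact: sqr_ge0].
apply: addr_ge0; apply: divr_ge0 => //; try exact: ltW.
  by apply: mulr_ge0; exact: ltW.
exact: mulr_ge0.
Qed.
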